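(* Let $m\ge1$. The sum of the degrees of the complex irreducible characters $\chi^{\boldsymbol\lambda}$ of $U_{2m}$ corresponding to $\Theta$-partitions $\boldsymbol\lambda$ such that $\boldsymbol\lambda'$ is even is given by $$\sum_{\substack{\|\boldsymbol\lambda\|=2m\\ \boldsymbol\lambda'\text{ even}}}\chi^{\boldsymbol\lambda}(1)=(q+1)\,q^2\,(q^3+1)\cdots q^{2m-2}\,(q^{2m-1}+1).$$
   Context: **Groups and characters.** $q$ is a prime power, $\mathbb K=\overline{\mathbb F}_q$, $\mathbb K_2=\mathbb F_{q^2}$. Let $F$ be the map on $\mathrm{GL}(n,\mathbb K)$ sending $(a_{ij})$ to the inverse of the matrix $(a_{ji}^q)$, and let $U_n=\mathrm{U}(n,\mathbb F_{q^2})=\{a\in\mathrm{GL}(n,\mathbb K): F(a)=a\}$. Let $\mathbb M_m=\{x\in\mathbb K^\times: x^{q^m-(-1)^m}=1\}$ and $\mathbb M_m^*=\mathrm{Hom}(\mathbb M_m,\mathbb C^\times)$. For $r\mid m$ let $N_{mr}:\mathbb M_m\to\mathbb M_r$, $x\mapsto\prod_{j=0}^{m/r-1}x^{(-q)^{rj}}$, and let $\mathbb K^*=\varinjlim\mathbb M_m^*$ with transition maps $\xi\mapsto\xi\circ N_{mr}$; each $\mathbb M_m^*$ is regarded as a subgroup of $\mathbb K^*$. $F$ acts on $\mathbb K^\times$ by $x\mapsto x^{-q}$ and on $\mathbb K^*$ by $\xi\mapsto\xi^{-q}$. $\Theta$ is the set of $F$-orbits in $\mathbb K^*$; $|\varphi|$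 is the size of $\varphi\in\Theta$. $\Phi$ is the set of polynomials $\prod_{y\in O}(t-y)$ for $O$ an $F$-orbit in $\mathbb K^\times$ (these lie in $\mathbb K_2[t]$); $d(f)$ is the degree of $f\in\Phi$. For $x\in\mathbb K^\times$, $f_x\in\Phi$ is the element with $f_x(x)=0$. **Multipartitions.** For $\mathcal X=\Phi$ or $\Theta$, an $\mathcal X$-partition $\boldsymbol\nu$ is a family of partitions $\boldsymbol\nu(x)$, $x\in\mathcal X$, with finitely many nonempty; $\|\boldsymbol\nu\|=\sum_x|x|\,|\boldsymbol\nu(x)|$, where $|x|=d(x)$ if $\mathcal X=\Phi$ and $|x|$ is the orbit size if $\mathcal X=\Theta$; $n(\boldsymbol\nu)=\sum_x|x|\,n(\boldsymbol\nu(x))$ with $n(\nu)=\sum_i(i-1)\nu_i$; the conjugate $\boldsymbol\nu'$ is given by $\boldsymbol\nu'(x)=\boldsymbol\nu(x)'$. $\mathcal P^{\mathcal X}$ is the set of $\mathcal X$-partitions and $\mathcal P^{\mathcal X}_n$ those with $\|\boldsymbol\nu\|=n$. A $\Theta$-partition $\boldsymbol\lambda$ is even if every part of $\boldsymbol\lambda(\varphi)$ is even for every $\varphi\in\Theta$. **Conjugacy classes.** For $\boldsymbol\mu\in\mathcal P_n^\Phi$, $c_{\boldsymbol\mu}$ is the conjugacy class of those $g\in U_n$ for which $\mathbb K_2^n$, with $t$ acting as $g$, is isomorphic to $\bigoplus_{f,i}\mathbb K_2[t]/(f^{\boldsymbol\mu(f)_i})$ as a $\mathbb K_2[t]$-module;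 every conjugacy class of $U_n$ is a unique $c_{\boldsymbol\mu}$. $\pi_{\boldsymbol\mu}$ is the indicator function of $c_{\boldsymbol\mu}$. **Symmetric functions and characteristic map.** For each $f\in\Phi$ take an independent infinite set of variables $X^{(f)}$, and write $h(f)=h(X^{(f)})$ for a symmetric function $h$. With $P_\mu(X;t)$ the Hall–Littlewood symmetric functions, put $$P_{\boldsymbol\mu}=(-q)^{-n(\boldsymbol\mu)}\prod_{f\in\Phi}P_{\boldsymbol\mu(f)}\bigl(f;(-q)^{-d(f)}\bigr),\qquad \Lambda=\mathbb C\text{-span}\{P_{\boldsymbol\mu}:\boldsymbol\mu\in\mathcal P^\Phi\}.$$ For $\varphi\in\Theta$, $n\ge1$, define $p_n(\varphi)\in\Lambda$ by $$p_n(\varphi)=(-1)^{n|\varphi|-1}\sum_{x\in\mathbb M_{n|\varphi|}}\xi(x)\,p_{n|\varphi|/d(f_x)}(f_x),\qquad \xi\in\varphi,$$ (independent of the choice of $\xi\in\varphi$), and for any symmetric function $h$ let $h(\varphi)\in\Lambda$ be obtained by writing $h$ as a polynomial in the power sums $p_n$ and replacing each $p_n$ by $p_n(\varphi)$. With $s_\lambda$ the Schur functions, put $s_{\boldsymbol\lambda}=\prod_{\varphi\in\Theta}s_{\boldsymbol\lambda(\varphi)}(\varphi)$ for $\boldsymbol\lambda\in\mathcal P^\Theta$. Let $C_n$ be the space of complex class functions on $U_n$ and $C=\bigoplus_{n\ge0}C_n$. The characteristic map $\mathrm{ch}:C\to\Lambda$ is the linear isomorphism with $\mathrm{ch}(\pi_{\boldsymbol\mu})=P_{\boldsymbol\mu}$.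 **Irreducible characters.** For $\boldsymbol\lambda\in\mathcal P_n^\Theta$, $\chi^{\boldsymbol\lambda}\in C_n$ denotes the class function with $\chi^{\boldsymbol\lambda}(1)>0$ and $\mathrm{ch}(\chi^{\boldsymbol\lambda})=\pm s_{\boldsymbol\lambda}$; it is known that $\{\chi^{\boldsymbol\lambda}:\boldsymbol\lambda\in\mathcal P_n^\Theta\}$ is the set of irreducible characters of $U_n$. *)

(* Defs.v *)
From HB Require Import structures.
From mathcomp Require Import all_boot all_order all_algebra all_fingroup.
From mathcomp Require Import all_solvable all_field all_character
  finmap.
From mathcomp Require Import generic_quotient qpoly fraction.
From mathcomp Require Import boolp classical_sets functions cardinality fsbigop.
From mathcomp Require Import -(notations) monalg.
From mathcomp Require Import mpoly.

Set Implicit Arguments.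
Unset Strict Implicit.
Unset Printing Implicit Defensive.

Import Order.TTheory GRing.Theory Num.Theory.
Local Open Scope classical_set_scope.
Local Open Scope ring_scope.
Local Open Scope quotient_scope.

Definition is_intpart (s : seq nat) : bool := sorted geq s && (0%N \notin s).

Record intpart := IntPart { parts :> seq nat; _ : is_intpart parts }.
HB.instance Definition _ := [isSub for parts].
HB.instance Definition _ := [Choice of intpart by <:].

Definition intpart0 : intpart := @IntPart [::] isT.

Definition conj_seq (s : seq nat) : seq nat :=
  [seq count (fun a => (j < a)%N) s | j <- iota 0 (\max_(a <- s) a)].

Lemma conj_seq_subproof (s : seq nat) : is_intpart (conj_seq s).
Proof.
rewrite /is_intpart /conj_seq; apply/andP; split.
  rewrite sorted_map; apply: (@sub_sorted _ ltn); last exact: iota_ltn_sorted.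
  by move=> i j ij; apply: sub_count => a; apply: ltn_trans.
apply/negP => /mapP[j]; rewrite mem_iota add0n => /andP[_ jlt] /esym/eqP.
apply/negP; rewrite -lt0n -has_count; apply: contraTT jlt => /hasPn nh.
rewrite -leqNgt; apply/bigmax_leqP_seq => a /nh; rewrite -leqNgt; exact.
Qed.

Definition conj_part (la : intpart) : intpart :=
  IntPart (conj_seq_subproof la).

(* n(la) = sum_i (i-1) la_i, with parts numbered from 0 here *)
Definition npart (la : seq nat) : nat := (\sum_(i < size la) i * nth 0 la i)%N.

Definition multipart (X : choiceType) := {fsfun X -> intpart with intpart0}.

Section Multipartitions.
Variables (X : choiceType) (wt : X -> nat).
Implicit Types nu : multipart X.

Definition mp_norm nu : nat := (\sum_(x <- finsupp nu) wt x * sumn (nu x))%N.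

Definition mp_n nu : nat := (\sum_(x <- finsupp nu) wt x * npart (nu x))%N.

Definition mp_conj nu : multipart X :=
  [fsfun x in finsupp nu => conj_part (nu x)].

Definition mp_even nu : Prop := forall x, all (fun a => ~~ odd a) (nu x).

End Multipartitions.

(* A symmetric function in x_0, x_1, ... is given by its truncations to
   x_0, ..., x_{N-1}, for all N. *)
Definition symfun := forall N : nat, {mpoly algC[N]}.

Definition psum (k : nat) : symfun := fun N => \sum_(i < N) 'X_i ^+ k.

Definition poly_of_frac N (r : {fraction {mpoly algC[N]}}) : {mpoly algC[N]} :=
  xget 0 [set p | FracField.tofrac p = r].

Section SchurHallLittlewood.
Variable N : nat.
Local Notation x := (fun i : 'I_N => FracField.tofrac ('X_i : {mpoly algC[N]})).

Definition schur_frac (la : seq nat) : {fraction {mpoly algC[N]}} :=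
  \det (\matrix_(i < N, j < N) x i ^+ (nth 0%N la j + (N - j.+1)))
  / \det (\matrix_(i < N, j < N) x i ^+ (N - j.+1)).

Definition HL_v1 (t : algC) (m : nat) : algC :=
  \prod_(1 <= i < m.+1) ((1 - t ^+ i) / (1 - t)).

(* the zero part of la has multiplicity N - size la *)
Definition HL_v (t : algC) (la : seq nat) : algC :=
  HL_v1 t (N - size la) * \prod_(a <- undup la) HL_v1 t (count_mem a la).

Definition HL_frac (t : algC) (la : seq nat) : {fraction {mpoly algC[N]}} :=
  FracField.tofrac (mpolyC N (HL_v t la)^-1) *
  \sum_(w : 'S_N)
    (\prod_(i < N) x (w i) ^+ nth 0%N la i) *
    \prod_(i < N) \prod_(j < N | (i < j)%N)
       ((x (w i) - FracField.tofrac (mpolyC N t) * x (w j))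
        / (x (w i) - x (w j))).

End SchurHallLittlewood.

Definition schur (la : intpart) : symfun := fun N =>
  if (size la <= N)%N then poly_of_frac (schur_frac N la) else 0.

(* P_la(X; t) *)
Definition hall_littlewood (t : algC) (la : intpart) : symfun := fun N =>
  if (size la <= N)%N then poly_of_frac (HL_frac N t la) else 0.

(* h = Qh(p_1, ..., p_D) *)
Definition is_pexpansion (h : symfun) (D : nat) (Qh : {mpoly algC[D]}) : Prop :=
  forall N, h N = mmap (@mpolyC N algC) (fun i : 'I_D => psum i.+1 N) Qh.

Definition forbit (T : Type) (h : T -> T) (x : T) : set T :=
  [set iter j h x | j in [set: nat]].

(* q is #|Fq|, and K is to be an algebraic closure of Fq; that K is algebraic
   over Fq is not needed for the definitions. *)
Section Unitary.
Variables (Fq : finFieldType) (K : closedFieldType) (io : {rmorphism Fq -> K}).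

Local Notation q := #|Fq|.

Fact card_pnat : [pchar K].-nat q.
Proof.
have [p pr_p pF] := finPcharP Fq.
have pK : p \in [pchar K] by rewrite (fmorph_pchar io).
have /p_natP[e ->] : p.-nat q.
  have := fin_ring_pchar_abelem pF => /abelem_pgroup.
  by rewrite /pgroup cardsT.
rewrite pnatX; apply/orP; left; by rewrite pnatE.
Qed.

Fact card_gt0 : (0 < q)%N. Proof. by apply/card_gt0P; exists 0. Qed.

Definition inK2 of {rmorphism Fq -> K} : {pred K} := fun x => x ^+ (q ^ 2) == x.

Fact inK2_divring_closed : divring_closed (inK2 io).
Proof.
have q2 : [pchar K].-nat (q ^ 2)%N by rewrite pnatX card_pnat.
split=> [|x y|x y]; rewrite !unfold_in /=.
- by rewrite expr1n.
- by move=> /eqP xE /eqP yE; rewrite exprDn_pchar // exprNn_pchar // xE yE.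
- by move=> /eqP xE /eqP yE; rewrite exprMn exprVn xE yE.
Qed.
HB.instance Definition _ :=
  GRing.isDivringClosed.Build K (inK2 io) inK2_divring_closed.

Record K2 := MkK2 { K2val : K; K2valP : K2val \in inK2 io }.
HB.instance Definition _ := [isSub for K2val].
HB.instance Definition _ := [Choice of K2 by <:].
HB.instance Definition _ := [SubChoice_isSubComUnitRing of K2 by <:].
HB.instance Definition _ := [SubComUnitRing_isSubIntegralDomain of K2 by <:].
HB.instance Definition _ := [SubIntegralDomain_isSubField of K2 by <:].

Fact K2_finite : {s : seq K2 | finite_axiom s}.
Proof.
pose P : {poly K} := 'X^(q ^ 2) - 'X.
have [r Pr] := closed_field_poly_normal P.
have q2gt1 : (1 < q ^ 2)%N by rewrite -(exp1n 2) ltn_exp2r // finNzRing_gt1.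
have lP : lead_coef P = 1.
  by rewrite lead_coefDl ?lead_coefXn // size_polyXn size_polyN size_polyX.
rewrite lP scale1r in Pr.
exists (undup (pmap insub r)); move=> x.
rewrite count_uniq_mem ?undup_uniq // mem_undup mem_pmap_sub.
suff -> : val x \in r by [].
rewrite -root_prod_XsubC -Pr /root !hornerE /=.
by have := K2valP x; rewrite unfold_in => /eqP ->; rewrite subrr.
Qed.

Let K2_enum := sval K2_finite.

Fact K2_pcancel : pcancel (fun x : K2 => index x K2_enum) (onth K2_enum).
Proof.
move=> x; have := svalP K2_finite x; rewrite -/K2_enum => xs.
have xin : x \in K2_enum by rewrite -has_pred1 has_count xs.
by rewrite onthE (nth_map x) ?index_mem // nth_index.
Qed.
HB.instance Definition _ := PCanIsCountable K2_pcancel.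
HB.instance Definition _ := isFinite.Build K2 (svalP K2_finite).

(* the map F on GL(n, K) *)
Definition Fmx n (a : 'M[K]_n) : 'M[K]_n := invmx (\matrix_(i, j) a j i ^+ q).

Definition is_unitary n (a : 'M[K2]_n) : bool :=
  let b := map_mx val a in (b \in unitmx) && (Fmx b == b).

(* F-fixed matrices over K have their entries in K_2: [unitary_over_K2] below *)
Record unitary n := Unitary { umx :> 'M[K2]_n; umxP : is_unitary umx }.
HB.instance Definition _ n := [isSub for @umx n].
HB.instance Definition _ n := [Finite of unitary n by <:].

Lemma Frob_mulmx n (a b : 'M[K]_n) :
  (\matrix_(i, j) (a *m b) j i ^+ q) =
  (\matrix_(i, j) b j i ^+ q) *m (\matrix_(i, j) a j i ^+ q) :> 'M[K]_n.
Proof.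
apply/matrixP=> i j; rewrite !mxE.
have sumq (r : seq 'I_n) (G : 'I_n -> K) :
    (\sum_(k <- r) G k) ^+ q = \sum_(k <- r) G k ^+ q.
  elim: r => [|k r IH]; first by rewrite !big_nil expr0n eqn0Ngt card_gt0.
  by rewrite !big_cons exprDn_pchar ?card_pnat // IH.
by rewrite sumq; apply: eq_bigr => k _; rewrite !mxE exprMn mulrC.
Qed.

Lemma Frob_mx1 n : (\matrix_(i, j) (1%:M : 'M[K]_n) j i ^+ q) = 1%:M :> 'M[K]_n.
Proof.
apply/matrixP=> i j; rewrite !mxE eq_sym; case: eqP => _; first exact: expr1n.
by rewrite expr0n eqn0Ngt card_gt0.
Qed.

Lemma is_unitaryE n (a : 'M[K2]_n) : is_unitary a =
  (map_mx val a *m (\matrix_(i, j) (map_mx val a) j i ^+ q) == 1%:M :> 'M[K]_n).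
Proof.
rewrite /is_unitary /Fmx; set b := map_mx val a; set c := \matrix_(i, j) _.
apply/andP/eqP => [[ub /eqP Fb]|bc].
  have uc : c \in unitmx by rewrite -unitmx_inv Fb.
  by rewrite -{1}Fb mulVmx.
have [ub uc] := mulmx1_unit bc; split=> //; apply/eqP.
by rewrite -[LHS]mul1mx -bc -mulmxA mulmxV // mulmx1.
Qed.

Fact unitary_mul_subproof n (a b : unitary n) : is_unitary (a *m b).
Proof.
have := umxP a; have := umxP b; rewrite (is_unitaryE (umx a)) (is_unitaryE (umx b)) => /eqP ub /eqP ua.
rewrite (is_unitaryE (umx a *m umx b)) map_mxM Frob_mulmx.
by rewrite -mulmxA (mulmxA (map_mx _ (umx b))) ub mul1mx ua.
Qed.

Fact unitary_one_subproof n : is_unitary (1%:M : 'M[K2]_n).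
Proof. by rewrite (is_unitaryE 1%:M) map_mx1 Frob_mx1 mulmx1. Qed.

Fact unitary_inv_subproof n (a : unitary n) : is_unitary (invmx a).
Proof.
have ua : (a : 'M_n) \in unitmx.
  by have /andP[] := umxP a; rewrite map_unitmx.
have := umxP a; rewrite (is_unitaryE (umx a)) => /eqP aF.
rewrite (is_unitaryE (invmx a)); apply/eqP; set b := map_mx _ _; set c := \matrix_(i, j) _.
have ab : map_mx val a *m b = 1%:M by rewrite -map_mxM mulmxV // map_mx1.
have := Frob_mulmx (map_mx val a) b; rewrite ab Frob_mx1 -/c.
set d := \matrix_(i, j) _ => cd.
have bd : b = d.
  by rewrite -[LHS]mulmx1 -aF mulmxA (mulmx1C ab) mul1mx.
by rewrite bd; apply: mulmx1C; rewrite -cd.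
Qed.

Definition unitary_mul n (a b : unitary n) : unitary n :=
  Unitary (unitary_mul_subproof a b).
Definition unitary_one n : unitary n := Unitary (unitary_one_subproof n).
Definition unitary_inv n (a : unitary n) : unitary n :=
  Unitary (unitary_inv_subproof a).

Fact unitary_mulA n : associative (@unitary_mul n).
Proof. by move=> a b c; apply: val_inj; apply: mulmxA. Qed.
Fact unitary_mul1 n : left_id (unitary_one n) (@unitary_mul n).
Proof. by move=> a; apply: val_inj; apply: mul1mx. Qed.
Fact unitary_mulV n : left_inverse (unitary_one n) (@unitary_inv n) (@unitary_mul n).
Proof.
move=> a; apply: val_inj; apply: mulVmx.
by have /andP[] := umxP a; rewrite map_unitmx.
Qed.
HB.instance Definition _ n := Finite_isGroup.Build (unitary n)
  (@unitary_mulA n) (@unitary_mul1 n) (@unitary_mulV n).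

Lemma unitary_over_K2 n (b : 'M[K]_n) :
  b \in unitmx -> Fmx b = b -> exists a : unitary n, b = map_mx val (umx a).
Proof.
move=> ub Fb.
have uc : (\matrix_(i, j) b j i ^+ q : 'M[K]_n) \in unitmx.
  by rewrite -unitmx_inv -/(Fmx b) Fb.
have bc : b *m (\matrix_(i, j) b j i ^+ q) = 1%:M by rewrite -{1}Fb mulVmx.
have := Frob_mulmx b (\matrix_(i, j) b j i ^+ q); rewrite bc Frob_mx1.
set d := \matrix_(i, j) (\matrix_(i, j) _ : 'M_n) j i ^+ q => /esym dc.
have db : d = b by rewrite -[RHS]mul1mx -dc -mulmxA (mulmx1C bc) mulmx1.
have b2 i j : b i j \in inK2 io.
  have /matrixP/(_ i j) := db; rewrite /d !mxE -exprM => e.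
  by rewrite unfold_in -mulnn e.
pose a : 'M[K2]_n := \matrix_(i, j) MkK2 (b2 i j).
have ab : b = map_mx val a by apply/matrixP=> i j; rewrite !mxE.
have ua : is_unitary a by rewrite /is_unitary -ab ub Fb eqxx.
by exists (Unitary ua).
Qed.

Definition U (n : nat) : {group unitary n} := [set: unitary n]%G.

Definition FK (x : K) : K := x ^- q.

(* F has finite order on each of its orbits in K^x, so that [forbit FK x] is
   the full F-orbit of x. *)
Definition is_Phi (f : {poly K2}) : Prop := exists2 x : K, x != 0 &
  map_poly val f = \big[*%R/1]_(y \in forbit FK x) ('X - y%:P).

Record Phi := MkPhi { Phi_poly :> {poly K2}; PhiP : `[< is_Phi Phi_poly >] }.
HB.instance Definition _ := [isSub for Phi_poly].
HB.instance Definition _ := [Choice of Phi by <:].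

Definition degPhi (f : Phi) : nat := (size (f : {poly K2})).-1.

Fact Phi_one_subproof : `[< is_Phi ('X - 1) >].
Proof.
apply/asboolP; exists 1; rewrite ?oner_eq0 //.
have -> : forbit FK 1 = [set 1].
  apply/seteqP; split => [_ [j _ <-]|_ ->] /=; last by exists 0%N.
  by elim: j => //= j ->; rewrite /FK expr1n invr1.
by rewrite fsbig_set1 -[1 in LHS]polyC1 (map_polyXsubC (val : {rmorphism K2 -> K})).
Qed.

(* f_x, for x != 0 *)
Definition Phi_at (x : K) : Phi :=
  xget (MkPhi Phi_one_subproof) [set f : Phi | root (map_poly val (Phi_poly f)) x].

Definition elem_divisors (mu : multipart Phi) : seq {poly K2} :=
  [seq Phi_poly f ^+ k | f <- finsupp mu, k <- parts (mu f)].

(* K_2^n, with t acting as g, is isomorphic to the direct sum of the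
   K_2[t]/(h), h in hs, as a K_2[t]-module. *)
Definition has_module_type n (g : 'M[K2]_n) (hs : seq {poly K2}) : Prop :=
  exists psi : 'cV[K2]_n -> forall j : 'I_(size hs), {poly %/ hs`_j},
    [/\ bijective psi,
        forall a u v j, psi (a *: u + v) j = a *: psi u j + psi v j &
        forall v j, psi (g *m v) j = 'qX * psi v j].

Definition cclass n (mu : multipart Phi) : {set unitary n} :=
  [set g : unitary n | `[< has_module_type (umx g) (elem_divisors mu) >]]%SET.

Definition Mgrp (m : nat) : set K :=
  [set x | x != 0 /\ x ^ (q%:Z ^+ m - (-1) ^+ m) = 1].

Definition Nmap (m r : nat) (x : K) : K :=
  \prod_(j < m %/ r) x ^ ((- q%:Z) ^+ (r * j)).

(* Homomorphisms from M_m to C^x, extended by 0 to K *)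
Definition is_Mchar (m : nat) (xi : K -> algC) : Prop :=
  [/\ forall x y, Mgrp m x -> Mgrp m y -> xi (x * y) = xi x * xi y,
      forall x, Mgrp m x -> xi x != 0 &
      forall x, ~ Mgrp m x -> xi x = 0].

Record Mchar := MkMchar { Mchar_pair :> nat * (K -> algC);
  MkMcharP : `[< (0 < Mchar_pair.1)%N /\ is_Mchar Mchar_pair.1 Mchar_pair.2 >] }.
HB.instance Definition _ := [isSub for Mchar_pair].
HB.instance Definition _ := [Choice of Mchar by <:].

(* two characters have the same class in the direct limit K^* *)
Definition Mchar_equiv (a b : Mchar) : bool :=
  `[< exists k, [/\ (0 < k)%N, a.1 %| k, b.1 %| k &
     forall x, Mgrp k x -> a.2 (Nmap k a.1 x) = b.2 (Nmap k b.1 x)]%N >].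


Let Q : int := - q%:Z.
Let S (m r : nat) : int := \sum_(j < m %/ r) Q ^+ (r * j).

Let S_geom m r : (r %| m)%N -> (Q ^+ r - 1) * S m r = Q ^+ m - 1.
Proof.
move=> rm; rewrite -{2}(divnK rm) mulnC exprM [RHS]subrX1; congr (_ * _).
by apply: eq_bigr => j _; rewrite exprM.
Qed.

Let Q_neq1 r : (0 < r)%N -> Q ^+ r - 1 != 0.
Proof.
move=> r0; rewrite subr_eq0; apply/eqP => /(congr1 (fun z : int => `|z|%N)).
rewrite abszX abszN absz1 /= => /eqP.
by rewrite -(exp1n r) eqn_exp2r // gtn_eqF // finNzRing_gt1.
Qed.

Let MgrpE m x : Mgrp m x <-> x != 0 /\ x ^ (Q ^+ m - 1) = 1.
Proof.
rewrite /Mgrp /=.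
have -> : q%:Z ^+ m - (-1) ^+ m = (Q ^+ m - 1) * (-1) ^+ m :> int.
  by rewrite mulrBl mul1r /Q -exprMn mulrN1 opprK.
split=> -[x0 h]; split=> //; last by rewrite -exprz_exp h exp1rz.
have := congr1 (fun y => y ^ ((-1) ^+ m : int)) h.
by rewrite /= exprz_exp -mulrA -exprMn mulrNN mulr1 expr1n mulr1 exp1rz.
Qed.

Let NmapE m r x : x != 0 -> Nmap m r x = x ^ S m r.
Proof.
move=> x0; rewrite /Nmap /S; elim/big_rec2: _ => [|j y z _ ->].
  by rewrite expr0z.
by rewrite expfzDr.
Qed.

Fact Nmap_neq0 m r x : x != 0 -> Nmap m r x != 0.
Proof. by move=> x0; rewrite NmapE // expfz_neq0. Qed.

Fact Nmap_id m x : (0 < m)%N -> Nmap m m x = x.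
Proof. by move=> m0; rewrite /Nmap divnn m0 big_ord1 muln0 expr0 expr1z. Qed.

Fact Nmap_comp m s r x : (0 < r)%N -> (r %| s)%N -> (s %| m)%N -> x != 0 ->
  Nmap s r (Nmap m s x) = Nmap m r x.
Proof.
move=> r0 rs sm x0; rewrite !NmapE ?expfz_neq0 // exprz_exp; congr (_ ^ _).
apply: (mulfI (Q_neq1 r0)).
by rewrite mulrCA S_geom // mulrC S_geom // S_geom // (dvdn_trans rs).
Qed.

Fact Nmap_Mgrp m r x : (r %| m)%N -> Mgrp m x -> Mgrp r (Nmap m r x).
Proof.
move=> rm /MgrpE[x0 xm]; apply/MgrpE; split; first exact: Nmap_neq0.
by rewrite NmapE // exprz_exp mulrC S_geom.
Qed.

Fact Mchar_equiv_refl : reflexive Mchar_equiv.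
Proof.
move=> a; apply/asboolP; exists a.1.
by have /asboolP[a0 _] := MkMcharP a; split.
Qed.

Fact Mchar_equiv_sym : ssrbool.symmetric Mchar_equiv.
Proof.
move=> a b; apply/asboolP/asboolP=> -[k [k0 ak bk e]];
  by exists k; split=> // x /e ->.
Qed.

Fact Mchar_equiv_trans : transitive Mchar_equiv.
Proof.
move=> b a c /asboolP[k [k0 ak bk ek]] /asboolP[l [l0 bl cl el]].
have /asboolP[a0 _] := MkMcharP a; have /asboolP[b0 _] := MkMcharP b.
have /asboolP[c0 _] := MkMcharP c.
have kL := dvdn_lcml k l; have lL := dvdn_lcmr k l.
apply/asboolP; exists (lcmn k l); split.
- by rewrite lcmn_gt0 k0.
- exact: dvdn_trans kL.
- exact: dvdn_trans lL.
move=> x Mx; have /MgrpE[x0 _] := Mx.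
rewrite -(Nmap_comp a0 ak kL x0) -(Nmap_comp c0 cl lL x0).
rewrite ek; last exact: Nmap_Mgrp.
rewrite -el; last exact: Nmap_Mgrp.
by rewrite !Nmap_comp.
Qed.

Definition Mchar_equiv_rel :=
  EquivRel Mchar_equiv Mchar_equiv_refl Mchar_equiv_sym Mchar_equiv_trans.

Definition Kdual := {eq_quot Mchar_equiv_rel}.
HB.instance Definition _ := Choice.on Kdual.

(* For xi in the subgroup M_k^* of K^*, the corresponding function on M_k *)
Definition Kdual_at (k : nat) (xi : Kdual) : K -> algC :=
  xget (fun=> 0) [set eta | exists a : Mchar,
    Mchar_pair a = (k, eta) /\ \pi_Kdual a = xi].

Definition Mchar_F_pair (a : Mchar) : nat * (K -> algC) :=
  (a.1, fun x => a.2 x ^- q).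

Fact Mchar_F_subproof (a : Mchar) :
  `[< (0 < (Mchar_F_pair a).1)%N /\
      is_Mchar (Mchar_F_pair a).1 (Mchar_F_pair a).2 >].
Proof.
have /asboolP[a0 [aM an az]] := MkMcharP a; apply/asboolP; split=> //; split=> /=.
- by move=> x y Mx My; rewrite aM // exprMn invfM.
- by move=> x Mx; rewrite invr_eq0 expf_neq0 // an.
- by move=> x Mx; rewrite az // expr0n gtn_eqF ?card_gt0 // invr0.
Qed.

Definition Mchar_F (a : Mchar) : Mchar := MkMchar (Mchar_F_subproof a).

Definition Kdual_F (xi : Kdual) : Kdual := \pi_Kdual (Mchar_F (repr xi)).

Lemma Kdual_F_pi (a : Mchar) : Kdual_F (\pi_Kdual a) = \pi_Kdual (Mchar_F a).
Proof.
rewrite /Kdual_F; apply/eqmodP/asboolP.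
have /eqmodP/asboolP[k [k0 ak bk e]] : \pi_Kdual (repr (\pi_Kdual a)) = \pi_Kdual a.
  by rewrite reprK.
by exists k; split=> //= x Mx; rewrite e.
Qed.

Definition is_Theta (phi : set Kdual) : Prop :=
  exists xi : Kdual, phi = forbit Kdual_F xi.

Record Theta := MkTheta { Theta_set :> set Kdual;
                          ThetaP : `[< is_Theta Theta_set >] }.
HB.instance Definition _ := [isSub for Theta_set].
HB.instance Definition _ := [Choice of Theta by <:].

Definition sizeTheta (phi : Theta) : nat := #|` fset_set (Theta_set phi)|.

Fact Theta_nonempty (phi : Theta) : exists xi : Kdual, Theta_set phi xi.
Proof. by have /asboolP[xi ->] := ThetaP phi; exists xi, 0%N. Qed.

(* an arbitrary element of the orbit phi *)
Definition Theta_elem (phi : Theta) : Kdual := projT1 (cid (Theta_nonempty phi)).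

(* Polynomials in the variables X^(f)_i, for f in Phi and i in nat *)
Definition Xpoly := monalg.malg (monalg.cmonom (Phi * nat)%type) algC.
HB.instance Definition _ := GRing.ComNzRing.on Xpoly.
HB.instance Definition _ := GRing.Lmodule.on Xpoly.

Definition Xconst (c : algC) : Xpoly := monalg.mkmalgU (monalg.one) c.
Definition Xvar (f : Phi) (i : nat) : Xpoly := monalg.mkmalgU (monalg.ucm (f, i)) 1.

(* Like [symfun], an element is given by its truncations to the variables
   X^(f)_0, ..., X^(f)_{N-1}, f in Phi. The image of [ch] lies in the span of
   the elements [P_mp mu] of this ring. *)
Definition Lambda := nat -> Xpoly.
HB.instance Definition _ := GRing.ComNzRing.on Lambda.
HB.instance Definition _ := GRing.Lmodule.on Lambda.

(* h(f) = h(X^(f)) *)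
Definition sym_Phi (h : symfun) (f : Phi) : Lambda := fun N =>
  mmap Xconst (fun i : 'I_N => Xvar f i) (h N).

Definition P_mp (mu : multipart Phi) : Lambda :=
  (- (q%:R : algC)) ^- mp_n degPhi mu *:
  \prod_(f <- finsupp mu)
     sym_Phi (hall_littlewood ((- q%:R) ^- degPhi f) (mu f)) f.

(* p_k(phi), k >= 1 *)
Definition psum_Theta (k : nat) (phi : Theta) : Lambda :=
  let n := (k * sizeTheta phi)%N in
  (-1) ^+ n.-1 *: \sum_(x \in Mgrp n)
    Kdual_at n (Theta_elem phi) x *:
      sym_Phi (psum (n %/ degPhi (Phi_at x))) (Phi_at x).

(* h(phi): substitute p_k(phi) for p_k in the expression of h as a polynomial in
   the power sums *)
Definition sym_Theta (h : symfun) (phi : Theta) : Lambda :=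
  xget 0 [set y | exists (D : nat) (Qh : {mpoly algC[D]}),
    is_pexpansion h Qh /\
    y = mmap (fun c => (fun=> Xconst c) : Lambda)
          (fun i : 'I_D => psum_Theta i.+1 phi) Qh].

Definition s_mp (la : multipart Theta) : Lambda :=
  \prod_(phi <- finsupp la) sym_Theta (schur (la phi)) phi.

(* The linear extension of pi_mu |-> P_mu: the coordinates of chi in the basis
   (pi_mu) are its values on the classes c_mu. *)
Definition ch n (chi : 'CF(U n)) : Lambda :=
  \sum_(mu \in [set mu : multipart Phi | mp_norm degPhi mu = n])
    chi (fingroup.repr (cclass n mu)) *: P_mp mu.

Definition is_chi n (la : multipart Theta) (chi : 'CF(U n)) : Prop :=
  0 < chi 1%g /\ (ch chi = s_mp la \/ ch chi = - s_mp la).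

End Unitary.

(* Main.v *)
From HB Require Import structures.
Require Import Defs.
From mathcomp Require Import all_boot all_order all_algebra all_fingroup.
From mathcomp Require Import all_solvable all_field all_character finmap.
From mathcomp Require Import generic_quotient qpoly fraction ring zify.
From mathcomp Require Import boolp classical_sets functions cardinality fsbigop.
From mathcomp Require Import -(notations) monalg.
From mathcomp Require Import mpoly.

(** Write n = 2m and t = -1/q. The degree of a class function chi on U_n can be
    read off from ch(chi) by a ring homomorphism. Keep N variables X^(f)_0, ...,
    X^(f)_(N-1) for each f in Phi, send X^(f)_i to t^i when f = X - 1, and to 0
    for every other f ([spec]).

    In a Hall-Littlewood polynomial at 1, t, ..., t^(N-1), with parameter t, only
    the identity permutation survives. Hence the image of P_mu is 0 unless mu is
    supported at X - 1, and then it is a polynomial in V = t^N whose degree is the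
    length of mu(X - 1) ([HL_geo], [spec_P_mp]). The coefficient of V^n in the
    image of ch(chi) thus comes from the partition (1^n) alone, that is from the
    class of the identity: it is chi(1) times a constant [ones_coef n]
    ([coef_chV]).

    Let phi in Theta, with d = |phi| and s = t^d. In p_k(phi) only x = 1 survives,
    so the image of p_k(phi) is a multiple of 1 - V^(kd). When V = t^(-M) these
    values are the power sums of M numbers in geometric progression of ratio s.
    Hence the image of s_nu(phi) is a polynomial in V of degree d|nu| whose top
    coefficient is (-1)^(d|nu|) s_nu(1, s, s^2, ...) ([subst_schur],
    [schurW_top]). Comparing coefficients of V^n gives
      chi^la(1) * ones_coef n = +- prod_phi s_(la(phi))(1, s, s^2, ...).
    When every part of la' is even the right-hand product has the sign of (-1)^m,
    because n(nu) and |nu|/2 have the same parity if nu' is even ([evenp_npart]).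
    So all signs agree, and chi^la(1) is known without ambiguity ([chi_degree]).

    It remains to sum the products. Their sum is the coefficient of z^n in
      prod_phi sum_(nu' even) s_nu(1, s, s^2, ...) z^(d|nu|)
    ([sum_multipart]). Littlewood's identity
      sum_(nu' even) s_nu(x) = prod_(i < j) 1 / (1 - x_i x_j)
    ([paired_sum_prod]) shows that the factor of phi, as a series in Z = z^2,
    arises by the substitution of Z^d for Z from the series whose associated power
    sums are s^k / ((1 - s^k) (1 - s^(2k))) ([even_schur_newton]). There are
    q^k - (-1)^k elements of K^* fixed by F^k, so the |phi| dividing k have this sum
    ([sum_sizeTheta]). So the whole product has power sums
      (q^k - (-1)^k) t^k / ((1 - t^k) (1 - t^(2k))) = (-1)^k / (1 - t^(2k)),
    those of prod_(i >= 0) 1 / (1 + t^(2i) Z). By Euler's expansion the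
    coefficient of Z^m is (-1)^m / prod_(1 <= i <= m) (1 - t^(2i))
    ([sum_theta_const]), and division by [ones_coef (2m)] gives the stated product
    ([degree_product]). *)

Set Implicit Arguments.
Unset Strict Implicit.
Unset Printing Implicit Defensive.

Import Order.TTheory GRing.Theory Num.Theory.
Local Open Scope classical_set_scope.
Local Open Scope ring_scope.

(** * Littlewood's identity for alternants *)

Section Alternants.
Variable R : comNzRingType.

Lemma det_sum_cols N (J : finType) (P : 'I_N -> pred J) (g v : 'I_N -> J -> R) :
  \det (\matrix_(i < N, j < N) \sum_(e | P j e) g j e * v i e) =
  \sum_(b : {ffun 'I_N -> J} | b \in family P)
     (\prod_j g j (b j)) * \det (\matrix_(i < N, j < N) v i (b j)).
Proof.
rewrite -det_tr; under [RHS]eq_bigr => b _ do rewrite -det_tr big_distrr.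
rewrite exchange_big /=; apply: eq_bigr => s _.
under eq_bigr => i _ do rewrite !mxE.
rewrite bigA_distr_big_dep /= big_distrr /=; apply: eq_bigr => b _.
rewrite big_split /= mulrCA; congr (_ * (_ * _)).
by apply: eq_bigr => i _; rewrite !mxE.
Qed.

Lemma det_scale_rows N (c : 'I_N -> R) (A : 'M[R]_N) :
  \det (\matrix_(i, j) (c i * A i j)) = (\prod_i c i) * \det A.
Proof.
have -> : \matrix_(i, j) (c i * A i j) = diag_mx (\row_i c i) *m A.
  by apply/matrixP => i j; rewrite mul_diag_mx !mxE.
rewrite det_mulmx det_diag; congr (_ * _); apply: eq_bigr => i _; by rewrite mxE.
Qed.

Definition alternant N (x : 'I_N -> R) (al : 'I_N -> nat) : R :=
  \det (\matrix_(i < N, j < N) x i ^+ al j).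

Lemma geo_diff (a x : R) m n : (m <= n)%N ->
  x ^+ n - a ^+ (n - m) * x ^+ m =
  (x - a) * \sum_(m <= e < n) a ^+ (n.-1 - e) * x ^+ e.
Proof.
move=> /subnKC <-; move: (n - m)%N => d; rewrite addKn.
elim: d => [|d IH]; first by rewrite addn0 big_geq // mul1r subrr mulr0.
rewrite addnS big_nat_recr ?leq_addr //= mulrDr subnn mul1r.
have -> : \sum_(m <= i < m + d) a ^+ (m + d - i) * x ^+ i =
   a * \sum_(m <= i < m + d) a ^+ ((m + d).-1 - i) * x ^+ i.
  rewrite big_distrr /=; apply: eq_big_nat => i /andP[_ im].
  by rewrite mulrA -exprS; congr (a ^+ _ * _); lia.
rewrite mulrCA -IH !exprS; ring.
Qed.

Lemma geo_diff_rev (a x : R) m n : (m <= n)%N ->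
  (1 - a * x) * \sum_(m <= e < n) a ^+ (e - m) * x ^+ e =
  x ^+ m - a ^+ (n - m) * x ^+ n.
Proof.
move=> /subnKC <-; move: (n - m)%N => d; rewrite addKn.
elim: d => [|d IH]; first by rewrite addn0 big_geq // mul1r subrr mulr0.
rewrite addnS big_nat_recr ?leq_addr //= mulrDr IH addKn !exprS; ring.
Qed.

Lemma sum_ord_interval K m n (F : nat -> R) : (n <= K)%N ->
  \sum_(e < K | (m <= e < n)%N) F e = \sum_(m <= e < n) F e.
Proof.
move=> nK; rewrite (big_nat_widen _ _ K) // (big_nat_widenl _ 0) //=.
rewrite big_mkord; apply: eq_bigl => e; rewrite ?andbT; lia.
Qed.

(** The branching rule, in determinant form. Subtracting [a ^+ (al j - al j.+1)]
    times column j+1 from column j kills the row of the variable [a] except for its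
    last entry; each remaining entry is divisible by [x i - a], and its quotient is
    a sum of powers of [x i] with exponents in an interval. Multilinearity in the
    columns turns the determinant of sums into a sum of alternants whose exponents
    interlace with [al]. *)
Lemma alternant_branch K N (y : 'I_N.+1 -> R) (a : R) (x : 'I_N -> R)
    (al : nat -> nat) :
  y ord0 = a -> (forall i, y (lift ord0 i) = x i) ->
  (forall j, (j < N)%N -> (al j.+1 <= al j)%N) -> (al 0%N <= K)%N ->
  alternant y (fun j => al j) =
  a ^+ al N * (\prod_i (a - x i)) *
  \sum_(b : {ffun 'I_N -> 'I_K} |
        b \in family (fun j : 'I_N => fun e : 'I_K => (al j.+1 <= e < al j)%N))
    (\prod_(j < N) a ^+ ((al j).-1 - b j)) * alternant x (fun j => b j).
Proof.
move=> y0 yS aldec al0.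
have alK j : (j <= N)%N -> (al j <= K)%N.
  elim: j => // j IH jN; apply: leq_trans (aldec _ jN) (IH _); exact: ltnW.
(* the column operations, as right multiplication by a unitriangular matrix *)
pose T : 'M[R]_N.+1 := \matrix_(k, j)
  (if k == j then 1 else if (k == j.+1 :> nat) then - a ^+ (al j - al j.+1) else 0).
have detT : \det T = 1.
  rewrite det_trig; last first.
    apply/is_trig_mxP => i j ij; rewrite mxE.
    by rewrite (negPf (_ : i != j)) ?ifF // -?val_eqE /=; lia.
  by rewrite big1 // => i _; rewrite mxE eqxx.
pose A := \matrix_(i < N.+1, j < N.+1) y i ^+ al j.
have AT i j : (A *m T) i j = y i ^+ al j -
   (if (j < N)%N then a ^+ (al j - al j.+1) * y i ^+ al j.+1 else 0).
  rewrite mxE (bigD1 j) //= !mxE eqxx mulr1; congr (_ + _).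
  case: ifP => jN.
    have jN' : (j.+1 < N.+1)%N by [].
    rewrite (bigD1 (Ordinal jN')) /=; last by rewrite -val_eqE /=; lia.
    rewrite !mxE -val_eqE /= eqxx ifF; last by lia.
    rewrite big1 ?addr0 => [|k /andP[kj kj1]]; first by rewrite mulrN mulrC.
    by rewrite !mxE (negPf kj) ifF ?mulr0 // -[k == _ :> nat]/(k == Ordinal jN'); exact: negPf.
  rewrite big1 ?oppr0 // => k kj; rewrite !mxE (negPf kj) ifF ?mulr0 //.
  by have := ltn_ord k; lia.
have -> : alternant y (fun j => al j) = \det (A *m T).
  by rewrite det_mulmx detT mulr1.
(* the row of [a] is now zero outside the last column *)
rewrite (expand_det_row _ ord0) (bigD1 ord_max) //= big1 ?addr0; last first.
  move=> j jm; rewrite AT y0.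
  have jN : (j < N)%N by have := ltn_ord j; move: jm; rewrite -val_eqE /=; lia.
  by rewrite jN -exprD subnK ?aldec // subrr mul0r.
rewrite AT y0 /= ltnn subr0 -!mulrA; congr (_ * _).
rewrite /cofactor /= add0n.
have -> : row' ord0 (col' ord_max (A *m T)) = \matrix_(i < N, j < N)
   ((x i - a) * (\matrix_(i < N, j < N) \sum_(e < K | (al j.+1 <= e < al j)%N)
        a ^+ ((al j).-1 - e) * x i ^+ e) i j).
  apply/matrixP => i j; rewrite !mxE -[RHS]/(_ * _).
  have := AT (lift ord0 i) (lift ord_max j); rewrite mxE => ->.
  have -> : lift ord_max j = j :> nat by rewrite /= /bump leqNgt ltn_ord.
  rewrite ltn_ord yS (sum_ord_interval _ (fun e => a ^+ ((al j).-1 - e) * x i ^+ e)); last first.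
    by apply: alK; apply: ltnW.
  by rewrite -geo_diff ?aldec.
rewrite det_scale_rows mulrA; congr (_ * _).
  have -> : (-1) ^+ N = \prod_(i < N) (-1 : R) by rewrite prodr_const card_ord.
  rewrite -big_split /=; apply: eq_bigr => i _; ring.
have := @det_sum_cols N 'I_K (fun j e => (al j.+1 <= e < al j)%N)
   (fun j e => a ^+ ((al j).-1 - e)) (fun i e => x i ^+ e).
by move=> ->.
Qed.

(** The Pieri rule for multiplication by [prod_i (1 - a x_i)^-1], by similar column
    operations as for branching: the columns
    of the sum are truncated geometric series in [a * x i], and
    multiplication by [1 - a * x i] telescopes them. Nilpotency of the variables
    closes the series of the first column. *)
Lemma alternant_pieri K N (a : R) (x : 'I_N -> R) (gm : nat -> nat) :
  (forall i, x i ^+ K = 0) ->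
  (forall j, (j.+1 < N)%N -> (gm j.+1 <= gm j)%N) -> (gm 0%N <= K)%N ->
  (\prod_i (1 - a * x i)) *
  \sum_(b : {ffun 'I_N -> 'I_K} |
        b \in family (fun j : 'I_N => fun e : 'I_K =>
           (gm j <= e < (if (j : nat) is j'.+1 then gm j' else K))%N))
    (\prod_(j < N) a ^+ (b j - gm j)) * alternant x (fun j => b j)
  = alternant x (fun j => gm j).
Proof.
move=> xK gmdec gm0.
pose up j := if j is j'.+1 then gm j' else K.
have gmK j : (j < N)%N -> (gm j <= K)%N.
  elim: j => // j IH jN; apply: leq_trans (gmdec _ jN) (IH _); exact: ltnW.
have upK j : (j <= N)%N -> (up j <= K)%N by case: j => //= j; exact: gmK.
have gmup j : (j < N)%N -> (gm j <= up j)%N by case: j => //= j; exact: gmdec.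
have <- := @det_sum_cols N 'I_K (fun j e => (gm j <= e < up j)%N)
   (fun j e => a ^+ (e - gm j)) (fun i e => x i ^+ e).
rewrite -det_scale_rows.
pose T : 'M[R]_N := \matrix_(k, j)
  (if k == j then 1 else if (k.+1 == j :> nat) then - a ^+ (gm k - gm j) else 0).
have detT : \det T = 1.
  rewrite -det_tr det_trig; last first.
    apply/is_trig_mxP => i j ij; rewrite !mxE.
    by rewrite (negPf (_ : j != i)) ?ifF // -?val_eqE /=; lia.
  by rewrite big1 // => i _; rewrite !mxE eqxx.
rewrite /alternant -[RHS]mulr1 -[1 in RHS]detT -det_mulmx; congr (\det _).
apply/matrixP => i j; rewrite !mxE.
rewrite (sum_ord_interval _ (fun e => a ^+ (e - gm j) * x i ^+ e)) ?upK 1?ltnW //.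
rewrite geo_diff_rev ?gmup // (bigD1 j) //= !mxE eqxx mulr1; congr (_ + _).
(* in column 0 the series runs up to K, where [x i ^+ K] vanishes *)
case: j => -[|j] jN /=; first by rewrite xK mulr0 oppr0 big1 // => k kj; rewrite !mxE (negPf kj) mulr0.
have jN' : (j < N)%N by apply: ltnW.
rewrite (bigD1 (Ordinal jN')) /=; last by rewrite -val_eqE /=; lia.
rewrite !mxE -val_eqE /= eqxx ifF; last by lia.
rewrite big1 ?addr0 => [|k /andP[kj kj1]]; first by rewrite mulrN mulrC.
rewrite !mxE (negPf kj) ifF ?mulr0 //.
by move: kj1; rewrite -val_eqE eqSS => /negPf.
Qed.

(** Exponents raised by 1, so that 0 is free to stand for a virtual exponent -1 after
    the last column. With this convention the two interlacing lemmas below need no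
    distinction between an even and an odd number of variables. *)
Definition shifted N K (al : {ffun 'I_N -> 'I_K}) (j : nat) : nat :=
  if insub j is Some i then (al i).+1 else 0%N.

Lemma shifted_ord N K (al : {ffun 'I_N -> 'I_K}) (j : 'I_N) : shifted al j = (al j).+1.
Proof. by rewrite /shifted valK. Qed.

Lemma shifted_out N K (al : {ffun 'I_N -> 'I_K}) j : (N <= j)%N -> shifted al j = 0%N.
Proof. by move=> jN; rewrite /shifted insubN // -leqNgt. Qed.

Lemma shifted_le N K (al : {ffun 'I_N -> 'I_K}) j : (shifted al j <= K)%N.
Proof. by rewrite /shifted; case: insubP => // i _ _; apply: ltn_ord. Qed.

Definition strict N (s : nat -> nat) := [forall j : 'I_N, (s j.+1 < s j)%N].
(** For the exponents [la_j + (N - j)] of a partition this pairing of the entries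
    2i and 2i+1 says that [la_(2i) = la_(2i+1)], i.e., that the conjugate of [la]
    has even parts only. *)
Definition paired N (s : nat -> nat) :=
  strict N s && [forall j : 'I_N, ~~ odd j ==> (s j == (s j.+1).+1)].

Lemma strictP N s : reflect (forall j, (j < N)%N -> (s j.+1 < s j)%N) (strict N s).
Proof.
apply: (iffP forallP) => h j; last exact: h.
by move=> jN; apply: (h (Ordinal jN)).
Qed.

Lemma pairedP N s : reflect ((forall j, (j < N)%N -> (s j.+1 < s j)%N) /\
  (forall j, (j < N)%N -> ~~ odd j -> s j = (s j.+1).+1)) (paired N s).
Proof.
apply: (iffP andP) => -[/strictP h1 h2]; split=> //.
- by move=> j jN jo; have /forallP/(_ (Ordinal jN)) := h2; rewrite jo => /eqP.
- by apply/forallP => j; apply/implyP => jo; rewrite h2.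
Qed.

(** Interlacing leaves one unit of room between paired entries, so [u] determines its
    paired companion [s]. *)
Lemma branch_paired N (s u : nat -> nat) :
  (forall j, (N < j)%N -> s j = 0%N) -> (forall j, (N <= j)%N -> u j = 0%N) ->
  (paired N.+1 s /\ (forall j, (j < N)%N -> (s j.+1 <= u j < s j)%N)) <->
  (strict N u /\
   forall j, (j <= N)%N -> s j = if odd j then u j.-1 else (u j).+1).
Proof.
move=> s0 u0; split=> [[/pairedP[sd sp] int]|[/strictP ud su]].
  have su j : (j <= N)%N -> s j = if odd j then u j.-1 else (u j).+1.
    have even i : (i <= N)%N -> ~~ odd i -> s i = (u i).+1.
      move=> iN io; rewrite sp //; congr _.+1.
      have [iN'|Ni] := ltnP i N; last by rewrite s0 ?u0.
      by have := int i iN'; have := sp i iN io; lia.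
    case: ifP => jo jN; last by apply: even; rewrite ?jo.
    case: j jo jN => //= j jo jN.
    by have := even j (ltnW jN) jo; have := sp j (ltnW jN) jo; lia.
  split=> //; apply/strictP => j jN.
  have [jN'|Nj] := ltnP j.+1 N; last first.
    rewrite [u j.+1]u0 //; have := int j jN.
    have: (0 < s j.+1)%N by apply: leq_ltn_trans (sd j.+1 _).
    lia.
  have := su j.+1 jN; have := su j (ltnW jN); have := int j jN; have := int j.+1 jN'.
  by have := sd j.+1 jN; rewrite /=; case: (odd j) => /=; lia.
have int j : (j < N)%N -> (s j.+1 <= u j < s j)%N.
  move=> jN; rewrite !su //; last exact: ltnW.
  rewrite /=; have := ud j jN; case: (boolP (odd j)) => jo /=; last by lia.
  have := ud j.-1; case: j jo jN => //= j jo jN; lia.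
split=> //; apply/pairedP; split=> j jN.
  have [jN'|Nj] := ltnP j N; first by have := int j jN'; lia.
  rewrite [s j.+1]s0 // su //; case: ifP => // jo.
  by case: j jo jN Nj => //= j jo jN Nj; have := ud j; lia.
move=> jo; rewrite su // (negPf jo).
have [jN'|Nj] := ltnP j N; first by rewrite su //= jo.
by rewrite s0 // u0.
Qed.

(** Here again [u] determines its paired companion: an odd entry of [g] is squeezed
    onto [u], and the even entry before it is one more. *)
Lemma pieri_paired N (g u : nat -> nat) :
  (forall j, (N <= j)%N -> g j = 0%N) -> (forall j, (N <= j)%N -> u j = 0%N) ->
  (paired N g /\ (forall j, (j < N)%N -> (g j <= u j)%N /\
      ((j.+1 < N)%N -> (u j.+1 < g j)%N))) <->
  (strict N u /\
   forall j, (j < N)%N -> g j = if odd j then u j else (u j.+1).+1).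
Proof.
move=> g0 u0; split=> [[/pairedP[gd gp] int]|[/strictP ud gu]].
  have odd_gu j : odd j -> (j < N)%N -> g j = u j.
    case: j => //= j jo jN.
    have [] := int j (ltnW jN); have [] := int j.+1 jN.
    by have := gp j (ltnW jN) jo; lia.
  split=> [|j jN]; last first.
    case: ifPn => jo; first exact: odd_gu.
    rewrite gp //; congr _.+1.
    have [jN'|Nj] := ltnP j.+1 N; last by rewrite g0 ?u0.
    by rewrite odd_gu //= jo.
  apply/strictP => j jN; have [jN'|Nj] := ltnP j.+1 N.
    by have [gu /(_ jN')] := int j jN; lia.
  by have [] := int j jN; have := gd j jN; rewrite [u j.+1]u0 //; lia.
have int j : (j < N)%N -> (g j <= u j)%N /\ ((j.+1 < N)%N -> (u j.+1 < g j)%N).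
  move=> jN; rewrite gu //; have := ud j jN; case: ifP => jo; split=> //; lia.
split=> //; apply/pairedP; split=> j jN.
  have [jN'|Nj] := ltnP j.+1 N; last by rewrite [g j.+1]g0 // gu //; have := ud j jN; case: ifP; lia.
  rewrite !gu //=; case: (odd j) => /=; last by lia.
  by have := ud j.+1 jN'; have := ud j jN; lia.
move=> jo; rewrite gu // (negPf jo); congr _.+1.
have [jN'|Nj] := ltnP j.+1 N; last by rewrite g0 ?u0.
by rewrite gu //= jo.
Qed.

Definition paired_sum K N (x : 'I_N -> R) : R :=
  \sum_(al : {ffun 'I_N -> 'I_K} | paired N (shifted al)) alternant x (fun j => al j).

(** The common value, up to a product, of the branching and the Pieri expansions of a
    sum over paired exponents. The power of [a] adds up the gaps of [b] to the
    right of its even entries. *)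
Definition strict_sum K N (a : R) (x : 'I_N -> R) : R :=
  \sum_(b : {ffun 'I_N -> 'I_K} | strict N (shifted b))
    (\prod_(j < N | ~~ odd j) a ^+ (shifted b j - shifted b j.+1).-1) *
    alternant x (fun j => b j).

(** Disposes of the terms with an exponent K, for which the companion of the
    interlacing lemmas could overflow the range of exponents. *)
Lemma alternant_nil N (x : 'I_N -> R) (al : 'I_N -> nat) j :
  (forall i, x i ^+ al j = 0) -> alternant x al = 0.
Proof.
move=> h; rewrite /alternant (expand_det_col _ j) big1 // => i _.
by rewrite mxE h mul0r.
Qed.

Lemma paired_strict N (s : nat -> nat) : paired N s -> strict N s.
Proof. by case/andP. Qed.

Lemma paired_sum_branch K N (y : 'I_N.+1 -> R) (a : R) (x : 'I_N -> R) :
  y ord0 = a -> (forall i, y (lift ord0 i) = x i) -> (forall i, x i ^+ K = 0) ->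
  paired_sum K.+1 y = (\prod_i (a - x i)) * strict_sum K.+1 a x.
Proof.
move=> y0 yS xK; rewrite /paired_sum.
pose Q (al : {ffun 'I_N.+1 -> 'I_K.+1}) (b : {ffun 'I_N -> 'I_K.+1}) :=
  [forall j : 'I_N, (shifted al j.+1 <= shifted b j < shifted al j)%N].
pose w (al : {ffun 'I_N.+1 -> 'I_K.+1}) (b : {ffun 'I_N -> 'I_K.+1}) :=
  a ^+ (shifted al N).-1 * \prod_(j < N) a ^+ ((shifted al j).-1.-1 - b j).
transitivity ((\prod_i (a - x i)) *
   \sum_(al : {ffun 'I_N.+1 -> 'I_K.+1} | paired N.+1 (shifted al))
   \sum_(b : {ffun 'I_N -> 'I_K.+1} | Q al b) w al b * alternant x (fun j => b j)).
  rewrite big_distrr /=; apply: eq_bigr => al /paired_strict alP.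
  have /strictP sd := alP.
  have h : forall j, (j < N)%N -> ((shifted al j.+1).-1 <= (shifted al j).-1)%N.
    by move=> j jN; have := sd j (ltnW jN); lia.
  have h0 : ((shifted al 0).-1 <= K.+1)%N by have := shifted_le al 0; lia.
  transitivity (alternant y (fun j => (shifted al j).-1)).
    by congr (\det _); apply/matrixP => i j; rewrite !mxE shifted_ord.
  rewrite (alternant_branch y0 yS h h0) [a ^+ _ * _]mulrC -mulrA; congr (_ * _).
  rewrite big_distrr /=; apply: eq_big => [b|b _]; last by rewrite /w mulrA.
  apply/familyP/forallP => hb j; have jN := ltn_ord j;
    have := sd j (ltnW jN); have := sd j.+1 jN; have := hb j;
    rewrite /in_mem /= shifted_ord; lia.
congr (_ * _).
rewrite (exchange_big_dep predT) //= /strict_sum [RHS]big_mkcond /=.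
apply: eq_bigr => b _.
have QP al : paired N.+1 (shifted al) && Q al b <-> strict N (shifted b) /\
   forall j, (j <= N)%N -> shifted al j = if odd j then shifted b j.-1 else (shifted b j).+1.
  rewrite -(branch_paired (s := shifted al) (u := shifted b)); last 2 first.
  - by move=> j; apply: shifted_out.
  - by move=> j; apply: shifted_out.
  split=> [/andP[pal /forallP q]|[pal q]]; first by split=> // j jN; apply: (q (Ordinal jN)).
  by rewrite pal; apply/forallP => j; apply: q.
(* if some exponent of [b] is K, both sides vanish *)
have [[j0 bj0]|bK] := pselect (exists j, b j = K :> nat).
  have altb : alternant x (fun j => b j) = 0.
    by apply: (alternant_nil (j := j0)) => i; rewrite bj0.
  by rewrite altb mulr0 if_same big1 // => al _; rewrite mulr0.
case: ifPn => sb; last first.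
  by rewrite big_pred0 // => al; apply/negbTE/negP => /QP[]; rewrite (negPf sb).
pose sv j := if odd j then shifted b j.-1 else (shifted b j).+1.
have shbK j : (shifted b j <= K)%N.
  rewrite /shifted; case: insubP => // i _ _.
  by rewrite ltn_neqAle -ltnS ltn_ord andbT; apply/negP => /eqP h; apply: bK; exists i.
have svK j : ((sv j).-1 < K.+1)%N.
  by rewrite /sv; have := shbK j; have := shbK j.-1; case: ifP => _; lia.
(* the unique paired sequence interlacing with [b] *)
pose al0 := [ffun j : 'I_N.+1 => Ordinal (svK j)].
have sv0 j : (j <= N)%N -> (0 < sv j)%N.
  rewrite /sv; case: ifP => //; case: j => //= j jo jN.
  by rewrite -[j]/(val (Ordinal jN)) shifted_ord.
have shal0 j : (j <= N)%N -> shifted al0 j = sv j.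
  move=> jN; rewrite -ltnS in jN; rewrite -[j]/(val (Ordinal jN)) shifted_ord ffunE /=.
  by rewrite prednK // sv0.
have al0P : paired N.+1 (shifted al0) && Q al0 b by apply/QP.
rewrite (big_pred1 al0) /=; last first.
  move=> al; apply/idP/eqP => [/QP[_ h]|-> //].
  apply/ffunP => j; apply: val_inj; apply: succn_inj.
  by rewrite -!shifted_ord h ?shal0 // -ltnS.
congr (_ * _); rewrite /w shal0 // mulrC.
have -> : \prod_(j < N) a ^+ ((shifted al0 j).-2 - b j) =
  \prod_(j < N) (if odd j then a ^+ (shifted b j.-1 - shifted b j).-1 else 1).
  apply: eq_bigr => j _; rewrite shal0 1?ltnW // /sv.
  case: ifP => jo; first by rewrite shifted_ord; congr (a ^+ _); lia.
  by rewrite shifted_ord /= subnn.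
have -> : a ^+ (sv N).-1 = if odd N then a ^+ (shifted b N.-1 - shifted b N).-1 else 1.
  by rewrite /sv (@shifted_out _ _ b N) //; case: ifP; rewrite ?subn0.
transitivity (\prod_(j < N.+1) (if odd j then a ^+ (shifted b j.-1 - shifted b j).-1 else 1)).
  by rewrite big_ord_recr.
by rewrite big_ord_recl /= mul1r [RHS]big_mkcond.
Qed.

Lemma paired_sum_pieri K N (a : R) (x : 'I_N -> R) : (forall i, x i ^+ K = 0) ->
  paired_sum K.+1 x = (\prod_i (1 - a * x i)) * strict_sum K.+1 a x.
Proof.
move=> xK; rewrite /paired_sum.
pose Q (gm b : {ffun 'I_N -> 'I_K.+1}) := [forall j : 'I_N,
  (shifted gm j <= shifted b j)%N && ((j.+1 < N)%N ==> (shifted b j.+1 < shifted gm j)%N)].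
pose w (gm b : {ffun 'I_N -> 'I_K.+1}) :=
  \prod_(j < N) a ^+ (b j - (shifted gm j).-1).
transitivity ((\prod_i (1 - a * x i)) *
   \sum_(gm : {ffun 'I_N -> 'I_K.+1} | paired N (shifted gm))
   \sum_(b : {ffun 'I_N -> 'I_K.+1} | Q gm b) w gm b * alternant x (fun j => b j)).
  rewrite big_distrr /=; apply: eq_bigr => gm /paired_strict gmP.
  have /strictP sd := gmP.
  have xK1 i : x i ^+ K.+1 = 0 by rewrite exprS xK mulr0.
  have h : forall j, (j.+1 < N)%N -> ((shifted gm j.+1).-1 <= (shifted gm j).-1)%N.
    by move=> j jN; have := sd j (ltnW jN); lia.
  have h0 : ((shifted gm 0).-1 <= K.+1)%N by have := shifted_le gm 0; lia.
  transitivity (alternant x (fun j => (shifted gm j).-1)).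
    by congr (\det _); apply/matrixP => i j; rewrite !mxE shifted_ord.
  rewrite -(alternant_pieri a xK1 h h0); congr (_ * _).
  apply: eq_bigl => b.
  apply/familyP/forallP => hb j; have jN := ltn_ord j.
    have := hb j; rewrite /in_mem /= !shifted_ord /= ltnS => /andP[-> _] /=.
    apply/implyP => jN1; have := hb (Ordinal jN1); rewrite /in_mem /=.
    by rewrite -[j.+1]/(val (Ordinal jN1)) !shifted_ord /=; lia.
  have := hb j; rewrite !shifted_ord /in_mem /= ltnS => /andP[-> _] /=.
  case: j jN {hb} (hb) => -[|j] jN _ hb //=; have jN' := ltnW jN.
  have := hb (Ordinal jN'); rewrite /= jN -[j.+1]/(val (Ordinal jN)) !shifted_ord /=.
  by rewrite -[j]/(val (Ordinal jN')) !shifted_ord /=; lia.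
congr (_ * _).
rewrite (exchange_big_dep predT) //= /strict_sum [RHS]big_mkcond /=.
apply: eq_bigr => b _.
have QP gm : paired N (shifted gm) && Q gm b <-> strict N (shifted b) /\
   forall j, (j < N)%N -> shifted gm j = if odd j then shifted b j else (shifted b j.+1).+1.
  rewrite -(pieri_paired (g := shifted gm) (u := shifted b)); last 2 first.
  - by move=> j; apply: shifted_out.
  - by move=> j; apply: shifted_out.
  split=> [/andP[pal /forallP q]|[pal q]].
    by split=> // j jN; have /andP[? /implyP] := q (Ordinal jN).
  rewrite pal; apply/forallP => j; have [h1 h2] := q j (ltn_ord j).
  by rewrite h1; apply/implyP.
case: ifPn => sb; last first.
  by rewrite big_pred0 // => gm; apply/negbTE/negP => /QP[]; rewrite (negPf sb).
have /strictP sd := sb.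
pose gv j := if odd j then shifted b j else (shifted b j.+1).+1.
have gv0 j : (j < N)%N -> (0 < gv j)%N.
  by rewrite /gv; case: ifP => // _ /sd; lia.
have gvK (j : 'I_N) : ((gv j).-1 < K.+1)%N.
  have := sd j (ltn_ord j); have := shifted_le b j; have := gv0 _ (ltn_ord j).
  by rewrite /gv; case: ifP => _; lia.
(* the unique paired sequence interlacing with [b] *)
pose gm0 := [ffun j : 'I_N => Ordinal (gvK j)].
have shgm0 j : (j < N)%N -> shifted gm0 j = gv j.
  move=> jN; rewrite -[j]/(val (Ordinal jN)) shifted_ord ffunE /=.
  by rewrite prednK // gv0.
have gm0P : paired N (shifted gm0) && Q gm0 b by apply/QP.
rewrite (big_pred1 gm0) /=; last first.
  move=> gm; apply/idP/eqP => [/QP[_ h]|-> //].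
  apply/ffunP => j; apply: val_inj; apply: succn_inj.
  by rewrite -!shifted_ord h ?shgm0.
congr (_ * _); rewrite /w [RHS]big_mkcond /=; apply: eq_bigr => j _.
rewrite shgm0 // /gv if_neg; case: ifP => jo; first by rewrite shifted_ord /= subnn.
by rewrite shifted_ord; congr (a ^+ _) => /=; lia.
Qed.

(** Littlewood's identity: after division by the Vandermonde product on the right, it
    says that the sum of [s_la(x)] over [la] with even conjugate is
    [prod_(i < j) (1 - x_i x_j)^-1]. The branching rule removes the first variable
    from the sum over paired exponents in N+1 variables, and the Pieri rule
    applied to the sum in the N remaining variables gives the same [strict_sum];
    the quotient of the two factors is what the product formula requires. The
    variables are nilpotent so that all sums are finite. *)
Theorem paired_sum_prod K N (x : nat -> R) : (forall i, x i ^+ K = 0) ->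
  paired_sum K.+1 (fun i : 'I_N => x i) *
    \prod_(j < N) \prod_(i < j) (1 - x i * x j) =
  \prod_(j < N) \prod_(i < j) (x i - x j).
Proof.
move=> xK; elim: N x xK => [|N IH] x xK.
  rewrite !big_ord0 mulr1 /paired_sum (big_pred1 [ffun j : 'I_0 => ord0]) /=.
    by rewrite /alternant det_mx00.
  move=> al; rewrite /paired /strict.
  have -> : pred1 [ffun=> ord0] al by apply/eqP/ffunP => -[].
  by apply/andP; split; apply/forallP => -[].
(* isolates the pairs that contain the first variable *)
have split_prod (g : R -> R -> R) :
    \prod_(j < N.+1) \prod_(i < j) g (x i) (x j) =
    (\prod_(j < N) g (x 0%N) (x j.+1)) * \prod_(j < N) \prod_(i < j) g (x i.+1) (x j.+1).
  rewrite big_ord_recl big_ord0 mul1r -big_split /=; apply: eq_bigr => j _.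
  by rewrite big_ord_recl.
rewrite (split_prod (fun a b => 1 - a * b)) (split_prod (fun a b => a - b)).
have xK' i : x i.+1 ^+ K = 0 by [].
rewrite -(IH (fun i => x i.+1)) //.
rewrite (@paired_sum_branch K N _ (x 0%N) (fun i => x i.+1)) //.
rewrite (@paired_sum_pieri K N (x 0%N) (fun i => x i.+1)) //.
by ring.
Qed.
End Alternants.

(** * Power series with prescribed power sums *)

Section Newton.
Variable F : numFieldType.
Implicit Types (p r : nat -> F) (g h : {poly F}).

Definition logder n p : {poly F} := \poly_(i < n) p i.+1.

(** Modulo [X^n], h is the series [sum_k h_k X^k] attached to the power
    sums p, as complete symmetric functions are: [h' = (sum_i p_(i+1) X^i) h] and
    [h_0 = 1]. Products of such series add their power sums, which is how all the
    generating functions below are multiplied, inverted and compared. *)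
Definition newton n p h :=
  h`_0 = 1 /\ forall k, (k < n)%N -> (h^`() - logder n p * h)`_k = 0.

Lemma coefM_low0 g h k : (forall j, (j <= k)%N -> g`_j = 0) -> (g * h)`_k = 0.
Proof.
move=> g0; rewrite coefM big1 // => i _; rewrite g0 ?mul0r //.
by rewrite -ltnS.
Qed.

(** Newton's identities [(k+1) h_(k+1) = sum_i p_(i+1) h_(k-i)]. *)
Lemma newtonE n p h : newton n p h <-> h`_0 = 1 /\
  forall k, (k < n)%N -> h`_k.+1 *+ k.+1 = \sum_(i < k.+1) p i.+1 * h`_(k - i).
Proof.
have E k : (k < n)%N -> (h^`() - logder n p * h)`_k =
    h`_k.+1 *+ k.+1 - \sum_(i < k.+1) p i.+1 * h`_(k - i).
  move=> kn; rewrite coefB coef_deriv coefM; congr (_ - _).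
  by apply: eq_bigr => i _; rewrite coef_poly (leq_trans (ltn_ord i) kn).
split=> -[h0 hk]; split=> // k kn; have := hk k kn; rewrite E //.
  by move/eqP; rewrite subr_eq0 => /eqP.
by move=> ->; rewrite subrr.
Qed.

Lemma newton_uniq n p r g h : newton n p g -> newton n r h ->
  (forall i, (0 < i <= n)%N -> p i = r i) -> forall k, (k <= n)%N -> g`_k = h`_k.
Proof.
move=> /newtonE[g0 gE] /newtonE[h0 hE] pr; elim/ltn_ind => -[_ _|k IH kn].
  by rewrite g0 h0.
apply: (@mulIf _ (k.+1%:R)); first by rewrite pnatr_eq0.
rewrite !mulr_natr gE ?hE //; apply: eq_bigr => i _.
have ik := ltn_ord i; rewrite pr ?IH //; first [by rewrite ltnS leq_subr|exact: leq_trans (leq_subr _ _) (ltnW kn)|exact: leq_trans ik kn].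
Qed.

Lemma eq_newton n p r h : (forall i, (0 < i <= n)%N -> p i = r i) ->
  newton n p h -> newton n r h.
Proof.
move=> pr /newtonE[h0 hE]; apply/newtonE; split=> // k kn; rewrite hE //.
by apply: eq_bigr => i _; rewrite pr //=; have := ltn_ord i; lia.
Qed.

Lemma newton1 n : newton n (fun=> 0) 1.
Proof.
apply/newtonE; rewrite coef1; split=> // k kn.
by rewrite coef1 /= mul0rn big1 // => i _; rewrite mul0r.
Qed.

Lemma logderD n p r : logder n (fun i => p i + r i) = logder n p + logder n r.
Proof.
apply/polyP => i; rewrite coefD !coef_poly; case: ifP => // _; by rewrite addr0.
Qed.

Lemma newtonM n p r g h : newton n p g -> newton n r h ->
  newton n (fun i => p i + r i) (g * h).
Proof.
move=> [g0 gE] [h0 hE]; split; first by rewrite coefM big_ord1 g0 h0 mulr1.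
move=> k kn; rewrite derivM logderD.
have -> : g^`() * h + g * h^`() - (logder n p + logder n r) * (g * h) =
  (g^`() - logder n p * g) * h + (h^`() - logder n r * h) * g by ring.
rewrite coefD !coefM_low0 ?addr0 // => j jk; [apply: hE|apply: gE]; lia.
Qed.

Lemma newton_prod n (I : Type) (s : seq I) (P : pred I) (p : I -> nat -> F)
    (h : I -> {poly F}) : (forall i, P i -> newton n (p i) (h i)) ->
  newton n (fun k => \sum_(i <- s | P i) p i k) (\prod_(i <- s | P i) h i).
Proof.
move=> ph; elim: s => [|i s IH].
  by rewrite big_nil; apply: eq_newton (newton1 n) => i _; rewrite big_nil.
rewrite big_cons; case: ifP => Pi.
  apply: eq_newton (newtonM (ph i Pi) IH) => k _.
  by rewrite big_cons Pi.
by apply: eq_newton IH => k _; rewrite big_cons Pi.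
Qed.

Lemma newton_lin n c : newton n (fun k => - c ^+ k) (1 - c *: 'X).
Proof.
apply/newtonE; rewrite coefB coefZ coef1 coefX /= mulr0 subr0; split=> // k kn.
rewrite coefB coef1 coefZ coefX /= sub0r; case: k kn => [|k] kn.
  by rewrite big_ord1 subnn coefB coef1 coefZ coefX /= mulr0 subr0 !mulr1 expr1.
rewrite mulr0 oppr0 mul0rn !big_ord_recr /= subnn subSnn.
rewrite !coefB !coef1 !coefZ !coefX /= !mulr0 subr0 !mulr1 sub0r big1.
  by rewrite add0r mulrNN -exprSr subrr.
move=> i _; rewrite !coefB !coef1 !coefZ !coefX.
have -> : (k.+1 - i == 0)%N = false by have := ltn_ord i; lia.
have -> : (k.+1 - i == 1)%N = false by have := ltn_ord i; lia.
by rewrite mulr0 subr0 mulr0.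
Qed.

(** With r standing for the logarithmic derivative, the defect [D = h' + r h]
    satisfies [D g = (h g)' - (g' - r g) h], which
    vanishes to order n, and g is invertible. *)
Lemma newton_inv n r g h : newton n r g ->
  (forall k, (k <= n)%N -> (h * g)`_k = (k == 0%N)%:R) ->
  newton n (fun k => - r k) h.
Proof.
move=> [g0 gE] hg.
have h0 : h`_0 = 1 by have := hg 0%N isT; rewrite coefM big_ord1 g0 mulr1.
split=> //; set D := h^`() - _.
have lN : logder n (fun k => - r k) = - logder n r.
  by apply/polyP => i; rewrite coefN !coef_poly; case: ifP; rewrite ?oppr0.
have Dg k : (k < n)%N -> (D * g)`_k = 0.
  move=> kn; have -> : D * g = (h * g)^`() - (g^`() - logder n r * g) * h.
    by rewrite /D lN derivM; ring.
  rewrite coefB coef_deriv hg // mul0rn coefM_low0 ?subr0 // => j jk.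
  by apply: gE; lia.
elim/ltn_ind => k IH kn; have := Dg k kn.
rewrite coefM big_ord_recr /= subnn g0 mulr1 big1 ?add0r // => i _.
by rewrite IH ?mul0r //; have := ltn_ord i; lia.
Qed.

(** Replacing X by [X^d] multiplies the power sums by d and spreads them over the
    multiples of d; the factor d is what makes orbit sizes appear in
    [theta_newton]. *)
Lemma newton_dil n d p h : (0 < d)%N -> newton n p h ->
  newton n (fun k => if (d %| k)%N then d%:R * p (k %/ d)%N else 0) (h \Po 'X^d).
Proof.
move=> d0 [h0 hE]; set r := fun k => _.
have H0 : (h \Po 'X^d)`_0 = 1 by rewrite coef_comp_poly_Xn // dvdn0 div0n.
split=> // k kn.
pose L : {poly F} := d%:R *: ('X^(d.-1) * (logder n p \Po 'X^d)).
have LE j : (j < n)%N -> (logder n r)`_j = L`_j.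
  move=> jn; rewrite coefZ coefXnM coef_comp_poly_Xn // !coef_poly jn /r.
  have [jd|dj] := ltnP j d.-1.
    by rewrite ifF ?mulr0 //; apply/negbTE; rewrite gtnNdvd //; lia.
  have -> : j.+1 = (j - d.-1 + d)%N by lia.
  rewrite dvdn_addl // divnDr // divnn d0 addn1.
  case: ifP => dd; last by rewrite mulr0.
  by rewrite ifT //; apply: leq_ltn_trans jn; apply: leq_trans (leq_div _ _) _; lia.
have -> : ((h \Po 'X^d)^`() - logder n r * (h \Po 'X^d))`_k =
   ((h \Po 'X^d)^`() - L * (h \Po 'X^d))`_k.
  rewrite !coefB !coefM; congr (_ - _); apply: eq_bigr => j _.
  by rewrite LE //; have := ltn_ord j; lia.
rewrite deriv_comp derivXn.
have -> : (h^`() \Po 'X^d) * ('X^(d.-1) *+ d) - L * (h \Po 'X^d) =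
    d%:R *: ('X^(d.-1) * ((h^`() - logder n p * h) \Po 'X^d)).
  rewrite comp_polyB comp_polyM mulrBr scalerBr /L -scalerAl mulrA; congr (_ - _).
  by rewrite scaler_nat mulrnAr [_ * 'X^_]mulrC.
rewrite coefZ coefXnM coef_comp_poly_Xn //; case: ifP => _; first by rewrite mulr0.
case: ifP => _; rewrite ?mulr0 // hE ?mulr0 //.
by apply: leq_ltn_trans kn; apply: leq_trans (leq_div _ _) _; lia.
Qed.

(** Newton's identities for the q-exponential [h] (with parameter [r]), by induction
    from its functional equation: [h_k] and [p_k] are determined by
    [(1 - r^(k+1)) h_(k+1) = h_k] and [(1 - r^k) p_k = 1]. *)
Lemma qexp_logder (r : F) (h p : nat -> F) : h 0%N = 1 ->
  (forall k, (1 - r ^+ k.+1) * h k.+1 = h k) ->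
  (forall k, (1 - r ^+ k.+1) * p k.+1 = 1) ->
  forall k, h k.+1 *+ k.+1 = \sum_(i < k.+1) p i.+1 * h (k - i)%N.
Proof.
move=> h0 hS pS k.
have r1 j : 1 - r ^+ j.+1 != 0.
  by apply: contra_eq_neq (pS j) => ->; rewrite mul0r eq_sym oner_neq0.
elim: k => [|k IH].
  rewrite big_ord1 subnn h0 mulr1; apply: (mulfI (r1 0%N)).
  by rewrite mulr1n hS h0 pS.
apply: (mulfI (r1 k.+1)); rewrite mulrnAr hS.
(* use [1 - r^(k+2) = (1 - r^(i+1)) + r^(i+1) (1 - r^(k+1-i))] in each term *)
transitivity (\sum_(i < k.+2) h (k.+1 - i)%N +
    \sum_(i < k.+1) (p i.+1 - 1) * h (k - i)%N); last first.
  rewrite big_distrr /= [X in _ + X](_ : _ =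
     \sum_(i < k.+2) (p i.+1 - 1) * ((1 - r ^+ (k.+1 - i)) * h (k.+1 - i)%N)).
    rewrite -big_split /=; apply: eq_bigr => i _.
    have -> : r ^+ k.+2 = r ^+ i.+1 * r ^+ (k.+1 - i).
      by rewrite -exprD; congr (r ^+ _); have := ltn_ord i; lia.
    have -> : p i.+1 - 1 = r ^+ i.+1 * p i.+1.
      by rewrite -{1}(pS i); ring.
    rewrite -{1}[h _]mul1r -{1}(pS i); ring.
  rewrite [RHS]big_ord_recr /= subnn expr0 subrr mul0r mulr0 addr0.
  apply: eq_bigr => i _; have -> : (k.+1 - i = (k - i).+1)%N by have := ltn_ord i; lia.
  by rewrite hS.
rewrite big_ord_recl subn0 mulrS -addrA; congr (_ + _).
rewrite -big_split /= IH; apply: eq_bigr => i _.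
by rewrite /bump /= add1n subSS mulrBl mul1r addrC subrK.
Qed.

(** Euler's expansion of [prod_(i >= 0) (1 - c r^i X)^-1], whose power sums are
    [sum_i (c r^i)^k]. *)
Lemma newton_qexp n (r c : F) : (forall k, r ^+ k.+1 != 1) ->
  newton n (fun k => c ^+ k / (1 - r ^+ k))
    (\poly_(k < n.+1) (c ^+ k / \prod_(i < k) (1 - r ^+ i.+1))).
Proof.
move=> r1; apply/newtonE.
have r1' k : 1 - r ^+ k.+1 != 0 by rewrite subr_eq0 eq_sym.
rewrite coef_poly big_ord0 divr1; split=> // k kn.
pose h k : F := (\prod_(i < k) (1 - r ^+ i.+1))^-1.
pose p k : F := (1 - r ^+ k)^-1.
have := @qexp_logder r h p _ _ _ k.
rewrite coef_poly ltnS kn => E.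
rewrite -[_ / _]/(c ^+ k.+1 * h k.+1) -mulrnAr {}E.
- rewrite big_distrr; apply: eq_bigr => i _ /=.
  have ik := ltn_ord i; rewrite coef_poly ifT; last by lia.
  rewrite /p /h; have -> : c ^+ k.+1 = c ^+ i.+1 * c ^+ (k - i).
    by rewrite -exprD; congr (c ^+ _); lia.
  by rewrite mulrACA !mulrA.
- by rewrite /h big_ord0 invr1.
- by move=> j; rewrite /h big_ord_recr /= invfM mulrCA mulfV ?mulr1.
- by move=> j; rewrite mulfV.
Qed.
End Newton.

(** * Alternants at geometric progressions *)

Section Vandermonde.
Variable R : comNzRingType.

Definition vander N (x : 'I_N -> R) : R :=
  \prod_(i < N) \prod_(j < N | (i < j)%N) (x i - x j).

Lemma alternant_rev N (x : 'I_N -> R) (al : 'I_N -> nat) :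
  alternant (fun i => x (rev_ord i)) (fun j => al (rev_ord j)) = alternant x al.
Proof.
pose s : 'S_N := perm (@rev_ord_inj N).
rewrite /alternant; set A := \matrix_(i, j) (x i ^+ al j).
have -> : \matrix_(i, j) x (rev_ord i) ^+ al (rev_ord j) = row_perm s (col_perm s A).
  by apply/matrixP => i j; rewrite !mxE !permE.
by rewrite row_permE col_permE !det_mulmx !det_perm odd_permV mulrC -mulrA -signr_addb addbb mulr1.
Qed.

Lemma alternant_delta N (x : 'I_N -> R) :
  alternant x (fun j => N - j.+1)%N = vander x.
Proof.
rewrite -alternant_rev.
transitivity (\det (Vandermonde N (\row_i x (rev_ord i)))).
  rewrite -det_tr; congr (\det _); apply/matrixP => i j; rewrite !mxE; congr (_ ^+ _).
  exact: (congr1 val (rev_ordK j)).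
rewrite det_Vandermonde /vander.
under eq_bigr => i _ do under eq_bigr => j _ do rewrite !mxE.
rewrite (exchange_big_dep predT) //= [LHS](reindex_inj rev_ord_inj) /=.
apply: eq_bigr => i _; rewrite [LHS](reindex_inj rev_ord_inj) /=.
apply: eq_big => [j|j _]; last by rewrite !rev_ordK.
by have := ltn_ord i; have := ltn_ord j; lia.
Qed.

(** At a geometric progression an alternant is a Vandermonde determinant in the
    powers [s ^+ al j], with rows and columns exchanged. *)
Lemma alternant_geo N (c s : R) (al : 'I_N -> nat) :
  alternant (fun i : 'I_N => c * s ^+ i) al =
  (\prod_j c ^+ al j) * \prod_(i < N) \prod_(j < N | (i < j)%N) (s ^+ al j - s ^+ al i).
Proof.
rewrite /alternant -det_tr.
transitivity (\det (\matrix_(j < N, i < N) (c ^+ al j * (Vandermonde N (\row_j s ^+ al j))^T j i))).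
  congr (\det _); apply/matrixP => i j; rewrite !mxE exprMn -!exprM.
  by rewrite [(j * _)%N]mulnC.
rewrite det_scale_rows det_tr det_Vandermonde; congr (_ * _).
by apply: eq_bigr => i _; apply: eq_bigr => j _; rewrite !mxE.
Qed.
End Vandermonde.

Section PrincipalSpecialization.
Variable F : fieldType.
Variable s : F.
Hypothesis s0 : s != 0.
Hypothesis s1 : forall k, s ^+ k.+1 != 1.

Lemma subs_neq0 k : (0 < k)%N -> 1 - s ^+ k != 0.
Proof. by case: k => // k _; rewrite subr_eq0 eq_sym s1. Qed.

Definition hook_factor (l : nat -> nat) N :=
  \prod_(j < N) \prod_(i < j) ((1 - s ^+ (l i - l j + (j - i))) / (1 - s ^+ (j - i))).

(** The value [s_la(1, s, s^2, ...)] of the infinite principal specialization,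
    which makes sense for every [s] that is not a root of unity. *)
Definition schur_const (la : seq nat) : F :=
  let l := nth 0%N la in
  s ^+ npart la * hook_factor l (size la) /
    \prod_(i < size la) \prod_(k < l i) (1 - s ^+ (size la - i + k)).

Lemma prod_swap N (f : nat -> nat -> F) :
  \prod_(i < N) \prod_(j < N | (i < j)%N) f i j = \prod_(j < N) \prod_(i < j) f i j.
Proof.
rewrite (exchange_big_dep predT) //=; apply: eq_bigr => j _.
by rewrite (big_ord_widen N (fun i => f i j)) 1?ltnW.
Qed.

Lemma box_telescope a n :
  (\prod_(k < n) (1 - s ^+ (a.+1 + k))) * (1 - s ^+ a) =
  (\prod_(k < n) (1 - s ^+ (a + k))) * (1 - s ^+ (a + n)).
Proof.
elim: n => [|n IH]; first by rewrite !big_ord0 addn0.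
by rewrite !big_ord_recr /= mulrAC IH addSnnS.
Qed.

(** Passing from N to N+1 variables multiplies both sides by the same ratios, because
    the products over the cells of row i telescope. *)
Lemma hook_factor_widen (la : seq nat) N : (size la <= N)%N ->
  let l := nth 0%N la in
  hook_factor l N * \prod_(i < size la) \prod_(k < l i) (1 - s ^+ (size la - i + k)) =
  hook_factor l (size la) * \prod_(i < size la) \prod_(k < l i) (1 - s ^+ (N - i + k)).
Proof.
move=> + l; elim: N => [|N IH]; first by rewrite leqn0 /hook_factor => /eqP ->; rewrite !big_ord0.
rewrite leq_eqVlt => /predU1P[->//|]; rewrite ltnS => lN.
rewrite /hook_factor big_ord_recr -/(hook_factor l N) /= mulrAC IH // -mulrA; congr (_ * _).
have lN0 : l N = 0%N by rewrite /l nth_default.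
have -> : \prod_(i < N) ((1 - s ^+ (l i - l N + (N - i))) / (1 - s ^+ (N - i))) =
  \prod_(i < size la) ((1 - s ^+ (N - i + l i)) / (1 - s ^+ (N - i))).
  rewrite (big_ord_widen N (fun i => (1 - s ^+ (N - i + l i)) / (1 - s ^+ (N - i)))) //.
  rewrite [RHS]big_mkcond; apply: eq_bigr => i _; rewrite lN0 subn0.
  case: ifPn => [_|il]; first by rewrite addnC.
  rewrite /l nth_default; last by rewrite leqNgt.
  by rewrite add0n mulfV // subs_neq0 // subn_gt0.
rewrite -big_split /=; apply: eq_bigr => i _.
have iN : (i < N)%N by apply: leq_trans lN.
rewrite mulrA; apply: (canLR (mulfK _)); first by rewrite subs_neq0 // subn_gt0.
by rewrite subSn 1?ltnW // box_telescope.
Qed.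

(** The principal specialization in N variables:
    [s_la(1, s, ..., s^(N-1))] is [s_la(1, s, s^2, ...)] times
    [prod (1 - s^(N + c))] over the contents [c] of the cells of [la]. *)
Lemma schur_const_eval (la : seq nat) N : is_intpart la -> (size la <= N)%N ->
  let l := nth 0%N la in
  alternant (fun i : 'I_N => s ^+ i) (fun j => l j + (N - j.+1))%N =
  schur_const la * (\prod_(i < size la) \prod_(k < l i) (1 - s ^+ (N - i + k))) *
  vander (fun i : 'I_N => s ^+ i).
Proof.
move=> /andP[la_sort _] laN l.
have lmono i j : (i <= j)%N -> (l j <= l i)%N.
  move=> ij; have [js|sj] := ltnP j (size la); last by rewrite /l nth_default.
  have := sorted_leq_nth (fun a b c h1 h2 => leq_trans h2 h1) (leqnn) 0%N la_sort.
  by apply=> //; rewrite inE; lia.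
have geo al : alternant (fun i : 'I_N => s ^+ i) al =
    \prod_(i < N) \prod_(j < N | (i < j)%N) (s ^+ al j - s ^+ al i).
  have := alternant_geo 1 s al; rewrite big1 ?mul1r => [<-|j _]; last by rewrite expr1n.
  by congr (\det _); apply/matrixP => i j; rewrite !mxE mul1r.
(* the denominator of [schur_const] *)
have boxne : \prod_(i < size la) \prod_(k < l i) (1 - s ^+ (size la - i + k)) != 0.
  apply/prodf_neq0 => i _; apply/prodf_neq0 => k _; rewrite subs_neq0 //.
  by have := ltn_ord i; lia.
have -> : schur_const la * \prod_(i < size la) \prod_(k < l i) (1 - s ^+ (N - i + k)) =
    s ^+ npart la * hook_factor l N.
  rewrite /schur_const mulrAC; apply: (canLR (mulfK boxne)).
  by rewrite -[RHS]mulrA hook_factor_widen // mulrA.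
rewrite -alternant_delta !geo.
rewrite (prod_swap N (fun i j => s ^+ (l j + (N - j.+1)) - s ^+ (l i + (N - i.+1)))).
rewrite (prod_swap N (fun i j => s ^+ (N - j.+1) - s ^+ (N - i.+1))).
have -> : s ^+ npart la = \prod_(j < N) \prod_(i < j) s ^+ l j.
  under eq_bigr => j _ do rewrite prodr_const card_ord -exprM mulnC.
  rewrite -(big_morph _ (exprD s) (expr0 s)); congr (_ ^+ _).
  rewrite /npart (big_ord_widen N (fun i => i * nth 0 la i)%N) // big_mkcond.
  apply: eq_bigr => i _; case: ifPn => // il.
  by rewrite /l nth_default ?muln0 // leqNgt.
rewrite /hook_factor -!big_split; apply: eq_bigr => j _ /=.
rewrite -!big_split; apply: eq_bigr => i _ /=.
have ij := ltn_ord i; have jN := ltn_ord j; have lij := lmono _ _ (ltnW ij).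
have -> : s ^+ (l i + (N - i.+1)) = s ^+ (l j + (N - j.+1)) * s ^+ (l i - l j + (j - i)).
  by rewrite -exprD; congr (s ^+ _); lia.
have -> : s ^+ (N - i.+1) = s ^+ (N - j.+1) * s ^+ (j - i).
  by rewrite -exprD; congr (s ^+ _); lia.
rewrite !exprD; have := subs_neq0 (k := (j - i)%N); rewrite subn_gt0 => /(_ ij).
move: (s ^+ (j - i)) (s ^+ l j) (s ^+ (N - j.+1)) (s ^+ (l i - l j)) => a b c d.
by move=> a1; field.
Qed.

End PrincipalSpecialization.

(** * Partitions whose conjugate is even *)

Section Partitions.
Local Open Scope nat_scope.

Lemma nth_nonzero (s : seq nat) : sorted geq s ->
  nth 0 [seq x <- s | x != 0] =1 nth 0 s.
Proof.
elim: s => //= x s IH ps i; case: ifPn => [_|/negPn/eqP x0].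
  by case: i => //= i; apply/IH/path_sorted/ps.
have /allP h : all (geq x) s by apply: order_path_min ps => a b c /= h1 h2; apply: leq_trans h2 h1.
have s0 j : nth 0 s j = 0.
  have [js|sj] := ltnP j (size s); last by rewrite nth_default.
  by have := h _ (mem_nth 0 js); rewrite x0 /= leqn0 => /eqP.
rewrite (_ : filter _ s = [::]); first by case: i => [|i] /=; rewrite ?x0 ?nth_nil ?s0.
apply/eqP; rewrite -size_eq0 size_filter -leqn0 leqNgt -has_count; apply/hasPn => y /h /=.
by rewrite x0 leqn0 => /eqP ->.
Qed.

Lemma intpart_gt0 (la : intpart) i : i < size la -> 0 < nth 0 la i.
Proof.
case: la => s /= /andP[_ h] i_s; rewrite lt0n; apply: contraNneq h => <-.
exact: mem_nth.
Qed.

Lemma intpart_mono (la : intpart) i j : i <= j -> nth 0 la j <= nth 0 la i.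
Proof.
case: la => s /= /andP[ss _] ij; have [js|sj] := ltnP j (size s); last by rewrite nth_default.
have := sorted_leq_nth (fun a b c h1 h2 => leq_trans h2 h1) (leqnn) 0 ss.
by apply=> //; rewrite inE; lia.
Qed.

Lemma intpart_eq (la mu : intpart) : nth 0 la =1 nth 0 mu -> la = mu.
Proof.
move=> h; apply: val_inj; apply: (@eq_from_nth _ 0) => //.
apply/eqP; rewrite eqn_leq; apply/andP; split; rewrite leqNgt; apply/negP => lt.
  by have := intpart_gt0 lt; rewrite h nth_default.
by have := intpart_gt0 lt; rewrite -h nth_default.
Qed.

Lemma sumn_ord (s : seq nat) N : size s <= N -> sumn s = \sum_(j < N) nth 0 s j.
Proof.
move=> sN; rewrite sumnE (big_nth 0) big_mkord (big_ord_widen N (nth 0 s)) //.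
rewrite big_mkcond; apply: eq_bigr => i _; case: ifPn => //.
by rewrite -leqNgt => h; rewrite nth_default.
Qed.

Lemma size_sumn (la : intpart) : size la <= sumn la.
Proof.
rewrite (@sumn_ord la (size la)) // -[X in X <= _]card_ord -sum1_card.
by apply: leq_sum => i _; apply: intpart_gt0.
Qed.

Lemma nth_sumn (s : seq nat) i : nth 0 s i <= sumn s.
Proof.
by elim: s i => [|x s IH] [|i] //=; rewrite ?leq_addr // (leq_trans (IH i)) ?leq_addl.
Qed.

(** For a decreasing sequence; trailing zeros are dropped. *)
Definition intpart_of (s : seq nat) : intpart :=
  odflt intpart0 (insub [seq x <- s | x != 0]).

Lemma nth_intpart_of s : sorted geq s -> nth 0 (intpart_of s) =1 nth 0 s.
Proof.
move=> ss i; rewrite /intpart_of insubT /=; last by rewrite nth_nonzero.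
apply/andP; split; last by rewrite mem_filter.
by apply: sorted_filter => // a b c /= h1 h2; apply: leq_trans h2 h1.
Qed.

Definition parts_upto (n : nat) : seq intpart :=
  [seq la <- undup [seq intpart_of [seq val (f i) | i <- enum 'I_n] | f : {ffun 'I_n -> 'I_n.+1}]
    | sumn (parts la) <= n].

Lemma parts_upto_uniq n : uniq (parts_upto n).
Proof. by rewrite filter_uniq ?undup_uniq. Qed.

Lemma map_enum_ord N (f : nat -> nat) :
  [seq f (val i) | i <- enum 'I_N] = [seq f i | i <- iota 0 N].
Proof. by rewrite -val_enum_ord -map_comp. Qed.

Lemma sorted_map_enum N (f : nat -> nat) : (forall i j, i <= j -> f j <= f i) ->
  sorted geq [seq f (val i) | i <- enum 'I_N].
Proof.
move=> fm; rewrite map_enum_ord sorted_map.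
apply: (@sub_sorted _ leq); last exact: iota_sorted.
by move=> i j /fm.
Qed.

Lemma nth_map_enum N (f : nat -> nat) i :
  nth 0 [seq f (val i) | i <- enum 'I_N] i = if i < N then f i else 0.
Proof.
rewrite map_enum_ord; case: ifPn => iN.
  by rewrite (nth_map 0) ?size_iota // nth_iota.
by rewrite nth_default // size_map size_iota leqNgt.
Qed.

Lemma mem_parts_upto n la : (la \in parts_upto n) = (sumn la <= n).
Proof.
rewrite mem_filter mem_undup; case: leqP => //= lan; apply/mapP.
have lab i : nth 0 la i < n.+1 by rewrite ltnS (leq_trans (nth_sumn _ _)).
exists [ffun i : 'I_n => Ordinal (lab i)]; first by rewrite mem_enum.
apply: intpart_eq => i.
under [in RHS]eq_map => j do rewrite ffunE /=.
rewrite nth_intpart_of ?sorted_map_enum //; last exact: intpart_mono.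
rewrite nth_map_enum; case: ltnP => // ni; rewrite nth_default //.
by apply: leq_trans ni; apply: leq_trans lan; apply: size_sumn.
Qed.

Definition evenp (la : intpart) := all (fun a => ~~ odd a) (conj_part la).

(** The number of parts exceeding j is the number of indices at which the part
    exceeds j, because the parts decrease. *)
Lemma count_nth (la : intpart) j N :
  reflect (forall i, (i < N) = (j < nth 0 la i)) (count (fun a => j < a) la == N).
Proof.
have cN i : (i < count (fun a => j < a) la) = (j < nth 0 la i).
  case: la i => s /= /andP[ss _]; elim: s ss => [|x s IH] //= ps i; first by rewrite nth_nil.
  case: (ltnP j x) => jx /=; first by case: i => //= i; rewrite add1n ltnS IH // (path_sorted ps).
  have /allP h : all (geq x) s by apply: order_path_min ps => a b c /= h1 h2; apply: leq_trans h2 h1.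
  rewrite add0n (_ : count _ _ = 0); last first.
    apply/eqP; rewrite -leqn0 leqNgt -has_count; apply/hasPn => y /h /= yx.
    by rewrite -leqNgt (leq_trans yx).
  rewrite ltn0; apply/esym/negbTE; rewrite -leqNgt; case: i => //= i.
  have [js|sj] := ltnP i (size s); last by rewrite nth_default.
  by apply: leq_trans jx; exact: h _ (mem_nth 0 js).
apply: (iffP eqP) => [<- //|h].
apply/eqP; rewrite eqn_leq; apply/andP; split; rewrite leqNgt; apply/negP.
  by rewrite cN -h ltnn.
by rewrite h -cN ltnn.
Qed.

(** An odd part of the conjugate, equal to i+1 with i even, is a strict descent of
    [la] after its i-th entry (counted from 0). *)
Lemma evenpP (la : intpart) :
  reflect (forall i, ~~ odd i -> nth 0 la i = nth 0 la i.+1) (evenp la).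
Proof.
have bigmaxE : \max_(a <- la) a = nth 0 la 0.
  apply/eqP; rewrite eqn_leq; apply/andP; split.
    apply/bigmax_leqP_seq => a /(nthP 0)[i _ <-] _; exact: intpart_mono.
  case: la => -[|x s] //= _; by rewrite big_cons leq_maxl.
apply: (iffP allP) => [h i io|h c].
  apply/eqP; rewrite eqn_leq (intpart_mono la (leqnSn i)) andbT leqNgt; apply/negP => lt.
  have /h : i.+1 \in (conj_part la : seq nat).
    apply/mapP; exists (nth 0 la i.+1).
      by rewrite mem_iota add0n bigmaxE (leq_trans lt) // intpart_mono.
    apply/esym/eqP/count_nth => k; rewrite ltnS; case: leqP => ki.
      apply/negbTE; apply: contraTN lt => h1; rewrite -leqNgt.
      by apply: leq_trans ki; apply: intpart_mono.
    by rewrite leqNgt; apply: contraTN ki => h1; rewrite -leqNgt; apply: intpart_mono.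
  by rewrite /= io.
case/mapP => j _ ->; set k := count _ _; have /eqP/count_nth kP : k = k by [].
apply/negP => ko; have := kP k; have := kP k.-1; rewrite ltnn prednK; last by case: (k) ko.
rewrite leqnn => /esym h1 /esym.
have := h k.-1; rewrite prednK; last by case: (k) ko.
by move=> <-; [rewrite h1|case: (k) ko => //= i; rewrite negbK].
Qed.

End Partitions.

(** * Littlewood's identity as a sum over partitions *)

Section LittlewoodPoly.
Variable F : fieldType.

Lemma map_alternant (R S : comNzRingType) (f : {rmorphism R -> S}) N (x : 'I_N -> R) al :
  f (alternant x al) = alternant (fun i => f (x i)) al.
Proof.
rewrite /alternant -det_map_mx; congr (\det _).
by apply/matrixP => i j; rewrite !mxE rmorphXn.
Qed.

Lemma alternant_scaleX N (c : 'I_N -> F) (al : 'I_N -> nat) :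
  alternant (fun i => c i *: 'X) al = alternant c al *: 'X^(\sum_j al j).
Proof.
transitivity ((\prod_j 'X^(al j)) * \det (\matrix_(j < N, i < N) ((c i ^+ al j)%:P : {poly F}))).
  rewrite -det_scale_rows /alternant -det_tr; congr (\det _).
  by apply/matrixP => i j; rewrite !mxE exprZn -mul_polyC mulrC.
rewrite prodrXr -mul_polyC mulrC; congr (_ * _).
rewrite -det_tr /alternant -(det_map_mx (@polyC F)); congr (\det _).
by apply/matrixP => i j; rewrite !mxE.
Qed.

(** Littlewood's identity at [x_i = c_i X], where X is nilpotent in the quotient by
    [X^K]. The power of X records the sum of the exponents. *)
Lemma paired_sum_poly K N (c : nat -> F) k : (k < K)%N ->
  ((\sum_(al : {ffun 'I_N -> 'I_K.+1} | paired N (shifted al))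
      alternant (fun i : 'I_N => c i) (fun j => al j) *: 'X^(\sum_j al j)) *
   \prod_(j < N) \prod_(i < j) (1 - (c i * c j) *: 'X^2))`_k =
  (\prod_(j < N) \prod_(i < j) ((c i - c j) *: 'X))`_k.
Proof.
move=> kK; have K0 : (0 < K)%N by exact: leq_ltn_trans kK.
set A := _ * _; set B := \prod_(_ < _) _.
(* computing modulo [X^K] does not change coefficients below K *)
have vE (p : {poly F}) : val (in_qpoly 'X^K p) = take_poly K p.
  rewrite Pdiv.RingMonic.take_poly_rmodp.
  by rewrite -[LHS]/(Pdiv.CommonRing.rmodp p (mk_monic 'X^K)) mk_monic_Xn prednK.
suff /(congr1 val) : in_qpoly 'X^K A = in_qpoly 'X^K B.
  by rewrite !vE => /(congr1 (fun p : {poly F} => p`_k)); rewrite !coef_take_poly kK.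
have xK i : (in_qpoly 'X^K (c i *: 'X)) ^+ K = 0.
  rewrite -rmorphXn; apply: val_inj; rewrite vE exprZn take_polyZ.
  by rewrite -['X^K]mul1r take_polyMXn_0 scaler0.
have := @paired_sum_prod _ K N _ xK; rewrite /A /B.
rewrite rmorphM !rmorph_prod rmorph_sum /= => E.
etransitivity; last first.
  etransitivity; first exact: E.
  apply: eq_bigr => j _; rewrite rmorph_prod; apply: eq_bigr => i _ /=.
  by rewrite -raddfB -scalerBl.
congr (_ * _).
  apply: eq_bigr => al _; rewrite -alternant_scaleX; exact: map_alternant.
apply: eq_bigr => j _; rewrite rmorph_prod; apply: eq_bigr => i _ /=.
by rewrite rmorphB rmorph1 -rmorphM /= -scalerAl -scalerAr scalerA -expr2.
Qed.
End LittlewoodPoly.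

Lemma strict_lower N (u : nat -> nat) j : strict N u -> (j <= N)%N -> (N - j <= u j)%N.
Proof.
move=> /strictP ud jN; rewrite -{2}(subKn jN); have := leq_subr j N.
elim: (N - j)%N => // d IH dN; have := ud (N - d.+1)%N.
have -> : (N - d.+1).+1 = (N - d)%N by lia.
by have := IH (ltnW dN); lia.
Qed.

(** The bijection [la_j |-> la_j + (N - 1 - j)] between partitions with even conjugate
    and paired exponents. For even N the zero parts beyond the length of [la] pair
    up among themselves. *)
Lemma sum_paired_parts (F : fieldType) N K n k (G : ('I_N -> nat) -> F) :
  (k <= n)%N -> (n <= N)%N -> ~~ odd N -> (n + N <= K)%N ->
  \sum_(al : {ffun 'I_N -> 'I_K.+1} |
        paired N (shifted al) && (\sum_j al j == k + \sum_(j < N) (N - j.+1))%N)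
     G (fun j => al j) =
  \sum_(la <- parts_upto n | evenp la && (sumn la == k))
     G (fun j => nth 0 la j + (N - j.+1))%N.
Proof.
move=> kn nN No nNK.
pose S := [seq la <- parts_upto n | evenp la && (sumn (parts la) == k)].
pose Phi (la : intpart) : {ffun 'I_N -> 'I_K.+1} :=
  [ffun j : 'I_N => inord (nth 0 la j + (N - j.+1))%N].
have PhiE la (j : 'I_N) : la \in S -> Phi la j = (nth 0 la j + (N - j.+1))%N :> nat.
  rewrite mem_filter mem_parts_upto => /andP[/andP[_ /eqP lk] _].
  by rewrite ffunE inordK //; have := nth_sumn la j; have := ltn_ord j; lia.
rewrite -[RHS]big_filter -/S.
transitivity (\sum_(al <- map Phi S) G (fun j => al j)); last first.
  rewrite big_map !big_seq; apply: eq_bigr => la laS.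
  by congr G; apply: funext => j; rewrite PhiE.
rewrite -big_filter; apply: perm_big; apply: uniq_perm.
- by rewrite filter_uniq // index_enum_uniq.
- rewrite map_inj_in_uniq; first exact/filter_uniq/parts_upto_uniq.
  move=> la mu laS muS /ffunP eqPhi.
  have szN x : x \in S -> (size (parts x) <= N)%N.
    rewrite mem_filter mem_parts_upto => /andP[_ h].
    by apply: leq_trans nN; apply: leq_trans h; apply: size_sumn.
  apply: intpart_eq => i; have [iN|Ni] := ltnP i N; last first.
    by rewrite !nth_default // (leq_trans _ Ni) // szN.
  have := congr1 val (eqPhi (Ordinal iN)); rewrite /= !PhiE //= => /eqP.
  by rewrite eqn_add2r => /eqP.
move=> al; rewrite mem_filter mem_index_enum andbT; apply/andP/mapP; last first.
  move=> [la laS ->].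
  have := laS; rewrite mem_filter mem_parts_upto => /andP[/andP[/evenpP la_even /eqP lk] ln].
  have shiftedE j : (j < N)%N -> shifted (Phi la) j = (nth 0%N la j + (N - j))%N.
    by move=> jN; rewrite -[j]/(val (Ordinal jN)) shifted_ord PhiE //=; lia.
  split; last first.
    rewrite -lk (@sumn_ord la N) -?big_split /=; last first.
      by apply: leq_trans nN; apply: leq_trans ln; apply: size_sumn.
    by apply/eqP; apply: eq_bigr => j _; rewrite PhiE.
  apply/pairedP; split => j jN.
    rewrite [X in (_ < X)%N]shiftedE //; have [jN'|Nj] := ltnP j.+1 N.
      by rewrite shiftedE //; have := intpart_mono la (leqnSn j); lia.
    by rewrite shifted_out //; lia.
  move=> jo; have jN' : (j.+1 < N)%N by lia.
  by rewrite !shiftedE // la_even //; lia.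
move=> [/pairedP[sd sp] /eqP sk].
have /strict_lower lo : strict N (shifted al) by apply/strictP.
(* the inverse of the bijection *)
pose l j := ((shifted al j).-1 - (N - j.+1))%N.
have lE j : (j < N)%N -> shifted al j = (l j + (N - j))%N.
  by move=> jN; rewrite /l; have := lo j (ltnW jN); lia.
have l0 j : (N <= j)%N -> l j = 0%N by move=> Nj; rewrite /l shifted_out.
have lmonoS j : (l j.+1 <= l j)%N.
  have [jN|Nj] := ltnP j.+1 N; last by rewrite l0.
  by have := sd j (ltnW jN); rewrite !lE //; lia.
have lmono i j : (i <= j)%N -> (l j <= l i)%N.
  move=> /subnKC <-; elim: (j - i)%N => [|d IH]; rewrite ?addn0 // addnS.
  exact: leq_trans (lmonoS _) IH.
pose la := intpart_of [seq l (val j) | j <- enum 'I_N].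
have laE i : nth 0%N la i = l i.
  rewrite nth_intpart_of ?nth_map_enum; last exact: sorted_map_enum.
  by case: ltnP => // Ni; rewrite l0.
have szla : (size (parts la) <= N)%N.
  rewrite leqNgt; apply/negP => /intpart_gt0; by rewrite laE l0.
have lk : sumn la = k.
  rewrite (sumn_ord szla); apply/eqP.
  rewrite -(eqn_add2r (\sum_(j < N) (N - j.+1))%N) -sk -big_split /=; apply/eqP.
  apply: eq_bigr => j _; rewrite laE; apply: succn_inj.
  by rewrite -shifted_ord lE //; have := ltn_ord j; lia.
have laS : la \in S.
  rewrite mem_filter mem_parts_upto lk eqxx kn !andbT.
  apply/evenpP => i io; rewrite !laE; have [iN|Ni] := ltnP i N; last by rewrite !l0 // leqW.
  have iN' : (i.+1 < N)%N by lia.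
  by have := sp i iN io; rewrite !lE //; lia.
exists la => //; apply/ffunP => j; apply: val_inj => /=; rewrite PhiE // laE.
by apply: succn_inj; rewrite -shifted_ord lE //; have := ltn_ord j; lia.
Qed.

(** * Even Schur sums at 1, s, s^2, ... *)

Lemma sum_pairs (f : nat -> nat) M :
  (\sum_(j < M.*2) f j = \sum_(i < M) (f i.*2 + f i.*2.+1))%N.
Proof.
elim: M => [|M IH]; first by rewrite !big_ord0.
by rewrite doubleS !big_ord_recr /= IH -addnA.
Qed.

Lemma evenp_sumn (la : intpart) : evenp la ->
  sumn la = (\sum_(i < size la) nth 0%N la i.*2).*2.
Proof.
move=> /evenpP la_even; rewrite (@sumn_ord la (size la).*2); last by rewrite -addnn leq_addr.
rewrite sum_pairs -muln2 big_distrl /=; apply: eq_bigr => i _.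
by rewrite -la_even ?odd_double // muln2 addnn.
Qed.

(** If [la_(2i) = la_(2i+1)] for all i then [n(la)] is the sum of
    [(4i+1) la_(2i)], while half of [|la|] is the sum of [la_(2i)]. *)
Lemma evenp_npart (la : intpart) : evenp la -> odd (npart la) = odd (sumn la)./2.
Proof.
move=> la_even; rewrite (evenp_sumn la_even) doubleK; move/evenpP: la_even => la_even.
have -> : npart la = (\sum_(j < (size la).*2) j * nth 0 la j)%N.
  rewrite /npart (big_ord_widen (size la).*2 (fun j => j * nth 0 la j)%N); last first.
    by rewrite -addnn leq_addr.
  rewrite big_mkcond; apply: eq_bigr => i _; case: ifPn => //.
  by rewrite -leqNgt => h; rewrite nth_default // muln0.
rewrite (sum_pairs (fun j => j * nth 0 la j)%N); elim: (size la) => [|M IH]; first by rewrite !big_ord0.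
rewrite !big_ord_recr; cbn [nat_of_ord widen_ord ord_max].
rewrite oddD IH [in RHS]oddD; congr (_ (+) _)%B.
by rewrite -la_even ?odd_double // oddD !oddM oddS odd_double.
Qed.

Section Littlewood.
Variable F : numFieldType.
Variable s : F.
Hypothesis s0 : s != 0.
Hypothesis s1 : forall k, s ^+ k.+1 != 1.

(** The polynomial in V with value [s_la(1, s, ..., s^(N-1))] at [V = s^N], for every
    N at least the length of [la] ([schurV_eval]); its value at V = 0 is
    [s_la(1, s, s^2, ...)]. Everywhere below a name ending in V denotes such an
    interpolation in the number N of variables. *)
Definition schurV (la : seq nat) : {poly F} :=
  schur_const s la *: \prod_(i < size la) \prod_(k < nth 0%N la i) (1 - (s ^+ k / s ^+ i) *: 'X).

Lemma schurV_pow (la : seq nat) N : (size la <= N)%N ->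
  (schurV la).[s ^+ N] = schur_const s la *
     \prod_(i < size la) \prod_(k < nth 0%N la i) (1 - s ^+ (N - i + k)).
Proof.
move=> lN; rewrite /schurV hornerZ horner_prod; congr (_ * _); apply: eq_bigr => i _.
rewrite horner_prod; apply: eq_bigr => k _; rewrite hornerD hornerN hornerC hornerZ hornerX.
have iN : (i <= N)%N by apply: leq_trans (ltnW (ltn_ord i)) lN.
have si : s ^+ i != 0 by rewrite expf_neq0.
by congr (1 - _); rewrite -{1}(subnK iN) !exprD; field.
Qed.

Lemma schurV0 (la : seq nat) : (schurV la).[0] = schur_const s la.
Proof.
rewrite /schurV hornerZ horner_prod big1 ?mulr1 // => i _.
rewrite horner_prod big1 // => k _.
by rewrite hornerD hornerN hornerC hornerZ hornerX mulr0 subr0.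
Qed.

Lemma schurV_eval (la : intpart) N : (size la <= N)%N ->
  alternant (fun i : 'I_N => s ^+ i) (fun j => nth 0 la j + (N - j.+1))%N =
  (schurV la).[s ^+ N] * vander (fun i : 'I_N => s ^+ i).
Proof.
move=> lN; rewrite schurV_pow //; apply: (schur_const_eval s0 s1) lN.
by case: la.
Qed.

Lemma exps_inj : injective (fun n => s ^+ n).
Proof.
have aux i j : (i < j)%N -> s ^+ i != s ^+ j.
  move=> ij; rewrite -(subnKC (ltnW ij)) exprD -{1}[s ^+ i]mulr1.
  rewrite (inj_eq (mulfI _)) ?expf_neq0 //; have : (0 < j - i)%N by rewrite subn_gt0.
  by case: (j - i)%N => // k _; rewrite eq_sym.
move=> i j /= /eqP e; apply/eqP; case: ltngtP => // /aux.
  by rewrite e.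
by rewrite eq_sym e.
Qed.

Lemma vander_geo_neq0 N : vander (fun i : 'I_N => s ^+ i) != 0.
Proof.
apply/prodf_neq0 => i _; apply/prodf_neq0 => j ij.
by rewrite subr_eq0 (inj_eq exps_inj) neq_ltn ij.
Qed.

Definition even_schur m N : {poly F} := \poly_(k < m.+1)
  \sum_(la <- parts_upto m.*2 | evenp la && (sumn la == k.*2)) (schurV la).[s ^+ N].

(** Littlewood's identity at [x_i = s^i X], divided by the Vandermonde product and
    with X in place of [X^2]: only even powers occur, because a partition with even
    conjugate has even size. *)
Lemma littlewood_geo m N k : ~~ odd N -> (m.*2 <= N)%N -> (k <= m)%N ->
  (even_schur m N * \prod_(j < N) \prod_(i < j) (1 - (s ^+ i * s ^+ j) *: 'X))`_k = (k == 0%N)%:R.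
Proof.
move=> No mN km.
set Q := \prod_(j < N) _; set D := vander (fun i : 'I_N => s ^+ i).
have D0 : D != 0 by apply: vander_geo_neq0.
(* the degree of the Vandermonde product, and a bound on the exponents that is
   large enough for all partitions of size at most 2m *)
pose C := (\sum_(j < N) (N - j.+1))%N.
pose K := (C + m.*2 + N).+1.
pose B : {poly F} := \sum_(al : {ffun 'I_N -> 'I_K.+1} | paired N (shifted al))
      alternant (fun i : 'I_N => s ^+ i) (fun j => al j) *: 'X^(\sum_j al j).
pose A := even_schur m N \Po 'X^2.
have BE e : (e <= C + m.*2)%N -> B`_e = (D *: ('X^C * A))`_e.
  move=> eC; rewrite coefZ coefXnM coef_comp_poly_Xn // /B coef_sum.
  under eq_bigr => al _ do rewrite coefZ coefXn.
  case: ltnP => Ce.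
    rewrite mulr0 big1 // => al /paired_strict/strict_lower lo.
    rewrite (_ : (e == _) = false) ?mulr0 //; apply/negbTE.
    rewrite neq_ltn; apply/orP; left; apply: leq_trans Ce _.
    apply: leq_sum => j _; have := lo j (ltnW (ltn_ord j)).
    by rewrite shifted_ord; have := ltn_ord j; lia.
  pose G (al : 'I_N -> nat) := alternant (fun i : 'I_N => s ^+ i) al.
  transitivity (\sum_(al : {ffun 'I_N -> 'I_K.+1} |
      paired N (shifted al) && (\sum_j al j == (e - C) + C)%N) G (fun j => al j)).
    rewrite [RHS]big_mkcondr; apply: eq_bigr => al _.
    by rewrite subnK // eq_sym; case: eqP => _; rewrite ?mulr1 ?mulr0.
  rewrite (@sum_paired_parts F N K m.*2); [|lia|lia|by []|rewrite /K; lia].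
  transitivity (\sum_(la <- parts_upto m.*2 | evenp la && (sumn la == e - C)%N)
      D * (schurV la).[s ^+ N]).
    rewrite big_seq_cond [RHS]big_seq_cond; apply: eq_bigr => la.
    rewrite mem_parts_upto => /andP[h _]; rewrite /G schurV_eval 1?mulrC //.
    by apply: leq_trans mN; apply: leq_trans h; apply: size_sumn.
  rewrite -big_distrr /= dvdn2; congr (_ * _); case: ifPn => ec.
    rewrite coef_poly ifT; last by lia.
    by apply: eq_bigl => la; rewrite divn2 -{1}(odd_double_half (e - C)) (negPf ec).
  rewrite big1 // => la /andP[/evenp_sumn e1 /eqP e2].
  by move: ec; rewrite -e2 e1 odd_double.
have := @paired_sum_poly F K N (fun i => s ^+ i) (C + k.*2)%N.
rewrite -/B => /(_ _)/wrap[]; first by rewrite /K; lia.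
have -> : \prod_(j < N) \prod_(i < j) (1 - (s ^+ i * s ^+ j) *: 'X^2) = Q \Po 'X^2.
  rewrite /Q rmorph_prod; apply: eq_bigr => j _; rewrite rmorph_prod.
  by apply: eq_bigr => i _ /=; rewrite comp_polyB comp_polyC comp_polyZ comp_polyX.
have -> : \prod_(j < N) \prod_(i < j) ((s ^+ i - s ^+ j) *: 'X) = D *: 'X^C.
  rewrite /D /vander (prod_swap N (fun i j => s ^+ i - s ^+ j)).
  have -> : C = (\sum_(j < N) j)%N.
    rewrite /C (reindex_inj rev_ord_inj); apply: eq_bigr => j _ /=.
    by have := ltn_ord j; lia.
  rewrite -prodrXr -mul_polyC rmorph_prod -big_split; apply: eq_bigr => j _ /=.
  rewrite rmorph_prod -[X in 'X^X](card_ord j) -prodr_const -big_split.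
  by apply: eq_bigr => i _ /=; rewrite mul_polyC.
have -> : (B * (Q \Po 'X^2))`_(C + k.*2) = ((D *: ('X^C * A)) * (Q \Po 'X^2))`_(C + k.*2).
  rewrite !coefM; apply: eq_bigr => j _; rewrite BE //.
  by have := ltn_ord j; lia.
rewrite -scalerAl !coefZ => /(mulfI D0).
rewrite -mulrA coefXnM ltnNge leq_addr /= addKn -comp_polyM coef_comp_poly_Xn //.
rewrite -muln2 dvdn_mull // mulnK // => ->.
by rewrite coefXn -{2}[C]addn0 eqn_add2l muln_eq0 orbF.
Qed.

(** As a polynomial in [V = s^N], the k-th power sum of the products
    [s^i s^j] with i < j < N. *)
Definition pair_psum k : {poly F} :=
  2^-1 *: (((1 - s ^+ k)^-1 *: (1 - 'X^k)) ^+ 2 - (1 - s ^+ k.*2)^-1 *: (1 - 'X^(k.*2))).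

Lemma geo_sum N k : (0 < k)%N ->
  \sum_(i < N) (s ^+ i) ^+ k = (1 - (s ^+ N) ^+ k) / (1 - s ^+ k).
Proof.
move=> k0; apply: (canRL (mulfK _)); first exact: subs_neq0.
elim: N => [|N IH]; first by rewrite big_ord0 mul0r expr1n subrr.
by rewrite big_ord_recr /= mulrDl IH exprSr exprMn; ring.
Qed.

Lemma sum_sqr N (x : nat -> F) :
  \sum_(j < N) \sum_(i < j) (x i * x j) =
  2^-1 * ((\sum_(i < N) x i) ^+ 2 - \sum_(i < N) x i ^+ 2).
Proof.
have two0 : (2 : F) != 0 by rewrite pnatr_eq0.
elim: N => [|N IH]; first by rewrite !big_ord0; ring.
rewrite !big_ord_recr /= IH -big_distrl /=; by field.
Qed.

Lemma pair_psumE N k : (0 < k)%N ->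
  \sum_(j < N) \sum_(i < j) (s ^+ i * s ^+ j) ^+ k = (pair_psum k).[s ^+ N].
Proof.
move=> k0; under eq_bigr => j _ do under eq_bigr => i _ do rewrite exprMn.
rewrite (sum_sqr N (fun i => (s ^+ i) ^+ k)).
under [X in _ - X]eq_bigr => i _ do rewrite -exprM muln2.
rewrite !geo_sum ?double_gt0 // /pair_psum !hornerE; ring.
Qed.

Lemma pair_psum0 k : (0 < k)%N ->
  (pair_psum k).[0] = s ^+ k / ((1 - s ^+ k) * (1 - s ^+ k.*2)).
Proof.
move=> k0; have two0 : (2 : F) != 0 by rewrite pnatr_eq0.
rewrite /pair_psum !hornerE !expr0n double_eq0 (eqn0Ngt k) k0 /=.
have := subs_neq0 s1 k0; have := subs_neq0 s1 (_ : (0 < k.*2)%N).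
rewrite double_gt0 k0 -muln2 exprM => /(_ isT).
move: (s ^+ k) => a h1 h2; field.
by rewrite h1 h2.
Qed.

Lemma poly_inf_roots (f : nat -> F) (p : {poly F}) : injective f ->
  (forall n, p.[f n] = 0) -> p = 0.
Proof.
move=> fi pf; apply/eqP; apply: contraT => p0.
have := max_poly_roots p0 (rs := [seq f i | i <- iota 0 (size p)]).
rewrite size_map size_iota ltnn; apply.
  by apply/allP => _ /mapP[i _ ->]; rewrite /root pf.
by rewrite map_inj_uniq // iota_uniq.
Qed.

Definition even_schur_const m : {poly F} := \poly_(k < m.+1)
  \sum_(la <- parts_upto m.*2 | evenp la && (sumn la == k.*2)) schur_const s la.

(** Both sides of Newton's identities for the finite specializations are polynomials
    in [V = s^N]. They agree at infinitely many values of V, hence at V = 0, which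
    stands for infinitely many variables. *)
Theorem even_schur_newton m :
  newton m (fun k => s ^+ k / ((1 - s ^+ k) * (1 - s ^+ k.*2))) (even_schur_const m).
Proof.
pose E k := \sum_(la <- parts_upto m.*2 | evenp la && (sumn la == k.*2)) schurV la.
have EN N k : (k <= m)%N -> (even_schur m N)`_k = (E k).[s ^+ N].
  by move=> km; rewrite coef_poly ltnS km horner_sum.
have E0 k : (k <= m)%N -> (even_schur_const m)`_k = (E k).[0].
  by move=> km; rewrite coef_poly ltnS km horner_sum; apply: eq_bigr => la _; rewrite schurV0.
have NN N : ~~ odd N -> (m.*2 <= N)%N ->
    newton m (fun k => (pair_psum k).[s ^+ N]) (even_schur m N).
  move=> No mN.
  apply: (@eq_newton _ m (fun k => - \sum_(j < N) \sum_(i < j) - (s ^+ i * s ^+ j) ^+ k)).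
    move=> k /andP[k0 _]; rewrite -pair_psumE // -sumrN; apply: eq_bigr => j _.
    by rewrite sumrN opprK.
  apply: newton_inv (fun k km => littlewood_geo No mN km).
  by apply: newton_prod => j _; apply: newton_prod => i _; apply: newton_lin.
(* N must be even and at least 2m for [littlewood_geo] *)
pose pts n := s ^+ (m + n).*2.
have ptsI : injective pts.
  by move=> i j /exps_inj /double_inj /eqP; rewrite eqn_add2l => /eqP.
apply/newtonE; split.
  have -> : (even_schur_const m)`_0 = (E 0%N).[0] by apply: E0.
  suff /eqP : E 0%N - 1 = 0 by rewrite subr_eq0 => /eqP ->; rewrite hornerC.
  apply: (poly_inf_roots ptsI) => n; rewrite hornerD hornerN hornerC -EN //.
  have [] := NN (m + n).*2; rewrite ?odd_double ?leq_double ?leq_addr // => -> _.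
  by rewrite subrr.
move=> k km; rewrite E0 //.
have : E k.+1 *+ k.+1 - \sum_(i < k.+1) pair_psum i.+1 * E (k - i)%N = 0.
  apply: (poly_inf_roots ptsI) => n; rewrite hornerD hornerN hornerMn -EN //.
  have := NN (m + n).*2; rewrite odd_double leq_double leq_addr => /(_ isT isT) /newtonE[_ hN].
  rewrite hN //.
  rewrite horner_sum; apply/eqP; rewrite subr_eq0; apply/eqP; apply: eq_bigr => i _.
  by rewrite hornerM EN // (leq_trans (leq_subr _ _)) // ltnW.
move/eqP; rewrite subr_eq0 => /eqP /(congr1 (fun p : {poly F} => p.[0])).
rewrite hornerMn => ->; rewrite horner_sum; apply: eq_bigr => i _.
by rewrite hornerM pair_psum0 // E0 // (leq_trans (leq_subr _ _)) // ltnW.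
Qed.
End Littlewood.

(** * Sums over multipartitions *)

Section SumMultipart.
Variables (X : choiceType) (wt : X -> nat) (T : {fset X}) (n : nat).
Hypothesis wt_gt0 : forall x, (0 < wt x)%N.
Hypothesis wtT : forall x, (wt x <= n)%N -> x \in T.

Let P := in_tuple (parts_upto n).
Let I := 'I_(size (parts_upto n)).

Let mk_at (f : {ffun T -> I}) (x : X) : intpart :=
  if insub x is Some y then tnth P (f y) else intpart0.
(** The multipartitions of norm at most n, coded by finite functions on [T] with
    values in the positions of the list of partitions of size at most n. *)
Definition mp_of (f : {ffun T -> I}) : multipart X := [fsfun x in T => mk_at f x].

Lemma mp_ofE f (y : T) : mp_of f (val y) = tnth P (f y).
Proof. by rewrite fsfunE /mk_at valK (valP y). Qed.

Lemma mp_of_out f x : x \notin T -> mp_of f x = intpart0.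
Proof. by move=> xT; rewrite fsfunE (negPf xT). Qed.

Lemma mp_of_inj : injective mp_of.
Proof.
move=> f g fg; apply/ffunP => y; apply: (tuple_uniqP P (parts_upto_uniq n)).
by rewrite -!mp_ofE fg.
Qed.

Lemma big_multipart (R : Type) (idx : R) (op : Monoid.com_law idx) (mu : multipart X) (S : {fset X})
    (F : X -> intpart -> R) : {subset finsupp mu <= S} -> (forall x, F x intpart0 = idx) ->
  \big[op/idx]_(x <- finsupp mu) F x (mu x) = \big[op/idx]_(x <- S) F x (mu x).
Proof.
move=> muS F0; apply: big_fset_incl; first exact/fsubsetP.
by move=> x _ xmu; rewrite fsfun_dflt.
Qed.

Lemma mp_norm_ge (mu : multipart X) x : (wt x * sumn (mu x) <= mp_norm wt mu)%N.
Proof.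
case: (boolP (x \in finsupp mu)) => xmu; last by rewrite fsfun_dflt //= muln0.
by rewrite /mp_norm (big_fsetD1 x) //= leq_addr.
Qed.

Lemma sumn_gt0 (la : intpart) : la != intpart0 -> (0 < sumn la)%N.
Proof.
move=> la0; apply: leq_trans (size_sumn la); rewrite lt0n size_eq0.
by apply: contraNneq la0 => e; apply/eqP/val_inj.
Qed.

Lemma mp_normT (mu : multipart X) : (mp_norm wt mu <= n)%N -> {subset finsupp mu <= T}.
Proof.
move=> mun x; rewrite mem_finsupp => mux; apply: wtT.
apply: leq_trans mun; apply: leq_trans (mp_norm_ge mu x).
by rewrite leq_pmulr // sumn_gt0.
Qed.

Lemma mp_of_surj (mu : multipart X) : (mp_norm wt mu <= n)%N -> exists f, mu = mp_of f.
Proof.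
move=> mun; have mem x : mu x \in parts_upto n.
  rewrite mem_parts_upto; apply: leq_trans mun; apply: leq_trans (mp_norm_ge mu x).
  exact: leq_pmull.
have lt (y : T) : (index (mu (val y)) (parts_upto n) < size (parts_upto n))%N.
  by rewrite index_mem mem.
exists [ffun y => Ordinal (lt y)]; apply/fsfunP => x.
case: (boolP (x \in T)) => xT; last first.
  rewrite mp_of_out // fsfun_dflt //; apply: contra xT; exact: mp_normT.
rewrite -[x]/(val ([` xT])%fset) mp_ofE ffunE (tnth_nth intpart0) /=.
by rewrite nth_index // mem.
Qed.

Lemma mp_norm_of f : mp_norm wt (mp_of f) = (\sum_(y : T) wt (val y) * sumn (tnth P (f y)))%N.
Proof.
rewrite /mp_norm (@big_multipart _ _ _ (mp_of f) T (fun x la => wt x * sumn la)%N).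
- rewrite big_seq_fsetE; apply: eq_bigr => y _; by rewrite mp_ofE.
- by move=> x; rewrite mem_finsupp; apply: contraR => /(mp_of_out f) ->.
- by move=> x; rewrite muln0.
Qed.

Lemma finite_multipart : finite_set [set mu : multipart X | mp_norm wt mu = n].
Proof.
apply: (@sub_finite_set _ _ (range mp_of)); last exact/finite_image/finite_finset.
by move=> mu /= mun; have [|f ->] := @mp_of_surj mu; rewrite ?mun //; exists f.
Qed.

(** Expand the product over [T] and collect the terms in which the exponents of X add
    up to n. *)
Lemma sum_multipart (R : comNzRingType) (Q : pred intpart) (w : X -> intpart -> R) :
  Q intpart0 -> (forall x, w x intpart0 = 1) ->
  \sum_(mu \in [set mu : multipart X | mp_norm wt mu = n /\ forall x, Q (mu x)])
     \prod_(x <- finsupp mu) w x (mu x) =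
  (\prod_(x <- T) \sum_(nu <- parts_upto n | Q nu) w x nu *: 'X^(wt x * sumn nu))`_n.
Proof.
move=> Q0 w0.
pose good (f : {ffun T -> I}) := (f \in ffun_on (fun i : I => Q (tnth P i))) &&
   (\sum_(y : T) wt (val y) * sumn (tnth P (f y)) == n)%N.
transitivity (\sum_(mu <- [seq mp_of f | f <- index_enum {ffun T -> I} & good f])
    \prod_(x <- finsupp mu) w x (mu x)).
  rewrite [RHS]fsbig_seq; last by rewrite map_inj_uniq ?filter_uniq ?index_enum_uniq //; exact: mp_of_inj.
  apply: eq_fsbigl; apply/seteqP; split=> mu /=.
    move=> [mun Qmu]; have [|f fmu] := @mp_of_surj mu; first by rewrite mun.
    apply/mapP; exists f => //; rewrite mem_filter mem_index_enum andbT /good.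
    rewrite -mp_norm_of -fmu mun eqxx andbT; apply/ffun_onP => y.
    by rewrite /in_mem /= -mp_ofE -fmu.
  move=> /mapP[f]; rewrite mem_filter => /andP[/andP[/ffun_onP Qf /eqP fn] _] ->.
  split; first by rewrite mp_norm_of.
  move=> x; case: (boolP (x \in T)) => xT; last by rewrite mp_of_out.
  by have := Qf ([` xT])%fset; rewrite /in_mem /= -mp_ofE.
rewrite big_map big_filter big_seq_fsetE /=.
under [in RHS]eq_bigr => y _ do rewrite big_tnth.
rewrite bigA_distr_big coef_sum /good big_mkcondr; apply: eq_bigr => f _.
transitivity ((\prod_(y : T) w (val y) (tnth P (f y))) *
  ('X^(\sum_(y : T) wt (val y) * sumn (tnth P (f y))) : {poly R})`_n).
  rewrite coefXn eq_sym; case: eqP => _; rewrite ?mulr1 ?mulr0 //.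
  rewrite (@big_multipart _ _ _ (mp_of f) T w) //.
    by rewrite big_seq_fsetE; apply: eq_bigr => y _; rewrite mp_ofE.
  by move=> x; rewrite mem_finsupp; apply: contraR => /(mp_of_out f) ->.
by rewrite -coefZ -prodrXr scaler_prod.
Qed.
End SumMultipart.

(** * Schur and Hall-Littlewood polynomials as quotients by the Vandermonde product *)

Section Antisymmetric.
Variable N : nat.
Implicit Types (A B : {mpoly algC[N]}).

(** The substitution [x_i := x_j]; a polynomial it kills is divisible by
    [x_i - x_j]. *)
Definition identify (i j : 'I_N) : {mpoly algC[N]} -> {mpoly algC[N]} :=
  mmap (@mpolyC N algC) (fun k => if k == i then 'X_j else 'X_k).
HB.instance Definition _ i j := GRing.RMorphism.on (identify i j).

Lemma identifyC i j c : identify i j c%:MP = c%:MP.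
Proof. by rewrite /identify mmapC. Qed.

Lemma identifyX i j k : identify i j 'X_k = if k == i then 'X_j else 'X_k.
Proof. by rewrite /identify mmapX mmap1U. Qed.

Lemma identify_dvd i j A : exists B, A - identify i j A = ('X_i - 'X_j) * B.
Proof.
elim/mpolyind: A => [|c m p _ _ [B pB]].
  by exists 0; rewrite rmorph0 subrr mulr0.
have mulD q r : (exists B, q - identify i j q = ('X_i - 'X_j) * B) ->
    (exists B, r - identify i j r = ('X_i - 'X_j) * B) ->
    exists B, q * r - identify i j (q * r) = ('X_i - 'X_j) * B.
  move=> [B1 e1] [B2 e2]; exists (B1 * r + identify i j q * B2).
  rewrite mulrDr mulrA -e1 [X in _ = _ + X]mulrCA -e2 rmorphM /= mulrBl mulrBr addrA subrK.
  by [].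
have [B' mB] : exists B, 'X_[m] - identify i j 'X_[m] = ('X_i - 'X_j) * B.
  rewrite mpolyXE_id; elim/big_ind: _ => //.
  - by exists 0; rewrite rmorph1 subrr mulr0.
  move=> k _; elim: (m k) => [|d IH].
    by exists 0; rewrite expr0 rmorph1 subrr mulr0.
  rewrite exprS; apply: mulD => //; rewrite identifyX; case: eqP => [->|_].
    by exists 1; rewrite mulr1.
  by exists 0; rewrite subrr mulr0.
have sZ : identify i j (c *: 'X_[m]) = c *: identify i j 'X_[m].
  by rewrite -!mul_mpolyC rmorphM /= identifyC.
exists (c *: B' + B).
by rewrite rmorphD /= sZ mulrDr -pB -scalerAr -mB scalerBr opprD addrACA.
Qed.

Lemma mpolyX_inj : injective (fun i : 'I_N => 'X_i : {mpoly algC[N]}).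
Proof.
move=> i j /= e; have /= := congr1 (mcoeff U_(i)%MM) e; rewrite !mcoeffX eqxx.
case: eqP => [/(congr1 (fun m : 'X_{1..N} => m i)) |_ /eqP]; last by rewrite oner_eq0.
by rewrite !mnm1E eqxx; case: eqP.
Qed.

(** The factors [x_i - x_j] can be divided out one after the other, because
    identifying [x_i] with [x_j] kills no other factor. *)
Lemma vander_dvd A :
  (forall i j : 'I_N, (i < j)%N -> identify i j A = 0) ->
  exists B, A = B * vander (fun i => 'X_i).
Proof.
move=> Aij; rewrite /vander pair_big_dep /=.
rewrite -big_filter; set s := filter _ _.
have us : uniq s by rewrite filter_uniq // index_enum_uniq.
have : all (fun p : 'I_N * 'I_N => (p.1 < p.2)%N) s by apply: filter_all.
elim: s us => [|[i j] s IH] /=; first by exists A; rewrite big_nil mulr1.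
move=> /andP[ijs us] /andP[/= ij sP].
have [B AB] := IH us sP.
have : identify i j B = 0.
  have := Aij i j ij; rewrite AB rmorphM rmorph_prod /= => /eqP.
  rewrite mulf_eq0 => /orP[/eqP //|]; rewrite prodf_seq_eq0 => /hasP[[k l] kls /=].
  rewrite rmorphB /= !identifyX subr_eq0.
  have /= kl := allP sP _ kls.
  have kl' : k != l by apply: contraTneq kl => ->; rewrite ltnn.
  case: (k =P i) => ki; case: (l =P i) => li; rewrite (inj_eq mpolyX_inj) => /eqP e.
  - by move: kl'; rewrite ki li eqxx.
  - by move: kls ijs; rewrite ki -e => ->.
  - by move: kl; rewrite e li ltnNge ltnW.
  - by move: kl'; rewrite e eqxx.
move=> B0; have [B' e] := identify_dvd i j B; rewrite B0 subr0 in e.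
exists B'; rewrite big_cons AB e [_ * B']mulrC -mulrA; by [].
Qed.

Let XX : 'I_N -> {mpoly algC[N]} := fun i => 'X_i.

Lemma vanderX_neq0 : vander XX != 0.
Proof.
apply/prodf_neq0 => i _; apply/prodf_neq0 => j ij.
by rewrite subr_eq0 (inj_eq mpolyX_inj) neq_ltn ij.
Qed.

(** The fraction that defines a Schur or Hall-Littlewood polynomial is a
    polynomial, so the choice made by [poly_of_frac] is the expected one. *)
Lemma poly_of_fracE A B : A = B * vander XX ->
  poly_of_frac (FracField.tofrac A / FracField.tofrac (vander XX)) = B.
Proof.
move=> ->; rewrite tofracM mulfK ?tofrac_eq0 ?vanderX_neq0 //.
rewrite /poly_of_frac; case: xgetP => [p _ /= /eqP|]; first by rewrite tofrac_eq => /eqP.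
by move=> /(_ B) /=.
Qed.

Lemma alternantX_dvd (al : 'I_N -> nat) : exists B, alternant XX al = B * vander XX.
Proof.
apply: vander_dvd => i j ij; rewrite map_alternant.
apply: (@determinant_alternate _ _ _ i j); first by rewrite neq_ltn ij.
move=> k; rewrite !mxE /= /XX !identifyX eqxx; case: (j =P i) => // ->.
Qed.

Lemma schur_spec (la : intpart) : (size la <= N)%N ->
  schur la N * vander XX = alternant XX (fun j => nth 0 la j + (N - j.+1))%N.
Proof.
move=> lN; rewrite /schur lN.
have tofrac_alt al : \det (\matrix_(i < N, j < N) (FracField.tofrac (XX i) ^+ al j)) =
    FracField.tofrac (alternant XX al).
  rewrite -det_map_mx; congr (\det _).
  by apply/matrixP => i j; rewrite !mxE /= tofracXn.
rewrite /schur_frac (tofrac_alt (fun j => nth 0 la j + (N - j.+1))%N).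
rewrite (tofrac_alt (fun j => N - j.+1)%N) alternant_delta.
have [B e] := alternantX_dvd (fun j => nth 0 la j + (N - j.+1))%N.
by rewrite (poly_of_fracE e) e.
Qed.

Definition HL_term (t : algC) (la : seq nat) (w : 'S_N) : {mpoly algC[N]} :=
  (\prod_(i < N) 'X_(w i) ^+ nth 0%N la i) *
  \prod_(i < N) \prod_(j < N | (i < j)%N) ('X_(w i) - t%:MP * 'X_(w j)).

Lemma vander_perm (w : 'S_N) : vander (fun i => XX (w i)) = (-1) ^+ w * vander XX.
Proof.
rewrite -!alternant_delta -det_perm -det_mulmx -row_permE; congr (\det _).
by apply/matrixP => i j; rewrite !mxE.
Qed.

(** Exchanging [x_i] and [x_j] changes the sign of the sum, but has no effect after
    they are identified. *)
Lemma HL_antisym t la (i j : 'I_N) : (i < j)%N ->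
  identify i j (\sum_(w : 'S_N) (-1) ^+ w * HL_term t la w) = 0.
Proof.
move=> ij; have ij' : i != j by rewrite neq_ltn ij.
have idt k : identify i j 'X_(tperm i j k) = identify i j 'X_k.
  rewrite !identifyX; by case: tpermP => [->|->|//]; rewrite eqxx if_same.
have HLt w : identify i j (HL_term t la (w * tperm i j)%g) = identify i j (HL_term t la w).
  rewrite /HL_term !rmorphM !rmorph_prod /=; congr (_ * _).
    by apply: eq_bigr => u _; rewrite !rmorphXn /= permM idt.
  apply: eq_bigr => u _; rewrite !rmorph_prod; apply: eq_bigr => v _.
  by rewrite /= !rmorphB !rmorphM /= !permM !idt.
set S := identify _ _ _.
(* reindex by [w |-> w * (i j)], which changes the sign but not the identified term *)
suff : S = - S by move/eqP; rewrite -addr_eq0 -mulr2n -mulr_natr mulf_eq0 -mpolyC_nat mpolyC_eq0 pnatr_eq0 orbF => /eqP.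
rewrite {1}/S rmorph_sum /= (reindex_inj (mulIg (tperm i j))) /=.
rewrite /S rmorph_sum -sumrN; apply: eq_bigr => w _.
rewrite [in LHS]rmorphM [in RHS]rmorphM; rewrite /= HLt odd_permM odd_tperm ij' !rmorph_sign /= -mulNr; congr (_ * _).
by case: (odd_perm w) => /=; rewrite ?expr0 ?expr1 ?opprK.
Qed.

(** The factors [x_(w i) - x_(w j)] in the denominators multiply to the Vandermonde
    product up to the sign of w. *)
Lemma hall_littlewood_spec t (la : intpart) : (size la <= N)%N ->
  hall_littlewood t la N * vander XX =
  (HL_v N t la)^-1%:MP * \sum_(w : 'S_N) (-1) ^+ w * HL_term t la w.
Proof.
move=> lN; rewrite /hall_littlewood lN.
have [B e] : exists B, (HL_v N t la)^-1%:MP * \sum_(w : 'S_N) (-1) ^+ w * HL_term t la w =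
    B * vander XX.
  by apply: vander_dvd => i j ij; rewrite rmorphM /= HL_antisym ?mulr0.
rewrite e -(poly_of_fracE e); congr (poly_of_frac _ * _).
rewrite /HL_frac tofracM -[RHS]mulrA; congr (_ * _).
rewrite rmorph_sum mulr_suml; apply: eq_bigr => w _ /=.
have -> : FracField.tofrac ((-1) ^+ w * HL_term t la w) / FracField.tofrac (vander XX) =
    FracField.tofrac (HL_term t la w) / FracField.tofrac (vander (fun i => XX (w i))).
  rewrite vander_perm !tofracM invfM mulrAC [RHS]mulrC -!mulrA; congr (_ * _).
  by rewrite rmorph_sign; case: (odd_perm w); rewrite ?expr0 ?expr1 ?invrN ?invr1 // mulrC.
rewrite /HL_term tofracM -mulrA rmorph_prod; congr (_ * _).
  by apply: eq_bigr => i _; rewrite /= tofracXn.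
rewrite /vander !rmorph_prod -prodf_div; apply: eq_bigr => i _.
rewrite !rmorph_prod -prodf_div; apply: eq_bigr => j _.
by rewrite /= !tofracB tofracM.
Qed.
End Antisymmetric.

(** * Schur and Hall-Littlewood polynomials at a geometric progression *)

Lemma alternant_scale (R : comNzRingType) N (c : R) (x : 'I_N -> R) al :
  alternant (fun i => c * x i) al = c ^+ (\sum_j al j) * alternant x al.
Proof.
rewrite -prodrXr /alternant -[in RHS]det_tr -det_scale_rows -det_tr; congr (\det _).
by apply/matrixP => i j; rewrite !mxE exprMn.
Qed.

Lemma meval_vander N (x : 'I_N -> algC) :
  (vander (fun i => 'X_i)).@[x] = vander x.
Proof.
rewrite /vander rmorph_prod; apply: eq_bigr => i _; rewrite rmorph_prod.
by apply: eq_bigr => j _; rewrite /= mevalB !mevalXU.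
Qed.

Lemma schur_meval N (la : intpart) (x : 'I_N -> algC) : (size la <= N)%N ->
  (schur la N).@[x] * vander x = alternant x (fun j => nth 0 la j + (N - j.+1))%N.
Proof.
move=> lN; have := congr1 (meval x) (schur_spec lN).
rewrite mevalM meval_vander => ->; rewrite (map_alternant (meval x)); congr (\det _).
by apply/matrixP => i j; rewrite !mxE /= mevalXU.
Qed.

Section Principal.
Variable s : algC.
Hypothesis s0 : s != 0.
Hypothesis s1 : forall k, s ^+ k.+1 != 1.

Lemma schur_geo N (la : intpart) (c : algC) : c != 0 -> (size la <= N)%N ->
  (schur la N).@[fun i => c * s ^+ i] = c ^+ sumn la * (schurV s la).[s ^+ N].
Proof.
move=> c0 lN; have := schur_meval (fun i => c * s ^+ i) lN.
rewrite -alternant_delta !alternant_scale big_split /= -sumn_ord // exprD -!mulrA mulrA.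
rewrite alternant_delta (schurV_eval s0 s1 lN) !mulrA mulrC => /esym.
set D := vander _; have D0 : D != 0 by apply: vander_geo_neq0.
rewrite ![_ * D]mulrC => /(mulfI D0); rewrite mulrAC ![_ * c ^+ (\sum_(j < N) _)]mulrC.
by move/mulfI=> <- //; rewrite expf_neq0.
Qed.

Lemma perm_incr N (w : 'S_N) :
  (forall i j : 'I_N, (j = i.+1 :> nat) -> (w i < w j)%N) -> w = 1%g.
Proof.
move=> winc.
(* each step up by 1 raises w by at least 1; w starts at 0 or more and ends at N-1
   or less *)
have ge d : forall i j : 'I_N, (j = i + d :> nat)%N -> (w i + d <= w j)%N.
  elim: d => [|d IH] i j jd; first by rewrite !addn0 in jd *; rewrite (val_inj jd).
  have kN : (i + d < N)%N by have := ltn_ord j; lia.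
  have := IH i (Ordinal kN) erefl; have := winc (Ordinal kN) j.
  by rewrite jd addnS => /(_ erefl); lia.
apply/permP => i; rewrite perm1; apply: val_inj.
have N0 : (0 < N)%N by have := ltn_ord i; lia.
have h1 := ge i (Ordinal N0) i erefl.
have Nm : (N.-1 < N)%N by lia.
have h2 := ge (N.-1 - i)%N i (Ordinal Nm); have := ltn_ord i; have := ltn_ord (w (Ordinal Nm)).
by move: h1 h2 => /=; lia.
Qed.

(** A permutation w other than 1 has a pair [i < j] with [w i = w j + 1], and the
    factor [x_(w i) - s x_(w j)] vanishes at that pair. *)
Lemma HL_term_geo N (c : algC) la (w : 'S_N) : w != 1%g ->
  (HL_term s la w).@[fun i => c * s ^+ i] = 0.
Proof.
move=> w1; rewrite /HL_term mevalM.
suff -> : (\prod_(i < N) \prod_(j < N | (i < j)%N) ('X_(w i) - s%:MP * 'X_(w j))).@[fun i => c * s ^+ i] = 0.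
  by rewrite mulr0.
have [[i [j [ij wij]]]|no] := pselect (exists i j : 'I_N, (i < j)%N /\ w i = (w j).+1 :> nat).
  rewrite rmorph_prod (bigD1 i) //= rmorph_prod (bigD1 j) //= mevalB mevalM !mevalXU mevalC.
  by rewrite wij exprS mulrCA subrr !mul0r.
case/eqP: w1; apply: invg_inj; rewrite invg1; apply: perm_incr => i j ji.
rewrite ltnNge; apply/negP => h; apply: no; exists (w^-1 j)%g, (w^-1 i)%g.
rewrite !permKV; split=> //; rewrite ltn_neqAle h andbT.
by apply/eqP => /val_inj /perm_inj e; move: ji; rewrite e; lia.
Qed.

(** [P_la(1, s, s^2, ...; s)], by the formula
    [s^n(la) / prod_i ((1 - s) ... (1 - s^(m_i)))] with [m_i] the multiplicity of i
    in [la]. *)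
Definition HL_const (la : seq nat) : algC :=
  s ^+ npart la / ((1 - s) ^+ size la * \prod_(a <- undup la) HL_v1 s (count_mem a la)).

Definition HL_V (la : seq nat) : {poly algC} :=
  HL_const la *: \prod_(j < size la) (1 - (s ^+ j)^-1 *: 'X).

Lemma HL_v1S m : HL_v1 s m.+1 = HL_v1 s m * ((1 - s ^+ m.+1) / (1 - s)).
Proof. by rewrite /HL_v1 big_nat_recr. Qed.

Lemma one_sub_neq0 : 1 - s != 0.
Proof. by have := s1 0; rewrite expr1 subr_eq0 eq_sym. Qed.

Lemma HL_v1_neq0 m : HL_v1 s m != 0.
Proof.
elim: m => [|m IH]; first by rewrite /HL_v1 big_geq // oner_neq0.
by rewrite HL_v1S !mulf_neq0 ?invr_eq0 ?one_sub_neq0 // subr_eq0 eq_sym.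
Qed.

Lemma HL_v1_split N l : (l <= N)%N ->
  HL_v1 s N = HL_v1 s (N - l) * (\prod_(j < l) (1 - s ^+ (N - j))) / (1 - s) ^+ l.
Proof.
elim: l => [|l IH] lN; first by rewrite subn0 big_ord0 mulr1 expr0 divr1.
rewrite IH 1?ltnW // (_ : (N - l)%N = (N - l.+1).+1); last by lia.
rewrite HL_v1S big_ord_recr /= [(1 - s) ^+ l.+1]exprS.
have -> : (N - l)%N = (N - l.+1).+1 by lia.
have := one_sub_neq0; move: (1 - s) => u u0; field.
by rewrite u0 expf_neq0.
Qed.

(** The quotient by the Vandermonde product of the factors [x_i - s x_j] at a
    geometric progression; the product over i telescopes. *)
Lemma HL_cross N : \prod_(j < N) \prod_(i < j) ((1 - s ^+ (j - i).+1) / (1 - s ^+ (j - i))) = HL_v1 s N.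
Proof.
elim: N => [|N IH]; first by rewrite big_ord0 /HL_v1 big_geq.
rewrite big_ord_recr /= IH HL_v1S; congr (_ * _).
elim: N {IH} => [|N IH]; first by rewrite big_ord0 expr1 divff // one_sub_neq0.
rewrite big_ord_recl /= subn0.
under eq_bigr => i _ do rewrite /bump /= add1n subSS.
rewrite IH mulrA divfK // subr_eq0 eq_sym; exact: s1.
Qed.

(** Only the identity term contributes to the sum over permutations. For N smaller
    than the length of [la] the polynomial [HL_V] vanishes too, so that the
    formula holds for all N. *)
Lemma HL_geo N (la : intpart) (c : algC) : c != 0 ->
  (hall_littlewood s la N).@[fun i => c * s ^+ i] = c ^+ sumn la * (HL_V la).[s ^+ N].
Proof.
move=> c0; have [lN|Nl] := leqP (size la) N; last first.
  rewrite /hall_littlewood leqNgt Nl /= meval0 /HL_V hornerZ horner_prod.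
  rewrite (bigD1 (Ordinal Nl)) //= hornerD hornerN hornerC hornerZ hornerX mulVf ?expf_neq0 //.
  by rewrite subrr mul0r !mulr0.
have := congr1 (meval (fun i => c * s ^+ i)) (hall_littlewood_spec s lN).
rewrite !mevalM meval_vander mevalC rmorph_sum (bigD1 1%g) //= big1 ?addr0; last first.
  by move=> w w1; rewrite mevalM HL_term_geo ?mulr0.
rewrite odd_perm1 expr0 mul1r /HL_term mevalM.
have -> : (\prod_(i < N) 'X_((1%g : 'S_N) i) ^+ nth 0%N la i).@[fun i => c * s ^+ i] =
    c ^+ sumn la * s ^+ npart la.
  rewrite rmorph_prod (sumn_ord lN) -prodrXr.
  rewrite /npart (big_ord_widen N (fun i => i * nth 0 la i)%N) //.
  rewrite (_ : (\sum_(_ < _ | _) _)%N = \sum_(i < N) i * nth 0 la i)%N; last first.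
    rewrite big_mkcond; apply: eq_bigr => i _; case: ifPn => // h.
    by rewrite nth_default ?muln0 // leqNgt.
  rewrite -prodrXr -big_split; apply: eq_bigr => i _.
  by rewrite /= rmorphXn /= mevalXU perm1 exprMn -exprM.
have vE : vander (fun i : 'I_N => c * s ^+ i) =
    \prod_(j < N) \prod_(i < j) (c * s ^+ i * (1 - s ^+ (j - i))).
  rewrite /vander (prod_swap N (fun i j => c * s ^+ i - c * s ^+ j)).
  apply: eq_bigr => j _; apply: eq_bigr => i _.
  by rewrite mulrBr mulr1 -mulrA -exprD subnKC // ltnW.
have -> : (\prod_(i < N) \prod_(j < N | (i < j)%N)
     ('X_((1%g : 'S_N) i) - s%:MP * 'X_((1%g : 'S_N) j))).@[fun i => c * s ^+ i] =
   HL_v1 s N * vander (fun i : 'I_N => c * s ^+ i).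
  rewrite vE -HL_cross -big_split rmorph_prod /=.
  transitivity (\prod_(i < N) \prod_(j < N | (i < j)%N) (c * s ^+ i - s * (c * s ^+ j))).
    apply: eq_bigr => i _; rewrite rmorph_prod; apply: eq_bigr => j _.
    by rewrite /= mevalB mevalM !mevalXU mevalC !perm1.
  rewrite (prod_swap N (fun i j => c * s ^+ i - s * (c * s ^+ j))).
  apply: eq_bigr => j _; rewrite -big_split; apply: eq_bigr => i _ /=.
  have e : s ^+ j = s ^+ i * s ^+ (j - i) by rewrite -exprD subnKC // ltnW.
  have := subs_neq0 s1 (k := (j - i)%N); rewrite subn_gt0 ltn_ord => /(_ isT).
  by rewrite e exprS; move: (s ^+ (j - i)) => u u0; field.
rewrite !mulrA => /mulIf ->; last first.
  rewrite -alternant_delta alternant_scale mulf_neq0 ?expf_neq0 // alternant_delta.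
  exact: vander_geo_neq0.
suff <- : (HL_v N s la)^-1 * s ^+ npart la * HL_v1 s N = (HL_V la).[s ^+ N].
  by rewrite -!mulrA; ring.
rewrite /HL_V hornerZ horner_prod /HL_const /HL_v (HL_v1_split lN).
have -> : \prod_(i < size la) (1 - (s ^+ i)^-1 *: 'X).[s ^+ N] = \prod_(j < size la) (1 - s ^+ (N - j)).
  apply: eq_bigr => j _; rewrite hornerD hornerN hornerC hornerZ hornerX.
  have jN : (j <= N)%N by apply: leq_trans lN; apply: ltnW.
  by rewrite -{1}(subnK jN) exprD mulrCA mulVf ?mulr1 // expf_neq0.
have := HL_v1_neq0 (N - size la).
have : \prod_(a <- undup la) HL_v1 s (count_mem a la) != 0.
  by rewrite prodf_seq_neq0; apply/allP => a _; apply: HL_v1_neq0.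
have := one_sub_neq0.
move: (HL_v1 _ _) (\prod_(_ <- _) _) (1 - s) => A B u u0 B0 A0.
by field; rewrite A0 B0 expf_neq0.
Qed.

(** By [HL_geo] the value at [c s^i] is a multiple of [c^|la|] for every nonzero c,
    hence also for c = 0, as both sides are polynomials in c. *)
Lemma HL_zero N (la : intpart) : la != intpart0 ->
  (hall_littlewood s la N).@[fun=> 0] = 0.
Proof.
move=> la0; set p := hall_littlewood s la N.
(* the polynomial in c with value [p(c, c s, c s^2, ...)] *)
pose P : {poly algC} := mmap (@polyC algC) (fun i : 'I_N => s ^+ i *: 'X) p.
have PE c : P.[c] = p.@[fun i => c * s ^+ i].
  rewrite /P /mmap horner_sum mevalE; apply: eq_bigr => m _.
  rewrite hornerM hornerC /mmap1 horner_prod; congr (_ * _); apply: eq_bigr => i _.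
  by rewrite horner_exp hornerZ hornerX mulrC.
suff e : P = (HL_V la).[s ^+ N] *: 'X^(sumn la).
  have := PE 0; rewrite e hornerZ hornerXn expr0n.
  have -> : (sumn la == 0)%N = false.
    apply/negbTE; rewrite -lt0n; apply: leq_trans (size_sumn la).
    by rewrite lt0n size_eq0; apply: contraNneq la0 => h; apply/eqP/val_inj.
  rewrite mulr0 => h; have -> : p.@[fun=> 0] = p.@[fun i : 'I_N => 0 * s ^+ i].
    by apply: meval_eq => i; rewrite mul0r.
  by rewrite -h.
apply/eqP; rewrite -subr_eq0; apply/eqP.
apply: (@poly_inf_roots _ (fun n => n.+1%:R)).
  by move=> i j /eqP; rewrite eqr_nat => /eqP [].
move=> n; rewrite hornerD hornerN hornerZ hornerXn PE HL_geo ?pnatr_eq0 //.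
by rewrite mulrC subrr.
Qed.
End Principal.

(** * Orbits, and the groups M_m *)

Section Orbits.
Variables (T : choiceType) (f : T -> T).

(** The orbit of x is a cycle of length d. *)
Definition minimal_period (x : T) (d : nat) :=
  (0 < d)%N /\ forall j, iter j f x = x <-> (d %| j)%N.

Lemma iter_mul x k m : iter k f x = x -> iter (m * k) f x = x.
Proof. by move=> kx; elim: m => //= m IH; rewrite mulSn iterD IH. Qed.

Lemma iter_mod x k j : iter k f x = x -> iter j f x = iter (j %% k) f x.
Proof. by move=> kx; rewrite {1}(divn_eq j k) addnC iterD iter_mul. Qed.

Lemma minimal_periodP x k : (0 < k)%N -> iter k f x = x -> exists d, minimal_period x d.
Proof.
move=> k0 kx; have ex : exists n, (0 < n)%N && (iter n f x == x).
  by exists k; rewrite k0 kx eqxx.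
case: (ex_minnP ex) => d /andP[d0 /eqP dx] dmin; exists d; split=> // j.
split=> [jx|/dvdnP[m ->]]; last exact: iter_mul.
rewrite /dvdn; case: (posnP (j %% d)) => // r0.
have := dmin (j %% d)%N; rewrite r0 -iter_mod // jx eqxx => /(_ isT).
by rewrite leqNgt ltn_pmod.
Qed.

Lemma traject_uniq x d : minimal_period x d -> uniq (traject f x d).
Proof.
move=> [d0 dP]; apply/(uniqP x) => i j; rewrite !inE size_traject => id jd.
have dx : iter d f x = x by apply/dP.
rewrite !nth_traject //.
wlog ij : i j id jd / (i <= j)%N => [hw|].
  by case: (leqP i j) => [|/ltnW] ij e; [apply: hw|apply/esym/hw].
move=> e; have : iter (d - i) f (iter j f x) = x.
  by rewrite -e -iterD subnK // ltnW.
rewrite -iterD => /dP; have -> : (d - i + j = d + (j - i))%N by lia.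
rewrite dvdn_addr // /dvdn modn_small; last by lia.
by move/eqP; lia.
Qed.

Lemma forbitE x k : (0 < k)%N -> iter k f x = x -> forbit f x = [set` traject f x k].
Proof.
move=> k0 kx; apply/seteqP; split=> [_ [j _ <-]|y] /=.
  by apply/trajectP; exists (j %% k)%N; rewrite ?ltn_pmod // -iter_mod.
by case/trajectP => j _ ->; exists j.
Qed.

Lemma forbit_size x d : minimal_period x d -> #|` fset_set (forbit f x)| = d.
Proof.
move=> dP; have [d0 dx] := dP.
rewrite (forbitE d0); last exact/dx.
have <- : seq_fset tt (traject f x d) = fset_set [set` traject f x d].
  apply/fsetP => y; rewrite seq_fsetE in_fset_set ?mem_setE //; exact: finite_seq.
by rewrite size_seq_fset undup_id ?size_traject // traject_uniq.
Qed.

Lemma forbit_eq x y k : (0 < k)%N -> iter k f x = x -> forbit f x y -> forbit f y = forbit f x.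
Proof.
move=> k0 kx [j _ <-]; apply/seteqP; split=> [_ [i _ <-]|_ [i _ <-]].
  by exists (i + j)%N => //; rewrite iterD.
exists (i + (j * k - j))%N => //; rewrite -iterD -addnA subnK ?leq_pmulr //.
by rewrite iterD iter_mul.
Qed.

End Orbits.

Section UnitaryField.
Variables (Fq : finFieldType) (K : closedFieldType) (io : {rmorphism Fq -> K}).
Local Notation q := #|Fq|.
Local Notation Q := (- q%:Z).

Lemma q_gt1 : (1 < q)%N. Proof. exact: finNzRing_gt1. Qed.

Lemma FK_iter (x : K) j : x != 0 -> iter j (@FK Fq K) x = x ^ (Q ^+ j).
Proof.
move=> x0; elim: j => [|j IH]; first by rewrite expr0 expr1z.
by rewrite iterS IH /FK exprnN exprz_exp exprSr.
Qed.

Lemma Q_card m : q%:Z ^+ m - (-1) ^+ m = (Q ^+ m - 1) * (-1) ^+ m.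
Proof. by rewrite mulrBl mul1r -exprMn mulrN1 opprK. Qed.

Lemma MgrpE m (x : K) : Mgrp Fq m x <-> x != 0 /\ x ^ (Q ^+ m - 1) = 1.
Proof.
rewrite /Mgrp /= Q_card; split=> -[x0 h]; split=> //; last by rewrite -exprz_exp h exp1rz.
have := congr1 (fun y => y ^ ((-1) ^+ m : int)) h.
by rewrite /= exprz_exp -mulrA -exprMn mulrNN mulr1 expr1n mulr1 exp1rz.
Qed.

(** [M_m] is the set of fixed points of [F^m] on [K^x], since
    [q^m - (-1)^m] and [(-q)^m - 1] agree up to sign. *)
Lemma Mgrp_iter m (x : K) : Mgrp Fq m x <-> x != 0 /\ iter m (@FK Fq K) x = x.
Proof.
rewrite MgrpE; split=> -[x0 h]; split=> //.
  by rewrite FK_iter // -[Q ^+ m](subrK 1) expfzDr // h expr1z mul1r.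
by rewrite expfzDr // -FK_iter // h exprN1 mulfV.
Qed.

Definition cardM m : nat := if odd m then (q ^ m).+1 else (q ^ m).-1.

Lemma cardME m : (cardM m)%:Z = q%:Z ^+ m - (-1) ^+ m.
Proof.
have qm : (q ^ m)%N%:Z = q%:Z ^+ m by rewrite -[LHS]natz natrX natz.
rewrite /cardM -signr_odd -qm; case: (odd m); rewrite ?expr0 ?expr1 ?opprK.
  by rewrite -addn1 PoszD.
have q0 : (0 < q ^ m)%N by rewrite expn_gt0 (ltn_trans _ q_gt1).
by rewrite -subn1 -subzn.
Qed.

Lemma cardM_gt0 m : (0 < m)%N -> (0 < cardM m)%N.
Proof.
move=> m0; rewrite /cardM; case: (odd m) => //; rewrite -ltnS prednK ?expn_gt0 ?(ltn_trans _ q_gt1) //.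
by rewrite -(exp1n m) ltn_exp2r // q_gt1.
Qed.

Lemma MgrpX m (x : K) : (0 < m)%N -> Mgrp Fq m x <-> x ^+ cardM m = 1.
Proof.
move=> m0; rewrite /Mgrp /= -cardME; split=> [[]//|h]; split=> //.
by apply: contra_eq_neq h => ->; rewrite expr0n eqn0Ngt cardM_gt0 // eq_sym oner_eq0.
Qed.

Lemma cardM_pchar m : (0 < m)%N -> (cardM m)%:R != 0 :> K.
Proof.
move=> m0; have pr_p := pdiv_prime q_gt1; set p := pdiv q in pr_p.
have q0 : (0 < q)%N by apply: ltn_trans q_gt1.
have pK : p \in [pchar K].
  by have /(pnatP _ q0)/(_ p pr_p (pdiv_dvd q)) := card_pnat io.
have qm0 : ((q ^ m)%N)%:R = 0 :> K.
  apply/eqP; rewrite -(dvdn_pcharf pK); apply: dvdn_exp => //; exact: pdiv_dvd.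
rewrite /cardM; case: (odd m); first by rewrite -addn1 natrD qm0 add0r oner_neq0.
by rewrite -subn1 natrB ?expn_gt0 ?q0 // qm0 sub0r oppr_eq0 oner_neq0.
Qed.

(** [M_m] is cyclic of order [q^m - (-1)^m], because this order is prime to the
    characteristic. *)
Lemma Mgrp_prim m : (0 < m)%N -> exists g : K, (cardM m).-primitive_root g.
Proof.
move=> m0; have n0 := cardM_gt0 m0; set n := cardM m in n0 *.
pose P : {poly K} := 'X^n - 1.
have [r Pr] := closed_field_poly_normal P.
have lP : lead_coef P = 1 by rewrite lead_coefDl ?lead_coefXn // size_polyXn size_polyN size_poly1 ltnS.
rewrite lP scale1r in Pr.
have szr : size r = n.
  by apply: succn_inj; rewrite -(size_prod_XsubC r id) -Pr size_XnsubC.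
have ur : uniq r.
  by rewrite -separable_prod_XsubC -Pr separable_Xn_sub_1 // cardM_pchar.
have [g [gr gp]] : exists g, g \in r /\ n.-primitive_root g.
  have /hasP[g gr gp] : has n.-primitive_root r.
    apply: has_prim_root => //; last by rewrite szr.
    apply/allP => x xr; rewrite unity_rootE -subr_eq0.
    have : root P x by rewrite Pr root_prod_XsubC.
    by rewrite /root !hornerE.
  by exists g.
by exists g.
Qed.

End UnitaryField.

(** * Orbit polynomials *)

Section PhiSide.
Variables (Fq : finFieldType) (K : closedFieldType) (io : {rmorphism Fq -> K}).
Hypothesis Kalg : integralRange io.
Local Notation q := #|Fq|.
Local Notation FKq := (@FK Fq K).

Lemma q_gt0 : (0 < q)%N. Proof. exact: ltn_trans (q_gt1 Fq). Qed.

Lemma sum_Xq (I : Type) (r : seq I) (G : I -> K) : (\sum_(k <- r) G k) ^+ q = \sum_(k <- r) G k ^+ q.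
Proof.
elim: r => [|k r IH]; first by rewrite !big_nil expr0n eqn0Ngt q_gt0.
by rewrite !big_cons exprDn_pchar ?(card_pnat io) // IH.
Qed.

Lemma Xqm_inj m : injective (fun x : K => x ^+ (q ^ m)).
Proof.
move=> x y /= /eqP; rewrite -subr_eq0 => e; apply/eqP; rewrite -subr_eq0; move: e.
have qp : [pchar K].-nat (q ^ m)%N by rewrite pnatX (card_pnat io).
rewrite -exprNn_pchar // -exprDn_pchar // expf_eq0 => /andP[_]; by [].
Qed.

Lemma root_Xq (p : {poly Fq}) x : root (map_poly io p) x -> root (map_poly io p) (x ^+ q).
Proof.
rewrite /root !horner_coef !size_map_poly => /eqP /(congr1 (fun y => y ^+ q)).
rewrite expr0n eqn0Ngt q_gt0 /= sum_Xq => e; apply/eqP; rewrite -[RHS]e.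
apply: eq_bigr => i _; rewrite coef_map exprMn -rmorphXn /= expf_card.
by rewrite -!exprM mulnC.
Qed.

(** This is where algebraicity of K over the finite field enters: the powers
    [x^(q^i)] are roots of one polynomial, so two of them agree. *)
Lemma FK_periodic (x : K) : x != 0 -> exists2 k, (0 < k)%N & iter k FKq x = x.
Proof.
move=> x0; have [p pm px] := Kalg x.
have rt i : root (map_poly io p) (x ^+ (q ^ i)).
  elim: i => [|i IH]; first by rewrite expn0 expr1.
  by rewrite expnSr exprM root_Xq.
have P0 : map_poly io p != 0 by rewrite map_poly_eq0 monic_neq0.
pose s := [seq x ^+ (q ^ i) | i <- iota 0 (size (map_poly io p))].
have us : ~ uniq s.
  move=> us; have /(max_poly_roots P0)/(_ us) : all (root (map_poly io p)) s.
    by apply/allP => _ /mapP[i _ ->].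
  by rewrite size_map size_iota ltnn.
have [i [j [ij e]]] : exists i j, (i < j)%N /\ x ^+ (q ^ i) = x ^+ (q ^ j).
  apply: contrapT => no; apply: us.
  rewrite map_inj_uniq ?iota_uniq // => i j e; case: (ltngtP i j) => // ij; case: no.
    by exists i, j.
  by exists j, i.
have xd : x ^+ (q ^ (j - i)) = x.
  by apply: (@Xqm_inj i); rewrite -exprM -expnD subnK 1?ltnW.
exists (j - i).*2; first by rewrite double_gt0 subn_gt0.
rewrite FK_iter // -muln2 mulnC exprM sqrrN -exprM mulnC exprM.
have -> : (q%:Z ^+ (j - i)) ^+ 2 = (q ^ (j - i) * q ^ (j - i))%N.
  by rewrite PoszM -expr2 -[X in _ = X ^+ 2]natz natrX natz.
by rewrite -[LHS]/(x ^+ _) exprM !xd.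
Qed.

Local Notation valK2 := (val : {rmorphism K2 io -> K}).

Lemma iterFK_neq0 j x : x != 0 -> iter j FKq x != 0.
Proof. by move=> x0; rewrite FK_iter // expfz_neq0. Qed.

Lemma Phi_base (f : Phi io) : exists x d, [/\ x != 0, minimal_period FKq x d,
  map_poly val (Phi_poly f) = \prod_(z <- traject FKq x d) ('X - z%:P) & degPhi f = d].
Proof.
have /asboolP[x x0 fE] := PhiP f; have [k k0 xk] := FK_periodic x0.
have [d dP] := minimal_periodP k0 xk; exists x, d.
have fE' : map_poly val (Phi_poly f) = \prod_(z <- traject FKq x d) ('X - z%:P).
  rewrite fE (forbitE (proj1 dP)) ?(proj2 (proj2 dP d)) //.
  by rewrite -fsbig_seq // traject_uniq.
split=> //; rewrite /degPhi -(size_map_poly valK2) /= fE'.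
by rewrite (size_prod_XsubC _ id) size_traject.
Qed.

(** Every root of an orbit polynomial generates the orbit, so a polynomial in [Phi]
    is determined by any of its roots. *)
Lemma Phi_root_orbit (f : Phi io) x : root (map_poly val (Phi_poly f)) x ->
  [/\ x != 0, minimal_period FKq x (degPhi f) &
   map_poly val (Phi_poly f) = \big[*%R/1]_(y \in forbit FKq x) ('X - y%:P)].
Proof.
have [y [d [y0 dP fE ->]]] := Phi_base f; have [d0 yd] := dP.
rewrite fE root_prod_XsubC => /trajectP[j jd xE].
have xy : forbit FKq y x by exists j.
have dy : iter d FKq y = y by apply/yd.
split; first by rewrite xE iterFK_neq0.
  split=> // i; rewrite -yd; split=> e; last by rewrite xE -iterD addnC iterD e.
  have yx : forbit FKq x y by rewrite (forbit_eq d0 dy xy); exists 0%N.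
  by case: yx => l _ <-; rewrite -iterD addnC iterD e.
rewrite (forbit_eq d0 dy xy) (forbitE d0 dy) -fsbig_seq // traject_uniq //.
Qed.

Lemma Phi_root_eq (f g : Phi io) x : root (map_poly val (Phi_poly f)) x ->
  root (map_poly val (Phi_poly g)) x -> f = g.
Proof.
move=> /Phi_root_orbit[_ _ fE] /Phi_root_orbit[_ _ gE]; apply: val_inj.
by apply: (map_poly_inj valK2); rewrite /= fE gE.
Qed.

Definition frobq2 (x : K) : K := x ^+ (q ^ 2).
Fact frobq2_zmod : zmod_morphism frobq2.
Proof.
have qp : [pchar K].-nat (q ^ 2)%N by rewrite pnatX (card_pnat io).
by move=> x y; rewrite /frobq2 exprDn_pchar // exprNn_pchar.
Qed.
Fact frobq2_monoid : monoid_morphism frobq2.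
Proof. by split=> [|x y]; rewrite /frobq2 ?expr1n ?exprMn. Qed.
HB.instance Definition _ := GRing.isZmodMorphism.Build K K frobq2 frobq2_zmod.
HB.instance Definition _ := GRing.isMonoidMorphism.Build K K frobq2 frobq2_monoid.

Lemma frobq2E x : x != 0 -> frobq2 x = iter 2 FKq x.
Proof. by move=> x0; rewrite /= /FK /frobq2 exprVn invrK -exprM -mulnn. Qed.

(** The polynomial of an orbit has coefficients in [K_2], being fixed by
    [x |-> x^(q^2)], which is [F^2]. *)
Lemma Phi_exists x : x != 0 -> exists f : Phi io, root (map_poly val (Phi_poly f)) x.
Proof.
move=> x0; have [k k0 xk] := FK_periodic x0.
have [d dP] := minimal_periodP k0 xk; have [d0 xd] := dP.
have dx : iter d FKq x = x by apply/xd.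
pose s := traject FKq x d; have us : uniq s by apply: traject_uniq.
pose P := \prod_(z <- s) ('X - z%:P).
have s0 z : z \in s -> z != 0 by move=> /trajectP[j _ ->]; apply: iterFK_neq0.
have PF : map_poly frobq2 P = P.
  transitivity (\prod_(z <- map frobq2 s) ('X - z%:P)).
    by rewrite /P rmorph_prod big_map; apply: eq_bigr => z _; rewrite /= map_polyXsubC.
  apply: perm_big; apply: uniq_perm => //.
    by rewrite map_inj_in_uniq // => y z _ _; apply: (@Xqm_inj 2).
  have sub : {subset map frobq2 s <= s}.
    move=> _ /mapP[z zs ->]; rewrite frobq2E ?s0 //.
    have : forbit FKq x (iter 2 FKq z).
      by move: zs => /trajectP[j _ ->]; exists (2 + j)%N; rewrite // iterD.
    by rewrite (forbitE d0 dx).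
  have us' : uniq (map frobq2 s).
    by rewrite map_inj_in_uniq // => y z _ _; apply: (@Xqm_inj 2).
  by have [|_ e] := uniq_min_size us' sub; rewrite ?size_map.
have cK2 i : P`_i \in inK2 io.
  by rewrite unfold_in -[X in _ == X](congr1 (fun p : {poly K} => p`_i) PF) coef_map.
pose f0 : {poly K2 io} := \poly_(i < size P) (MkK2 (cK2 i)).
have f0E : map_poly val f0 = P.
  apply/polyP => i; rewrite (coef_map valK2) /= coef_poly; case: ltnP => // Pi.
  by rewrite nth_default.
have f0P : `[< is_Phi f0 >].
  apply/asboolP; exists x => //.
  by rewrite f0E (forbitE d0 dx) -fsbig_seq.
exists (MkPhi f0P); rewrite /= f0E root_prod_XsubC.
by apply/trajectP; exists 0%N.
Qed.

Lemma Phi_at_root x : x != 0 -> root (map_poly val (Phi_poly (Phi_at io x))) x.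
Proof. by move=> x0; exact: (xgetPex _ (Phi_exists x0)). Qed.

Definition Phi1 : Phi io := MkPhi (Phi_one_subproof io).

Lemma Phi1E : Phi_poly Phi1 = 'X - 1%:P.
Proof. by rewrite polyC1. Qed.

Lemma root_Phi1 x : root (map_poly val (Phi_poly Phi1)) x = (x == 1).
Proof. by rewrite Phi1E (map_polyXsubC valK2) root_XsubC rmorph1. Qed.

Lemma Phi_at1 : Phi_at io 1 = Phi1.
Proof. by apply: (@Phi_root_eq _ _ 1); rewrite ?root_Phi1 ?Phi_at_root ?oner_neq0. Qed.

Lemma Phi_at_neq1 x : x != 0 -> x != 1 -> Phi_at io x != Phi1.
Proof.
move=> x0; apply: contraNneq => e.
by have := Phi_at_root x0; rewrite e root_Phi1.
Qed.

Lemma degPhi1 : degPhi Phi1 = 1%N.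
Proof. by rewrite /degPhi Phi1E size_XsubC. Qed.

Lemma degPhi_gt0 (f : Phi io) : (0 < degPhi f)%N.
Proof. by have [x [d [_ [d0 _] _ ->]]] := Phi_base f. Qed.

Lemma degPhi_at n x : (0 < n)%N -> Mgrp Fq n x -> (degPhi (Phi_at io x) <= n)%N.
Proof.
move=> n0 /Mgrp_iter[x0 nx].
have [_ [d0 dP] _] := Phi_root_orbit (Phi_at_root x0).
by apply: dvdn_leq => //; apply/dP.
Qed.

Lemma finite_Mgrp n : (0 < n)%N -> finite_set (@Mgrp Fq K n).
Proof.
move=> n0; have [g gp] := Mgrp_prim io n0.
apply: (@sub_finite_set _ _ [set` [seq g ^+ i | i <- iota 0 (cardM Fq n)]]); last exact: finite_seq.
move=> x /(MgrpX _ x n0) xn /=; have [i ->] := prim_rootP gp xn.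
by apply/mapP; exists (val i) => //; rewrite mem_iota ltn_ord.
Qed.

(** An orbit polynomial of degree d is [Phi_at x] for an x in [M_d]. *)
Lemma finite_Phi n : finite_set [set f : Phi io | (degPhi f <= n)%N].
Proof.
apply: (@sub_finite_set _ _ (\bigcup_(d in [set d | (0 < d <= n)%N]) (Phi_at io @` @Mgrp Fq K d))).
  move=> f /= fn; exists (degPhi f); first by rewrite /= degPhi_gt0.
  have [x [d [x0 dP fE fd]]] := Phi_base f.
  exists x; first by apply/Mgrp_iter; split=> //; rewrite fd; apply/(proj2 dP).
  apply: (@Phi_root_eq _ _ x); first exact: Phi_at_root.
  rewrite fE root_prod_XsubC; apply/trajectP; exists 0%N => //; exact: (proj1 dP).
apply: bigcup_finite; last by move=> d /andP[d0 _]; apply/finite_image/finite_Mgrp.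
apply: (@sub_finite_set _ _ [set` iota 0 n.+1]); last exact: finite_seq.
move=> d /andP[_ dn]; change (is_true (d \in iota 0 n.+1)).
by rewrite mem_iota.
Qed.

End PhiSide.

(** * The specialization *)

Section MonomialEval.
Variables (I : choiceType) (v : I -> algC).

(** The value of a monomial in infinitely many variables. *)
Definition cmeval (m : monalg.cmonom I) : algC := \prod_(i <- finsupp m) v i ^+ m i.

Lemma cmevalEw (m : monalg.cmonom I) (d : {fset I}) : (finsupp m `<=` d)%fset ->
  cmeval m = \prod_(i <- d) v i ^+ m i.
Proof.
move=> le; rewrite /cmeval (big_fset_incl _ le) // => i _.
by rewrite -monalg.cmE_neq0 negbK => /eqP ->; rewrite expr0.
Qed.

Fact cmeval_mmorphism : monalg.mmorphism cmeval.
Proof.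
split=> [m1 m2|]; last by rewrite /cmeval monalg.mdom1 big_seq_fset0.
pose d := (finsupp m1 `|` finsupp m2)%fset.
rewrite (@cmevalEw m1 d) ?fsubsetUl // (@cmevalEw m2 d) ?fsubsetUr //.
rewrite /cmeval monalg.mdomD -big_split; apply: eq_bigr => i _.
by rewrite monalg.cmM exprD.
Qed.
HB.instance Definition _ := monalg.isMultiplicative.Build _ _ cmeval cmeval_mmorphism.
End MonomialEval.

Section Evaluation.
Variables (Fq : finFieldType) (K : closedFieldType) (io : {rmorphism Fq -> K}).
Hypothesis Kalg : integralRange io.
Local Notation q := #|Fq|.

Definition tq : algC := (- q%:R)^-1.

Definition spec_var (p : Phi io * nat) : algC := if p.1 == Phi1 io then tq ^+ p.2 else 0.

(** The specialization that detects the degree: [X^(f)_i] goes to [t^i] for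
    [f = X - 1], and to 0 for all other f. *)
Definition spec : Xpoly io -> algC := @monalg.mmap _ _ _ idfun (cmeval spec_var).
HB.instance Definition _ := GRing.RMorphism.on spec.

Lemma specXconst c : spec (Xconst io c) = c.
Proof. by rewrite /spec /Xconst monalg.mmapU monalg.mmorph1 mulr1. Qed.

Lemma specXvar f i : spec (Xvar f i) = spec_var (f, i).
Proof.
rewrite /spec /Xvar monalg.mmapU mul1r /cmeval monalg.mdomU big_seq_fset1.
by rewrite monalg.cmUU expr1.
Qed.

Lemma specZ c x : spec (c *: x) = c * spec x.
Proof. by rewrite /spec monalg.mmapZ. Qed.

Lemma spec_sym_Phi h (f : Phi io) N :
  spec (sym_Phi h f N) = (h N).@[fun i : 'I_N => spec_var (f, val i)].
Proof.
rewrite /sym_Phi /mmap rmorph_sum mevalE; apply: eq_bigr => m _ /=.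
rewrite rmorphM /= specXconst /mmap1 rmorph_prod; congr (_ * _).
by apply: eq_bigr => i _; rewrite rmorphXn /= specXvar.
Qed.

Lemma spec_sym_Phi1 h N : spec (sym_Phi h (Phi1 io) N) = (h N).@[fun i : 'I_N => tq ^+ i].
Proof. by rewrite spec_sym_Phi; apply: meval_eq => i; rewrite /spec_var /= eqxx. Qed.

Lemma spec_sym_Phi0 h (f : Phi io) N : f != Phi1 io ->
  spec (sym_Phi h f N) = (h N).@[fun i : 'I_N => 0].
Proof. by move=> f1; rewrite spec_sym_Phi; apply: meval_eq => i; rewrite /spec_var /= (negPf f1). Qed.

Lemma q0C : (q%:R : algC) != 0.
Proof. by rewrite pnatr_eq0 -lt0n; exact: (ltn_trans _ (q_gt1 Fq)). Qed.

Lemma norm_tq : `|tq| = (q%:R)^-1.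
Proof. by rewrite normfV normrN normr_nat. Qed.

Lemma tq0 : tq != 0. Proof. by rewrite invr_eq0 oppr_eq0 q0C. Qed.

Lemma norm_tqX k : (0 < k)%N -> `|tq ^+ k| < 1.
Proof.
move=> k0; rewrite normrX norm_tq exprVn invf_lt1 ?exprn_gt0 ?ltr0n ?(ltn_trans _ (q_gt1 Fq)) //.
by rewrite exprn_egt1 ?ltr1n ?q_gt1 // -lt0n.
Qed.

Lemma tqX_neq1 d k : (0 < d)%N -> (tq ^+ d) ^+ k.+1 != 1.
Proof.
move=> d0; have : `|tq ^+ (d * k.+1)| < 1 by rewrite norm_tqX // muln_gt0 d0.
by rewrite exprM; apply: contraTneq => ->; rewrite normr1 ltxx.
Qed.

(** A factor for [f <> X - 1] vanishes since [mu f] is nonempty on the support of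
    [mu]. *)
Definition P_mpV (mu : multipart (Phi io)) : {poly algC} :=
  (- (q%:R : algC)) ^- mp_n (@degPhi Fq K io) mu *:
    \prod_(f <- finsupp mu) (if f == Phi1 io then HL_V tq (mu f) else 0).

Lemma spec_P_mp mu N : spec (P_mp mu N) = (P_mpV mu).[tq ^+ N].
Proof.
have -> : P_mp mu N = (- (q%:R : algC)) ^- mp_n (@degPhi Fq K io) mu *:
   \prod_(f <- finsupp mu) (sym_Phi (hall_littlewood ((- q%:R) ^- degPhi f) (mu f)) f N).
  rewrite /P_mp -[LHS]/(_ *: (_ N)); congr (_ *: _).
  by elim: (finsupp mu : seq _) => [|f r IH]; rewrite ?big_nil // !big_cons -IH.
rewrite specZ hornerZ rmorph_prod horner_prod; congr (_ * _).
rewrite big_seq [RHS]big_seq; apply: eq_bigr => f fmu /=.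
case: eqP => [->|/eqP f1].
  rewrite spec_sym_Phi1 degPhi1 expr1.
  have t1 k : tq ^+ k.+1 != 1 by have := @tqX_neq1 1 k isT; rewrite expr1.
  have := @HL_geo tq tq0 t1 N (mu (Phi1 io)) 1 (oner_neq0 _).
  rewrite expr1n mul1r => <-.
  by apply: meval_eq => i; rewrite mul1r.
rewrite spec_sym_Phi0 // hornerC HL_zero //.
- by rewrite -exprVn expf_neq0 // tq0.
- by move=> k; rewrite -exprVn tqX_neq1 // degPhi_gt0.
- by rewrite -mem_finsupp.
Qed.

End Evaluation.

(** * The degree as a coefficient of the specialized characteristic *)

(** The variable acts as 1 on the quotient by [X - 1]. *)
Lemma qX_sub1 (R : fieldType) (h : {poly R}) (w : {poly %/ h}) : h = 'X - 1 -> 'qX * w = w.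
Proof.
move=> hE; have hM : mk_monic h = h.
  by rewrite /mk_monic hE -polyC1 size_XsubC monicXsubC.
have -> : 'qX = 1 :> {poly %/ h}.
  rewrite /qpolyX; have -> : 'X = h + 1 by rewrite hE subrK.
  rewrite rmorphD rmorph1 /= (_ : in_qpoly h h = 0) ?add0r //.
  apply: val_inj; rewrite -[LHS]/(Pdiv.CommonRing.rmodp h (mk_monic h)) [X in Pdiv.CommonRing.rmodp _ X]hM.
  by rewrite Pdiv.RingMonic.rmodpp // hE -polyC1 monicXsubC.
by rewrite mul1r.
Qed.

Section ClassSide.
Variables (Fq : finFieldType) (K : closedFieldType) (io : {rmorphism Fq -> K}).
Hypothesis Kalg : integralRange io.
Local Notation q := #|Fq|.
Local Notation tq := (tq Fq).

(** The types for which all elementary divisors are [X - 1]. *)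
Definition ones_type (mu : multipart (Phi io)) :=
  [forall x : finsupp mu, (val x == Phi1 io) && all (pred1 1%N) (parts (mu (val x)))].

(** The class consists of elements acting as the identity. If it were empty the
    representative would be the unit by convention, so that nonemptiness does not
    have to be shown. *)
Lemma cclass_ones_type n (mu : multipart (Phi io)) : ones_type mu ->
  fingroup.repr (cclass n mu) = 1%g.
Proof.
move=> /forallP mu1; suff sub : cclass n mu \subset [set 1%g]%SET.
  have [e|/finset.set0Pn[x xc]] := eqVneq (cclass n mu) finset.set0; first by rewrite e repr_set0.
  by have h := fintype.subsetP sub _ (mem_repr _ xc); apply/eqP; rewrite finset.in_set1 in h.
apply/fintype.subsetP => g; rewrite !finset.inE => /asboolP[psi [psib _ psiX]].
have hs1 (j : 'I_(size (elem_divisors mu))) : (elem_divisors mu)`_j = 'X - 1.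
  have /allpairsPdep[f [k [fmu kp ->]]] : (elem_divisors mu)`_j \in elem_divisors mu by exact: mem_nth.
  have /andP[/eqP f1 /allP h] := mu1 [` fmu]%fset.
  by rewrite /= in f1 h; have /eqP -> := h _ kp; rewrite f1 expr1.
have gv (v : 'cV_n) : umx g *m v = v.
  have psi_inj := bij_inj psib; apply: psi_inj; apply: functional_extensionality_dep => j.
  by rewrite psiX qX_sub1.
apply/eqP; apply: val_inj; apply/matrixP => i j /=.
by have := gv (delta_mx j 0); rewrite -colE => /matrixP /(_ i 0); rewrite !mxE eqxx andbT.
Qed.

(** The degree of the polynomial in [V = t^N] is the length of [la]; it reaches
    [|la|] for [la = (1^n)] only. *)
Lemma size_HL_V (la : seq nat) : (size (HL_V tq la) <= (size la).+1)%N.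
Proof.
apply: leq_trans (size_scale_leq _ _) _.
elim: (size la) => [|l IH]; first by rewrite big_ord0 size_poly1.
rewrite big_ord_recr /=; apply: leq_trans (size_polyMleq _ _) _.
have : (size (1 - (tq ^+ l)^-1 *: 'X : {poly algC})%R <= 2)%N.
  apply: leq_trans (size_polyD _ _) _; rewrite size_poly1 size_polyN geq_max /=.
  by apply: leq_trans (size_scale_leq _ _) _; rewrite size_polyX.
by move: IH; set a := size _; set b := size _; lia.
Qed.

(** The coefficient of [V^n] in the specialization of [P_mu], for the type [mu] of
    the identity class ([coef_P_ones]). *)
Definition ones_coef n : algC := (-1) ^+ n * tq ^+ 'C(n, 2) / \prod_(1 <= i < n.+1) (1 - tq ^+ i).

Lemma tq1 k : tq ^+ k.+1 != 1.
Proof. by have := @tqX_neq1 Fq 1 k isT; rewrite expr1. Qed.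

Lemma HL_V_ones n : (0 < n)%N -> (HL_V tq (nseq n 1%N))`_n = ones_coef n * tq ^- 'C(n, 2).
Proof.
move=> n0; rewrite /HL_V coefZ size_nseq.
have -> : (\prod_(j < n) (1 - (tq ^+ j)^-1 *: 'X))`_n = \prod_(j < n) (- (tq ^+ j)^-1).
  have gen l : (\prod_(j < l) (1 - (tq ^+ j)^-1 *: 'X))`_l = \prod_(j < l) (- (tq ^+ j)^-1) :> algC.
    elim: l => [|l IH]; first by rewrite !big_ord0 coef1.
    rewrite !big_ord_recr /= mulrBr mulr1 coefB -scalerAr coefZ coefMX /= IH.
    rewrite [X in X - _]nth_default ?sub0r; last first.
      have := size_HL_V (nseq l 1%N); rewrite /HL_V size_nseq size_scale //.
      rewrite /HL_const mulf_neq0 ?invr_eq0 ?expf_neq0 ?tq0 //.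
      rewrite mulf_neq0 ?expf_neq0 ?(one_sub_neq0 tq1) //.
      by rewrite prodf_seq_neq0; apply/allP => a _; apply: (HL_v1_neq0 tq1).
    by rewrite mulrN mulrC.
  exact: gen.
have nE : npart (nseq n 1%N) = 'C(n, 2).
  rewrite /npart size_nseq -bin2_sum big_mkord; apply: eq_bigr => i _.
  by rewrite nth_nseq ltn_ord muln1.
rewrite /HL_const nE size_nseq /ones_coef.
have -> : undup (nseq n 1%N) = [:: 1%N].
  by case: (n) n0 => // k _; elim: k => //= k ->; rewrite inE eqxx.
rewrite big_seq1 count_nseq /= mul1n.
have -> : (1 - tq) ^+ n * HL_v1 tq n = \prod_(1 <= i < n.+1) (1 - tq ^+ i).
  rewrite /HL_v1 big_split /= prodr_const_nat subn1 /= mulrC -mulrA -exprMn mulVf ?expr1n ?mulr1 //.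
  exact: (one_sub_neq0 tq1).
have -> : \prod_(j < n) (- (tq ^+ j)^-1) = (-1) ^+ n * tq ^- 'C(n, 2).
  rewrite prodrN cardT size_enum_ord; congr (_ * _).
  by rewrite prodfV prodrXr -bin2_sum big_mkord.
by set P := \prod_(_ <= _ < _) _; ring.
Qed.

Lemma degPhi_fset n (f : Phi io) :
  (degPhi f <= n)%N -> f \in fset_set [set f : Phi io | (degPhi f <= n)%N].
Proof. by move=> fn; rewrite in_fset_set ?inE //; apply: finite_Phi. Qed.

Definition class_types n : set (multipart (Phi io)) :=
  [set mu | mp_norm (@degPhi Fq K io) mu = n].

Lemma finite_class_types n : finite_set (class_types n).
Proof. apply: finite_multipart (degPhi_gt0 Kalg) (@degPhi_fset n). Qed.

Definition chV n (chi : 'CF(U io n)) : {poly algC} :=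
  \sum_(mu <- fset_set (class_types n)) chi (fingroup.repr (cclass n mu)) *: P_mpV mu.

Lemma spec_ch n (chi : 'CF(U io n)) N : spec (ch chi N) = (chV chi).[tq ^+ N].
Proof.
have -> : ch chi N = \sum_(mu <- fset_set (class_types n))
    chi (fingroup.repr (cclass n mu)) *: P_mp mu N.
  rewrite /ch fsbig_finite; last exact: finite_class_types.
  by elim: (fset_set _ : seq _) => [|f r IH]; rewrite ?big_nil // !big_cons -IH.
rewrite rmorph_sum /chV horner_sum; apply: eq_bigr => mu _ /=.
by rewrite specZ hornerZ spec_P_mp.
Qed.

Lemma ones_type_shape n (mu : multipart (Phi io)) : class_types n mu ->
  (P_mpV mu)`_n != 0 -> {subset finsupp mu <= [fset Phi1 io]%fset} /\
     parts (mu (Phi1 io)) = nseq n 1%N.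
Proof.
move=> mun cn.
have sub : {subset finsupp mu <= [fset Phi1 io]%fset}.
  move=> f fmu; rewrite inE; apply: contraNT cn => f1.
  by rewrite coefZ (big_fsetD1 f) //= (negPf f1) mul0r coef0 mulr0.
split=> //.
have muE : sumn (mu (Phi1 io)) = n.
  rewrite -mun /mp_norm (@big_multipart _ _ _ _ mu [fset Phi1 io]%fset
     (fun x la => degPhi x * sumn (parts la))%N) //; last by move=> x; rewrite muln0.
  by rewrite big_seq_fset1 degPhi1 mul1n.
have szn : (n <= size (mu (Phi1 io)))%N.
  rewrite leqNgt; apply: contra cn => lt; rewrite coefZ nth_default ?mulr0 //.
  have -> : \prod_(f <- finsupp mu) (if f == Phi1 io then HL_V tq (mu f) else 0) =
      \prod_(f <- finsupp mu) HL_V tq (mu f).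
    by rewrite big_seq [RHS]big_seq; apply: eq_bigr => f /sub; rewrite inE => ->.
  rewrite (@big_multipart _ _ _ _ mu [fset Phi1 io]%fset (fun _ la => HL_V tq la)) //.
    by rewrite big_seq_fset1; apply: leq_trans (size_HL_V _) lt.
  move=> _; rewrite /HL_V /HL_const /npart /= !big_ord0 expr0 mul1r /=.
  by rewrite big_nil mulr1 invr1 scale1r.
move: muE szn; case: (mu (Phi1 io)) => s /= /andP[_ s0].
elim: s n s0 {mun cn} => [|a s IH] n /=; first by move=> _ <-.
rewrite inE negb_or eq_sym -lt0n => /andP[a0 s0] sn ns.
have ss : (size s <= sumn s)%N.
  elim: s s0 {IH sn ns} => //= b s IH; rewrite inE negb_or eq_sym -lt0n => /andP[b0 /IH h].
  by rewrite -add1n leq_add.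
have a1 : a = 1%N by lia.
by rewrite (IH n.-1 s0) ?a1 //; [have -> : n = n.-1.+1 by lia|lia|lia].
Qed.

Lemma ones_is_intpart n : is_intpart (nseq n 1%N).
Proof.
rewrite /is_intpart; apply/andP; split; last by rewrite mem_nseq andbF.
by case: n => // n /=; elim: n => //= n ->.
Qed.

Definition mp_ones n : multipart (Phi io) :=
  [fsfun x in [fset Phi1 io]%fset => IntPart (ones_is_intpart n)].

Lemma mp_ones1 n : mp_ones n (Phi1 io) = IntPart (ones_is_intpart n).
Proof. by rewrite fsfunE inE eqxx. Qed.

Lemma finsupp_ones n : (0 < n)%N -> finsupp (mp_ones n) = [fset Phi1 io]%fset.
Proof.
move=> n0; apply/fsetP => x; rewrite mem_finsupp fsfunE !inE.
case: (x =P Phi1 io) => _; last exact/eqP.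
by case: n n0 => // n _; apply/eqP => /(congr1 parts).
Qed.

Lemma mp_ones_norm n : (0 < n)%N -> class_types n (mp_ones n).
Proof.
move=> n0; rewrite /class_types /= /mp_norm finsupp_ones // big_seq_fset1 degPhi1 mul1n.
by rewrite mp_ones1 /= sumnE big_nseq iter_addn_0 mul1n.
Qed.

Lemma coef_P_ones n : (0 < n)%N -> (P_mpV (mp_ones n))`_n = ones_coef n.
Proof.
move=> n0; rewrite coefZ finsupp_ones // big_seq_fset1 eqxx mp_ones1 HL_V_ones //.
rewrite /mp_n finsupp_ones // big_seq_fset1 degPhi1 mul1n mp_ones1.
have -> : npart (IntPart (ones_is_intpart n)) = 'C(n, 2).
  rewrite /npart /= size_nseq -bin2_sum big_mkord; apply: eq_bigr => i _.
  by rewrite nth_nseq ltn_ord muln1.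
by rewrite -exprVn mulrCA mulfV ?mulr1 // expf_neq0 // tq0.
Qed.

(** The coefficient of [V^n] vanishes for every type other than that of the
    identity, either because of a factor at [f <> X - 1] or by [size_HL_V]. *)
Lemma coef_chV n (chi : 'CF(U io n)) : (0 < n)%N -> (chV chi)`_n = chi 1%g * ones_coef n.
Proof.
move=> n0; rewrite /chV coef_sum (big_fsetD1 (mp_ones n)) /=; last first.
  by rewrite in_fset_set ?inE; [apply: mp_ones_norm|apply: finite_class_types].
rewrite coefZ coef_P_ones // cclass_ones_type ?big_seq ?big1 ?addr0 //.
  move=> mu; rewrite !inE => /andP[mu1]; rewrite in_fset_set ?inE; last exact: finite_class_types.
  move=> mun; rewrite coefZ; apply/eqP; rewrite mulf_eq0; apply/orP; right.
  apply: contraNT mu1 => /(ones_type_shape mun)[sub mu1]; apply/eqP/fsfunP => x.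
  case: (boolP (x \in [fset Phi1 io]%fset)) => x1.
    by move: x1; rewrite inE => /eqP ->; rewrite mp_ones1; apply: val_inj.
  by rewrite !fsfun_dflt // ?finsupp_ones //; apply: contra x1; apply: sub.
apply/forallP => x.
have : val x \in [fset Phi1 io]%fset by rewrite -(finsupp_ones n0); apply: fsvalP.
rewrite inE => /eqP e.
by rewrite e eqxx /= mp_ones1 /= all_nseq orbT.
Qed.

End ClassSide.

(** * Orbits of characters *)

Local Open Scope quotient_scope.

Section ThetaSide.
Variables (Fq : finFieldType) (K : closedFieldType) (io : {rmorphism Fq -> K}).
Local Notation q := #|Fq|.
Local Notation Q := (- q%:Z).
Local Notation M := (@Mgrp Fq K).
Local Notation piK := (\pi_(Kdual Fq K)).

(** The norm from [M_m] to [M_r] is raising to this power,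
    [((-q)^m - 1) / ((-q)^r - 1)] ([norm_exp_geom]). *)
Definition norm_exp (m r : nat) : int := \sum_(j < m %/ r) Q ^+ (r * j).

Lemma norm_exp_geom m r : (r %| m)%N -> (Q ^+ r - 1) * norm_exp m r = Q ^+ m - 1.
Proof.
move=> rm; rewrite -{2}(divnK rm) mulnC exprM [RHS]subrX1; congr (_ * _).
by apply: eq_bigr => j _; rewrite exprM.
Qed.

Lemma Nmap_norm_exp m r (x : K) : x != 0 -> Nmap Fq m r x = x ^ norm_exp m r.
Proof.
move=> x0; rewrite /Nmap /norm_exp; elim/big_rec2: _ => [|j y z _ ->].
  by rewrite expr0z.
by rewrite expfzDr.
Qed.

Lemma QX_neq1 r : (0 < r)%N -> Q ^+ r - 1 != 0.
Proof.
move=> r0; rewrite subr_eq0; apply/eqP => /(congr1 (fun z : int => `|z|%N)).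
rewrite abszX abszN absz1 /= => /eqP.
by rewrite -(exp1n r) eqn_exp2r // gtn_eqF // q_gt1.
Qed.

Lemma exprz_surj (z : int) (y : K) : z != 0 -> y != 0 -> exists2 x : K, x != 0 & x ^ z = y.
Proof.
have nat_surj k (u : K) : (0 < k)%N -> u != 0 -> exists2 x : K, x != 0 & x ^+ k = u.
  move=> k0 u0; have /closed_rootP[x] : size ('X^k - u%:P : {poly K}) != 1%N.
    by rewrite size_XnsubC // eqSS -lt0n.
  rewrite /root !hornerE subr_eq0 => /eqP xk; exists x => //.
  by apply: contra_eq_neq xk => ->; rewrite expr0n eqn0Ngt k0 eq_sym.
case: z => k z0 y0.
  by have [|//|x x0 xk] := @nat_surj k y; rewrite ?lt0n //; exists x.
have [//||x x0 xk] := @nat_surj k.+1 y^-1; rewrite ?invr_eq0 //; exists x => //.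
by rewrite NegzE -exprnN xk invrK.
Qed.

Lemma Mgrp1 m : M m 1. Proof. by split; rewrite /= ?oner_neq0 ?exp1rz. Qed.

Lemma Mgrp_neq0 m x : M m x -> x != 0. Proof. by case. Qed.

Lemma MgrpM m x y : M m x -> M m y -> M m (x * y).
Proof. by move=> [x0 xm] [y0 ym]; split; rewrite /= ?mulf_neq0 // expfzMl xm ym mulr1. Qed.

Lemma MgrpXz m x (z : int) : M m x -> M m (x ^ z).
Proof.
by move=> [x0 xm]; split; rewrite /= ?expfz_neq0 // exprz_exp mulrC -exprz_exp xm exp1rz.
Qed.

Lemma MgrpV m x : M m x -> M m x^-1.
Proof. by move=> xm; rewrite -exprN1; apply: MgrpXz. Qed.

(** Extract a root of exponent [norm_exp m r] in the algebraically closed field;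
    it lies in [M_m] because [norm_exp m r * ((-q)^r - 1) = (-q)^m - 1]. *)
Lemma Nmap_surj m r y : (0 < r)%N -> (0 < m)%N -> (r %| m)%N -> M r y ->
  exists2 x, M m x & Nmap Fq m r x = y.
Proof.
move=> r0 m0 rm /MgrpE[y0 yr].
have S0 : norm_exp m r != 0.
  by apply: contraTneq (QX_neq1 m0) => e; rewrite -(norm_exp_geom rm) e mulr0 eqxx.
have [x x0 xS] := exprz_surj S0 y0; exists x; last by rewrite Nmap_norm_exp.
by apply/MgrpE; split=> //; rewrite -(norm_exp_geom rm) mulrC -exprz_exp xS.
Qed.

Lemma NmapM m r (x y : K) : x != 0 -> y != 0 -> Nmap Fq m r (x * y) = Nmap Fq m r x * Nmap Fq m r y.
Proof. by move=> x0 y0; rewrite !Nmap_norm_exp ?mulf_neq0 // expfzMl. Qed.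

Section OneChar.
Variables (m : nat) (xi : K -> algC).
Hypothesis xiP : is_Mchar Fq m xi.

Lemma Mchar1 : xi 1 = 1.
Proof.
have [xiM xi0 _] := xiP; have := xiM 1 1 (Mgrp1 m) (Mgrp1 m); rewrite mulr1.
by move/eqP; rewrite -{1}[xi 1]mulr1 (inj_eq (mulfI (xi0 _ (Mgrp1 m)))) => /eqP.
Qed.

Lemma McharV x : M m x -> xi x^-1 = (xi x)^-1.
Proof.
move=> xm; have [xiM xi0 _] := xiP; apply: (mulfI (xi0 _ xm)).
rewrite -xiM //; last exact: MgrpV.
by rewrite mulfV ?(Mgrp_neq0 xm) // Mchar1 mulfV // xi0.
Qed.

Lemma McharX x z : M m x -> xi (x ^ z) = xi x ^ z.
Proof.
move=> xm; have [xiM xi0 _] := xiP.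
have nat_case k : xi (x ^+ k) = xi x ^+ k.
  elim: k => [|k IH]; first by rewrite !expr0 Mchar1.
  by rewrite !exprS xiM ?IH //; apply: (@MgrpXz _ _ k).
case: z => k; first exact: nat_case.
by rewrite NegzE -!exprnN McharV ?nat_case //; apply: (@MgrpXz _ _ k.+1).
Qed.
End OneChar.

Lemma Mchar_is (a : Mchar Fq K) : is_Mchar Fq a.1 a.2.
Proof. by have /asboolP[] := MkMcharP a. Qed.

Lemma Mchar_gt0 (a : Mchar Fq K) : (0 < a.1)%N.
Proof. by have /asboolP[] := MkMcharP a. Qed.

Lemma Mchar_eq (a b : Mchar Fq K) : a.1 = b.1 -> (forall x, M a.1 x -> a.2 x = b.2 x) -> a = b.
Proof.
move=> ab h; apply: val_inj.
have [_ _ a0] := Mchar_is a; have [_ _ b0] := Mchar_is b.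
case: a ab h a0 => -[m xi] /= ap ab h a0; case: b ab h b0 => -[n eta] /= bp ab h b0.
subst n; congr pair; apply: funext => x; have [/h //|xm] := pselect (M m x).
by rewrite a0 // b0.
Qed.

(** Norms are surjective, so no two characters of [M_m] become equal in the limit. *)
Lemma piK_inj (a b : Mchar Fq K) : a.1 = b.1 -> piK a = piK b -> a = b.
Proof.
move=> ab /eqmodP /asboolP[k [k0 ak bk h]]; apply: Mchar_eq => // x xm.
have [y yk <-] := Nmap_surj (Mchar_gt0 a) k0 ak xm.
by rewrite h // ab.
Qed.

Lemma iter_Mchar_F (a : Mchar Fq K) j :
  (iter j (@Mchar_F Fq K) a).1 = a.1 /\
  forall x, M a.1 x -> (iter j (@Mchar_F Fq K) a).2 x = a.2 x ^ (Q ^+ j).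
Proof.
elim: j => [|j [IH1 IH2]]; first by split=> // x _; rewrite expr0 expr1z.
split=> [|x xm] //=; rewrite ?IH1 // /Mchar_F_pair /= IH2 //.
by rewrite exprnN exprz_exp exprSr.
Qed.

Lemma iter_Kdual_F (a : Mchar Fq K) j :
  iter j (@Kdual_F Fq K) (piK a) = piK (iter j (@Mchar_F Fq K) a).
Proof. by elim: j => //= j ->; rewrite Kdual_F_pi. Qed.

Lemma Mchar_val_fixed (a : Mchar Fq K) x : M a.1 x -> a.2 x ^ (Q ^+ a.1 - 1) = 1.
Proof.
move=> xm; rewrite -(McharX (Mchar_is a)) //.
have /MgrpE[_ ->] := xm; exact: Mchar1 (Mchar_is a).
Qed.

Lemma Mchar_fixed (a : Mchar Fq K) : iter a.1 (@Kdual_F Fq K) (piK a) = piK a.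
Proof.
rewrite iter_Kdual_F; congr (piK _); have [h1 h2] := iter_Mchar_F a a.1.
apply: Mchar_eq => //; rewrite h1 => x xm; rewrite h2 //.
have [_ a0 _] := Mchar_is a.
by rewrite -[Q ^+ _](subrK 1) expfzDr ?a0 // Mchar_val_fixed // mul1r expr1z.
Qed.

Lemma lift_Mchar (b : Mchar Fq K) n : (0 < n)%N -> (b.1 %| n)%N ->
  exists c : Mchar Fq K, c.1 = n /\ piK c = piK b.
Proof.
move=> n0 bn; have [bM b0 _] := Mchar_is b.
(* inflation along the norm *)
pose eta x := if `[< M n x >] then b.2 (Nmap Fq n b.1 x) else 0.
have etaE x : M n x -> eta x = b.2 (Nmap Fq n b.1 x) by rewrite /eta => /asboolP ->.
have etaP : `[< (0 < n)%N /\ is_Mchar Fq n eta >].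
  apply/asboolP; split=> //; split=> [x y xn yn|x xn|x xn].
  - rewrite !etaE //; last exact: MgrpM.
    by rewrite NmapM ?(Mgrp_neq0 xn) ?(Mgrp_neq0 yn) // bM //; apply: Nmap_Mgrp.
  - by rewrite etaE // b0 //; apply: Nmap_Mgrp.
  - by rewrite /eta; case: asboolP.
exists (@MkMchar Fq K (n, eta) etaP); split=> //.
by apply/eqmodP/asboolP; exists n; split=> //= x xn; rewrite Nmap_id // etaE.
Qed.

(** If [F^k] fixes the class of a character c of [M_n], with k dividing n, then c is
    trivial on the elements [z^((-q)^k - 1)] with z in [M_n]. These form the kernel
    of the norm to [M_k], by an analogue of Hilbert 90, so c factors through the
    norm. *)
Lemma fixed_descends (xi : Kdual Fq K) k : (0 < k)%N -> iter k (@Kdual_F Fq K) xi = xi ->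
  exists a : Mchar Fq K, a.1 = k /\ piK a = xi.
Proof.
move=> k0 xik.
have [c [cn cxi kn]] : exists c : Mchar Fq K, [/\ (k %| c.1)%N, piK c = xi & (0 < c.1)%N].
  have [|//|c [cn cb]] := @lift_Mchar (repr xi) ((repr xi).1 * k).
  - by rewrite muln_gt0 k0 Mchar_gt0.
  - exact: dvdn_mulr.
  exists c; rewrite cn cb reprK dvdn_mull // muln_gt0 k0 Mchar_gt0; by [].
have [cM c0 _] := Mchar_is c; set n := c.1 in cn kn cM c0.
(* the hypothesis on xi, transported to the character c of [M_n] *)
have cfix x : M n x -> c.2 x ^ (Q ^+ k - 1) = 1.
  move=> xn; have e : iter k (@Mchar_F Fq K) c = c.
    have [h1 _] := iter_Mchar_F c k.
    by apply: piK_inj => //; rewrite -iter_Kdual_F cxi.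
  have [_ /(_ x xn)] := iter_Mchar_F c k; rewrite e => h.
  by rewrite expfzDr ?c0 // -h exprN1 mulfV // c0.
have trivker x : M n x -> Nmap Fq n k x = 1 -> c.2 x = 1.
  move=> xn; rewrite Nmap_norm_exp ?(Mgrp_neq0 xn) // => xS.
  have [z z0 zx] := exprz_surj (QX_neq1 k0) (Mgrp_neq0 xn).
  have zn : M n z by apply/MgrpE; split=> //; rewrite -(norm_exp_geom cn) -exprz_exp zx.
  by rewrite -zx (McharX (Mchar_is c)) // cfix.
(* a section of the norm; the choice does not matter by [pre_eq] *)
pose pre y := xget 1 [set x | M n x /\ Nmap Fq n k x = y].
have preP y : M k y -> M n (pre y) /\ Nmap Fq n k (pre y) = y.
  move=> yk; have [x xn xy] := Nmap_surj k0 kn cn yk.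
  by apply: (@xgetPex _ 1 [set x | M n x /\ Nmap Fq n k x = y]); exists x.
have pre_eq x : M n x -> c.2 (pre (Nmap Fq n k x)) = c.2 x.
  move=> xn; have [pn pe] := preP _ (Nmap_Mgrp cn xn).
  have xV := MgrpV xn.
  have : c.2 (pre (Nmap Fq n k x) * x^-1) = 1.
    apply: trivker; first exact: MgrpM.
    rewrite NmapM ?(Mgrp_neq0 pn) ?(Mgrp_neq0 xV) // pe !Nmap_norm_exp ?(Mgrp_neq0 xn) ?(Mgrp_neq0 xV) //.
    by rewrite -[x^-1]exprN1 exprz_exp mulN1r -expfzDr ?(Mgrp_neq0 xn) // subrr.
  rewrite cM // (McharV (Mchar_is c)) // => /(canRL (mulfVK (c0 _ xn))).
  by rewrite mul1r.
pose eta y := if `[< M k y >] then c.2 (pre y) else 0.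
have etaE y : M k y -> eta y = c.2 (pre y) by rewrite /eta => /asboolP ->.
have etaP : `[< (0 < k)%N /\ is_Mchar Fq k eta >].
  apply/asboolP; split=> //; split=> [y z yk zk|y yk|y yk].
  - rewrite !etaE //; last exact: MgrpM.
    have [yn ye] := preP y yk; have [zn ze] := preP z zk.
    rewrite -cM // -[RHS]pre_eq; last exact: MgrpM.
    by rewrite NmapM ?(Mgrp_neq0 yn) ?(Mgrp_neq0 zn) // ye ze.
  - by rewrite etaE // c0 //; have [] := preP y yk.
  - by rewrite /eta; case: asboolP.
exists (@MkMchar Fq K (k, eta) etaP); split=> //; rewrite -cxi.
apply/eqmodP/asboolP; exists n; split=> //= x xn.
by rewrite Nmap_id // etaE ?pre_eq //; apply: Nmap_Mgrp.
Qed.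

(** The elements of [K^*] fixed by [F^k] are the characters of the cyclic group
    [M_k]: one for each root of unity of order dividing [q^k - (-1)^k], namely the
    value at a generator. *)
Lemma fixed_seq k : (0 < k)%N -> exists L : seq (Kdual Fq K),
  [/\ uniq L, size L = cardM Fq k & forall xi, (xi \in L) = (iter k (@Kdual_F Fq K) xi == xi)].
Proof.
move=> k0; set n := cardM Fq k; have n0 : (0 < n)%N := cardM_gt0 Fq k0.
have [g gp] := Mgrp_prim io k0; have [z zp] := C_prim_root_exists n0.
have gM : M k g by apply/MgrpX => //; exact: prim_expr_order.
have gMX i : M k (g ^+ i) by apply: (@MgrpXz _ _ i).
(* the discrete logarithm on [M_k] with respect to g *)
pose dl (x : K) : nat := if [pick i : 'I_n | x == g ^+ i] is Some i then i else 0%N.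
have dlP x : M k x -> g ^+ dl x = x.
  move=> /(MgrpX _ x k0) xn; have [i xi] := prim_rootP gp xn.
  by rewrite /dl; case: pickP => [j /eqP -> //|/(_ i)]; rewrite xi eqxx.
have zdl j x y : M k x -> M k y -> z ^+ (j * dl (x * y)) = z ^+ (j * dl x) * z ^+ (j * dl y).
  move=> xk yk; rewrite -exprD -mulnDr ![(j * _)%N]mulnC !exprM; congr (_ ^+ j).
  apply/eqP; rewrite (eq_prim_root_expr zp) -(eq_prim_root_expr gp) exprD !dlP //.
  exact: MgrpM.
pose eta j x := if `[< M k x >] then z ^+ (j * dl x) else 0.
have etaE j x : M k x -> eta j x = z ^+ (j * dl x) by rewrite /eta => /asboolP ->.
have z0 : z != 0 by apply: contra_eq_neq (prim_expr_order zp) => ->; rewrite expr0n eqn0Ngt n0 eq_sym oner_eq0.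
have etaP j : `[< (0 < k)%N /\ is_Mchar Fq k (eta j) >].
  apply/asboolP; split=> //; split=> [x y xn yn|x xn|x xn].
  - by rewrite !etaE ?zdl //; apply: MgrpM.
  - by rewrite etaE // expf_neq0.
  - by rewrite /eta; case: asboolP.
pose ch j := @MkMchar Fq K (k, eta j) (etaP j).
have chg j : (ch j).2 g = z ^+ j.
  rewrite /= etaE // mulnC exprM; congr (_ ^+ j).
  apply/eqP; rewrite -[X in _ == X]expr1 (eq_prim_root_expr zp) -(eq_prim_root_expr gp).
  by rewrite dlP // expr1.
exists [seq piK (ch j) | j <- iota 0 n]; split.
- rewrite map_inj_in_uniq ?iota_uniq // => i j; rewrite !mem_iota /= => i_n j_n e.
  have /(congr1 (fun a : Mchar Fq K => a.2 g)) := piK_inj (erefl : (ch i).1 = (ch j).1) e.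
  by rewrite !chg => /eqP; rewrite (eq_prim_root_expr zp) !modn_small // => /eqP.
- by rewrite size_map size_iota.
move=> xi; apply/mapP/eqP => [[j _ ->]|fx]; first exact: (Mchar_fixed (ch j)).
have [a [ak <-]] := fixed_descends k0 fx.
have aP := Mchar_is a; have [aM a0 _] := aP; rewrite ak in aP aM a0.
have : a.2 g ^+ n = 1.
  rewrite -[LHS]/(a.2 g ^ n) -(McharX aP) //= (_ : g ^ n = 1) ?(Mchar1 aP) //.
  exact: prim_expr_order.
move=> /(prim_rootP zp)[j aj]; exists (val j); first by rewrite mem_iota ltn_ord.
congr (piK _); apply: Mchar_eq => //; rewrite ak => x xk.
rewrite /= etaE // -{1}(dlP x xk) -[g ^+ _]/(g ^ (dl x)) (McharX aP) //= aj.
by rewrite exprM.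
Qed.

Lemma Kdual_periodic (xi : Kdual Fq K) : exists d, minimal_period (@Kdual_F Fq K) xi d.
Proof.
apply: (@minimal_periodP _ _ _ (repr xi).1); first exact: Mchar_gt0.
by rewrite -{2 3}[xi]reprK Mchar_fixed.
Qed.

Lemma Theta_elem_in (phi : Theta Fq K) : Theta_set phi (Theta_elem phi).
Proof. by rewrite /Theta_elem; case: cid. Qed.

(** All points of an orbit generate it and have its size as period. *)
Lemma Theta_orbit (phi : Theta Fq K) xi : Theta_set phi xi ->
  Theta_set phi = forbit (@Kdual_F Fq K) xi /\
  minimal_period (@Kdual_F Fq K) xi (sizeTheta phi).
Proof.
have /asboolP[eta phiE] := ThetaP phi; have [d dP] := Kdual_periodic eta.
have [d0 deta] := dP; have ed : iter d (@Kdual_F Fq K) eta = eta by apply/deta.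
rewrite phiE => xi_in; have fE := forbit_eq d0 ed xi_in; split; first by rewrite fE.
have [e eP] := Kdual_periodic xi.
by rewrite /sizeTheta phiE -fE (forbit_size eP).
Qed.

Lemma sizeTheta_gt0 (phi : Theta Fq K) : (0 < sizeTheta phi)%N.
Proof. by have [_ []] := Theta_orbit (Theta_elem_in phi). Qed.

Lemma Theta_eq (phi psi : Theta Fq K) xi : Theta_set phi xi -> Theta_set psi xi -> phi = psi.
Proof.
by move=> /Theta_orbit[h1 _] /Theta_orbit[h2 _]; apply: val_inj; rewrite /= h1 h2.
Qed.

Fact orbit_is_Theta (xi : Kdual Fq K) : `[< is_Theta (forbit (@Kdual_F Fq K) xi) >].
Proof. by apply/asboolP; exists xi. Qed.

Definition orbitT (xi : Kdual Fq K) : Theta Fq K := MkTheta (orbit_is_Theta xi).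

Lemma orbitT_in xi : Theta_set (orbitT xi) xi. Proof. by exists 0%N. Qed.

Lemma finite_Theta n : finite_set [set phi : Theta Fq K | (sizeTheta phi <= n)%N].
Proof.
apply: (@sub_finite_set _ _ (\bigcup_(d in [set d | (0 < d <= n)%N])
   (orbitT @` [set xi | iter d (@Kdual_F Fq K) xi = xi]))).
  move=> phi /= phin; have pin := Theta_elem_in phi; have [_ [d0 dP]] := Theta_orbit pin.
  exists (sizeTheta phi); first by rewrite /= d0.
  exists (Theta_elem phi); first by apply/dP.
  exact: (Theta_eq (orbitT_in _) pin).
apply: bigcup_finite => [|d /andP[d0 _]].
  apply: (@sub_finite_set _ _ [set` iota 0 n.+1]); last exact: finite_seq.
  move=> d /andP[_ dn]; change (is_true (d \in iota 0 n.+1)).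
  by rewrite mem_iota.
apply: finite_image; have [L [_ _ LP]] := fixed_seq d0.
apply: (@sub_finite_set _ _ [set` L]); last exact: finite_seq.
by move=> xi /= xid; rewrite LP; apply/eqP.
Qed.

(** The fixed points of [F^k] are partitioned into the orbits whose size divides k. *)
Lemma sum_sizeTheta (T : {fset Theta Fq K}) k : (0 < k)%N ->
  (forall phi, (sizeTheta phi <= k)%N -> phi \in T) ->
  (\sum_(phi <- T | sizeTheta phi %| k) sizeTheta phi)%N = cardM Fq k.
Proof.
move=> k0 kT; have [L [uL sL LP]] := fixed_seq k0.
(* count the pairs of an orbit and a fixed point in it *)
transitivity (\sum_(phi <- T | sizeTheta phi %| k) \sum_(xi <- L) `[< Theta_set phi xi >])%N.
  apply: eq_bigr => phi phik.
  have [fE dP] := Theta_orbit (Theta_elem_in phi); set d := sizeTheta phi in dP phik *.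
  have dE := proj2 (proj2 dP d) (dvdnn d).
  have {1}<- : size (traject (@Kdual_F Fq K) (Theta_elem phi) d) = d by rewrite size_traject.
  have -> : (\sum_(xi <- L) `[< Theta_set phi xi >])%N = count (fun xi => `[< Theta_set phi xi >]) L.
    rewrite -sum1_count [RHS]big_mkcond; apply: eq_bigr => xi _; by case: asboolP.
  rewrite -size_filter; apply: perm_size; apply: uniq_perm.
  - exact: traject_uniq.
  - exact: filter_uniq.
  move=> xi; rewrite mem_filter LP.
  have -> : `[< Theta_set phi xi >] = (xi \in traject (@Kdual_F Fq K) (Theta_elem phi) d).
    by rewrite fE (forbitE (proj1 dP) dE); apply/asboolP/idP.
  case: (boolP (xi \in _)) => //= xt; apply/esym/eqP.
  have xphi : Theta_set phi xi by rewrite fE (forbitE (proj1 dP) dE).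
  by have [_ [_ h]] := Theta_orbit xphi; apply/h.
rewrite exchange_big /= -sL -sum1_size big_seq [RHS]big_seq; apply: eq_bigr => xi.
rewrite LP => /eqP xik.
have xo := orbitT_in xi; have [_ [d0 dP]] := Theta_orbit xo.
have dk : (sizeTheta (orbitT xi) %| k)%N by apply/dP.
have oT : orbitT xi \in T by apply: kT; apply: dvdn_leq.
rewrite big_mkcond (big_fsetD1 (orbitT xi)) //= dk.
have -> : `[< Theta_set (orbitT xi) xi >] = true by apply/asboolP.
rewrite big_seq big1 // => phi; rewrite in_fsetD1 => /andP[ne _].
case: ifP => // _; have -> : `[< Theta_set phi xi >] = false; last by [].
by apply/asboolP => h; move/eqP: ne; apply; apply: Theta_eq h xo.
Qed.

End ThetaSide.

(** * Specialization of the Schur functions of orbits *)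

Lemma coef_top_prod (I : Type) (r : seq I) (p : I -> {poly algC}) (a : I -> nat) :
  (forall i, (size (p i) <= (a i).+1)%N) ->
  (size (\prod_(i <- r) p i)%R <= (\sum_(i <- r) a i).+1)%N /\
  (\prod_(i <- r) p i)`_(\sum_(i <- r) a i) = \prod_(i <- r) (p i)`_(a i).
Proof.
move=> pa; elim: r => [|i r [IH1 IH2]]; first by rewrite !big_nil size_poly1 coef1.
rewrite !big_cons; set P := \prod_(j <- r) p j in IH1 IH2 *; set A := (\sum_(j <- r) a j)%N in IH1 IH2 *.
have pai := pa i; split.
  apply: leq_trans (size_polyMleq _ _) _; lia.
rewrite coefM -IH2.
have lt : (a i < (a i + A).+1)%N by rewrite ltnS leq_addr.
rewrite (bigD1 (Ordinal lt)) //= addKn big1 ?addr0 // => j ja.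
have [ji|ij] := ltnP j (a i).
  rewrite [P`__]nth_default ?mulr0 //; apply: leq_trans IH1 _.
  by rewrite ltn_subRL ltn_add2r.
rewrite nth_default ?mul0r //; apply: leq_trans pai _.
by rewrite ltn_neqAle ij andbT eq_sym; exact: ja.
Qed.

Section SchurW.
Variables (s : algC) (c : algC) (d : nat).
Hypothesis d0 : (0 < d)%N.
(** For [c = (-1)^d] and [s = t^d], the specialization of [s_la(phi)] with
    [|phi| = d], as a polynomial in [V = t^N] ([subst_schur]). *)
Definition schurW (la : seq nat) : {poly algC} :=
  (c ^+ sumn la * schur_const s la) *:
    \prod_(i < size la) \prod_(k < nth 0%N la i) ('X^d - (s ^+ k / s ^+ i)%:P).

Lemma schurW_top (la : intpart) : (size (schurW la) <= (d * sumn la).+1)%N /\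
   (schurW la)`_(d * sumn la) = c ^+ sumn la * schur_const s la.
Proof.
have bin u : (size ('X^d - u%:P : {poly algC})%R <= d.+1)%N.
  by apply: leq_trans (size_polyD _ _) _; rewrite size_polyXn size_polyN geq_max leqnn (leq_trans (size_polyC_leq1 _)).
have inner i := coef_top_prod (index_enum 'I_(nth 0%N la i)) (fun k => bin (s ^+ k / s ^+ i)).
have [h1 h2] := coef_top_prod (index_enum 'I_(size la)) (fun i => proj1 (inner i)).
have e : (\sum_(i < size la) \sum_(k < nth 0%N la i) d = d * sumn la)%N.
  rewrite (@sumn_ord la (size la)) // big_distrr /=; apply: eq_bigr => i _.
  by rewrite sum_nat_const card_ord mulnC.
rewrite e in h1 h2; split; first exact: leq_trans (size_scale_leq _ _) h1.
rewrite coefZ h2 big1 ?mulr1 // => i _; have [_ ->] := inner i.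
by rewrite big1 // => k _; rewrite coefB coefXn eqxx coefC eqn0Ngt d0 subr0.
Qed.
End SchurW.

Section ThetaEval.
Variables (Fq : finFieldType) (K : closedFieldType) (io : {rmorphism Fq -> K}).
Hypothesis Kalg : integralRange io.
Local Notation q := #|Fq|.
Local Notation t := (tq Fq).

(** Truncation to N variables followed by the specialization. *)
Definition specL N (y : Lambda io) : algC := spec (y N).

Fact specL_zmod N : zmod_morphism (specL N).
Proof. by move=> x y; rewrite /specL -[(x - y) N]/(x N - y N) rmorphB. Qed.
Fact specL_monoid N : monoid_morphism (specL N).
Proof.
split=> [|x y]; rewrite /specL; first by rewrite -[(1 : Lambda io) N]/(1 : Xpoly io) rmorph1.
by rewrite -[(x * y) N]/(x N * y N) rmorphM.
Qed.
HB.instance Definition _ N := GRing.isZmodMorphism.Build (Lambda io) algC (specL N) (specL_zmod N).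
HB.instance Definition _ N := GRing.isMonoidMorphism.Build (Lambda io) algC (specL N) (specL_monoid N).

Lemma specLZ N c (y : Lambda io) : specL N (c *: y) = c * specL N y.
Proof. exact: specZ. Qed.

(** The orbit size divides n, so that every point of the orbit comes from a character
    of [M_n], and characters take the value 1 at 1. *)
Lemma Kdual_at1 n (phi : Theta Fq K) : (0 < n)%N -> (sizeTheta phi %| n)%N ->
  Kdual_at n (Theta_elem phi) 1 = 1.
Proof.
move=> n0 dn; have [_ [_ dP]] := Theta_orbit (Theta_elem_in phi).
have [a [an api]] := fixed_descends n0 (proj2 (dP n) dn).
have [b [bE _]] : exists b : Mchar Fq K,
    Mchar_pair b = (n, Kdual_at n (Theta_elem phi)) /\ \pi_(Kdual Fq K)%qT b = Theta_elem phi.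
  apply: (xgetPex (fun=> 0) (P := fun eta : K -> algC => exists a : Mchar Fq K,
    Mchar_pair a = (n, eta) /\ \pi_(Kdual Fq K)%qT a = Theta_elem phi)).
  by exists a.2, a; rewrite -an; case: (Mchar_pair a).
have bP := Mchar_is b; rewrite bE /= in bP.
exact: (Mchar1 bP).
Qed.

(** The specialization of [p_k(phi)], for [n = k |phi|], as a polynomial in
    [V = t^N]. *)
Definition psumV (n : nat) : {poly algC} := ((-1) ^+ n.-1 / (1 - t ^+ n)) *: (1 - 'X^n).

Lemma psum_meval k N (x : 'I_N -> algC) : (psum k N).@[x] = \sum_i x i ^+ k.
Proof. by rewrite /psum rmorph_sum; apply: eq_bigr => i _; rewrite /= rmorphXn /= mevalXU. Qed.

(** Only x = 1 contributes, since [f_x = X - 1] for no other x; there the character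
    is 1 and the power sum of [1, t, ..., t^(N-1)] is a geometric sum. *)
Lemma specL_psum_Theta k (phi : Theta Fq K) N : (0 < k)%N ->
  specL N (psum_Theta io k phi) = (psumV (k * sizeTheta phi)).[t ^+ N].
Proof.
move=> k0; set n := (k * sizeTheta phi)%N.
have n0 : (0 < n)%N by rewrite muln_gt0 k0 sizeTheta_gt0.
have dn : (sizeTheta phi %| n)%N by apply: dvdn_mull.
rewrite /psum_Theta -/n specLZ fsbig_finite; last exact: (finite_Mgrp io).
rewrite rmorph_sum.
transitivity ((-1) ^+ n.-1 * \sum_(x <- fset_set (@Mgrp Fq K n))
   Kdual_at n (Theta_elem phi) x * spec (sym_Phi (psum (n %/ degPhi (Phi_at io x))) (Phi_at io x) N)).
  congr (_ * _); apply: eq_bigr => x _; exact: specZ.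
rewrite (big_fsetD1 1) /=; last first.
  by rewrite in_fset_set ?inE; [exact: Mgrp1|exact: (finite_Mgrp io)].
rewrite (Kdual_at1 n0 dn) mul1r.
rewrite (Phi_at1 Kalg) degPhi1 divn1.
rewrite big_seq big1 ?addr0 => [|x]; last first.
  rewrite in_fsetD1 => /andP[x1]; rewrite in_fset_set ?inE; last exact: (finite_Mgrp io).
  move=> xn; have x0 := Mgrp_neq0 xn; rewrite spec_sym_Phi0; last exact: (Phi_at_neq1 Kalg).
  rewrite psum_meval big1 ?mulr0 // => i _.
  rewrite expr0n gtn_eqF // divn_gt0 ?(degPhi_gt0 Kalg) //.
  exact: (degPhi_at Kalg).
rewrite spec_sym_Phi1 psum_meval (geo_sum (@tq1 Fq)) // /psumV !hornerE -mulrA.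
by rewrite mulrA mulrAC ?mulrA.
Qed.

Lemma subst_psumV D (Qh : {mpoly algC[D]}) (phi : Theta Fq K) N :
  specL N (mmap (fun c => (fun=> Xconst io c) : Lambda io)
          (fun i : 'I_D => psum_Theta io i.+1 phi) Qh) =
  (mmap (@polyC algC) (fun i : 'I_D => psumV (i.+1 * sizeTheta phi)) Qh).[t ^+ N].
Proof.
rewrite /mmap rmorph_sum horner_sum; apply: eq_bigr => m _ /=.
rewrite rmorphM hornerM hornerC /=; congr (_ * _); first exact: specXconst.
rewrite /mmap1 rmorph_prod horner_prod; apply: eq_bigr => i _.
by rewrite rmorphXn /= specL_psum_Theta // horner_exp.
Qed.

Definition thetaW (phi : Theta Fq K) (la : seq nat) : {poly algC} :=
  let d := sizeTheta phi in schurW (t ^+ d) ((-1) ^+ d) d la.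

(** At [V = t^(-M)] the values of all [p_k(phi)] are the power sums of the same M
    numbers, in geometric progression of ratio [t^d]. *)
Lemma psumV_inv d k M : (0 < d)%N -> (0 < k)%N ->
  (psumV (k * d)).[(t ^+ M)^-1] =
  \sum_(i < M) ((-1) ^+ d / (t ^+ d) ^+ M * (t ^+ d) ^+ i) ^+ k.
Proof.
move=> d0 k0; have t0 : t != 0 := tq0 Fq.
under [RHS]eq_bigr => i _ do rewrite exprMn.
rewrite -mulr_sumr (geo_sum (fun k => tqX_neq1 Fq k d0)) // /psumV !hornerE.
have : 1 - t ^+ (k * d) != 0.
  have : (0 < k * d)%N by rewrite muln_gt0 k0.
  by case: (k * d)%N => // n _; rewrite subr_eq0 eq_sym tq1.
move: (tq Fq) t0 => u u0.
have e1 : (u ^+ M) ^+ (k * d) = u ^+ (d * M * k).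
  by rewrite -exprM; congr (u ^+ _); lia.
have e2 : ((u ^+ d) ^+ M) ^+ k = u ^+ (d * M * k) by rewrite [RHS]exprM [in RHS]exprM.
have e3 : (u ^+ d) ^+ k = u ^+ (k * d) by rewrite -exprM mulnC.
have e : ((-1) ^+ d) ^+ k = - (-1) ^+ (k * d).-1 :> algC.
  have : (0 < k * d)%N by rewrite muln_gt0 k0.
  by rewrite -exprM [(d * k)%N]mulnC; case: (k * d)%N => // n _; rewrite exprS mulN1r.
rewrite exprMn !exprVn e1 e2 e3 e.
have : u ^+ (d * M * k) != 0 by rewrite expf_neq0.
move: (u ^+ (d * M * k)) (u ^+ (k * d)) ((-1) ^+ _) => A B C A0 B1.
rewrite -[RHS]/(- C / A * (1 - A) / (1 - B)); by field; rewrite A0 B1.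
Qed.

(** By [psumV_inv] the left-hand side at [V = t^(-M)] is the value of the Schur
    polynomial in M variables at a geometric progression, for every large M. This
    determines the polynomial, whichever expansion [Qh] is used. *)
Lemma subst_schur D (Qh : {mpoly algC[D]}) (phi : Theta Fq K) (la : intpart) :
  is_pexpansion (schur la) Qh ->
  mmap (@polyC algC) (fun i : 'I_D => psumV (i.+1 * sizeTheta phi)) Qh = thetaW phi la.
Proof.
move=> pe; set d := sizeTheta phi; have d0 : (0 < d)%N := sizeTheta_gt0 phi.
have t0 : t != 0 := tq0 Fq.
pose s := t ^+ d; have s0 : s != 0 by rewrite expf_neq0.
have s1 k : s ^+ k.+1 != 1 := tqX_neq1 Fq k d0.
apply/eqP; rewrite -subr_eq0; apply/eqP.
apply: (@poly_inf_roots _ (fun n => (t ^+ (size la + n))^-1)).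
  by move=> i j /invr_inj /(exps_inj t0 (@tq1 Fq)) /addnI.
move=> n; set M := (size la + n)%N; rewrite hornerD hornerN; apply/eqP; rewrite subr_eq0; apply/eqP.
pose c : algC := (-1) ^+ d / s ^+ M.
transitivity ((schur la M).@[fun i => c * s ^+ i]).
  rewrite pe {1}/mmap horner_sum /mmap rmorph_sum; apply: eq_bigr => m _.
  rewrite /= mevalM mevalC hornerM hornerC; congr (_ * _).
  rewrite /mmap1 horner_prod rmorph_prod; apply: eq_bigr => i _.
  by rewrite /= rmorphXn /= horner_exp psum_meval psumV_inv.
have c0 : c != 0 by rewrite mulf_neq0 ?invr_eq0 ?expf_neq0 // oppr_eq0 oner_eq0.
rewrite (schur_geo s0 s1) ?leq_addr // /thetaW /schurW /schurV !hornerZ exprMn.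
rewrite -/d -/s; move: (schur_const s la) => C0; rewrite -!mulrA; congr (_ * _); rewrite mulrCA; congr (_ * _).
rewrite (@sumn_ord la (size la)) // -prodrXr !horner_prod -big_split; apply: eq_bigr => i _ /=.
rewrite !horner_prod -[X in _ ^+ X]card_ord -prodr_const -big_split; apply: eq_bigr => k _ /=.
have Xd : ((t ^+ M)^-1) ^+ d = (s ^+ M)^-1 by rewrite [LHS]exprVn -exprM mulnC exprM.
rewrite !hornerE Xd.
rewrite mulrBr mulr1; congr (_ - _).
by rewrite [_ * s ^+ M]mulrC mulKf // expf_neq0.
Qed.

(** The element [sym_Theta] is 0 by default when there is no expansion into power
    sums; if it is nonzero then an expansion exists. *)
Lemma specL_sym_Theta (la : intpart) (phi : Theta Fq K) N :
  sym_Theta io (schur la) phi != 0 ->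
  specL N (sym_Theta io (schur la) phi) = (thetaW phi la).[t ^+ N].
Proof.
rewrite /sym_Theta; case: xgetP => [y _ [D [Qh [pe ->]]] _|_]; last by rewrite eqxx.
by rewrite subst_psumV (subst_schur _ pe).
Qed.

Lemma specL_s_mp (la : multipart (Theta Fq K)) N : s_mp io la != 0 ->
  specL N (s_mp io la) = (\prod_(phi <- finsupp la) thetaW phi (la phi)).[t ^+ N].
Proof.
move=> s0; rewrite /s_mp rmorph_prod horner_prod big_seq [RHS]big_seq.
apply: eq_bigr => phi phila /=; apply: specL_sym_Theta.
apply: contraNneq s0 => e; rewrite /s_mp (big_fsetD1 phi) //= e.
by rewrite mul0r.
Qed.

End ThetaEval.

(** * The sum of the degrees *)

Lemma mp_even_conj (X : choiceType) (la : multipart X) :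
  mp_even (mp_conj la) <-> forall x, evenp (la x).
Proof.
have E x : mp_conj la x = conj_part (la x).
  rewrite fsfunE; case: (boolP (x \in finsupp la)) => // xla.
  by rewrite fsfun_dflt //; apply: val_inj; rewrite /= /conj_seq big_nil.
by split=> h x; have := h x; rewrite E.
Qed.

Lemma evenp0 : evenp intpart0.
Proof. by apply/evenpP => i _; rewrite !nth_nil. Qed.

Section RealSign.
Variable s : algC.
Hypothesis sR : s \is Num.real.
Hypothesis s_lt1 : `|s| < 1.
Hypothesis s0 : s != 0.

Lemma one_subX_gt0 k : (0 < k)%N -> 0 < 1 - s ^+ k.
Proof.
move=> k0; rewrite subr_gt0; apply: (@le_lt_trans _ _ `|s ^+ k|).
  by rewrite real_ler_norm // rpredX.
by rewrite normrX exprn_ilt1 // -lt0n.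
Qed.

(** All factors [1 - s^k] are positive. *)
Lemma schur_const_sign (la : intpart) : 0 < schur_const s la / s ^+ npart la.
Proof.
have mono := intpart_mono la.
rewrite /schur_const -!mulrA mulrC -!mulrA mulVf ?expf_neq0 // mulr1.
apply: mulr_gt0.
  apply: prodr_gt0 => j _; apply: prodr_gt0 => i _.
  have ij : (0 < j - i)%N by rewrite subn_gt0.
  by rewrite divr_gt0 ?one_subX_gt0 // addn_gt0 ij orbT.
rewrite invr_gt0; apply: prodr_gt0 => i _; apply: prodr_gt0 => k _.
by rewrite one_subX_gt0 // addn_gt0 subn_gt0 ltn_ord.
Qed.
End RealSign.

Section Final.
Variables (Fq : finFieldType) (K : closedFieldType) (io : {rmorphism Fq -> K}).
Hypothesis Kalg : integralRange io.
Local Notation q := #|Fq|.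
Local Notation t := (tq Fq).

Lemma tR : t \is Num.real. Proof. by rewrite rpredV rpredN realn. Qed.

Lemma tE : t = - (q%:R)^-1. Proof. by rewrite /tq invrN. Qed.

Lemma t_lt1 : `|t| < 1. Proof. by have := @norm_tqX Fq 1 isT; rewrite expr1. Qed.

Lemma qC_gt0 : 0 < q%:R :> algC. Proof. by rewrite ltr0n (ltn_trans _ (q_gt1 Fq)). Qed.

(** The binomial coefficient [2m choose 2] has the parity of m, and t is negative. *)
Lemma ones_coef_sign m : 0 < (-1) ^+ m * ones_coef Fq m.*2.
Proof.
rewrite /ones_coef -[(-1) ^+ m.*2]signr_odd odd_double expr0 mul1r mulrA; apply: mulr_gt0; last first.
  rewrite invr_gt0 big_nat; apply: prodr_gt0 => i /andP[i0 _].
  exact: one_subX_gt0 tR t_lt1 i i0.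
(* by Pascal's rule, going from 2m to 2m+2 adds 4m+1 *)
have odd_bin : odd 'C(m.*2, 2) = odd m.
  elim: m => // m IH; rewrite doubleS binS bin1 binS bin1 !oddD IH /= odd_double.
  by case: (odd m).
have -> : t ^+ 'C(m.*2, 2) = (-1) ^+ m * (q%:R^-1) ^+ 'C(m.*2, 2).
  by rewrite tE [LHS]exprNn -[in LHS]signr_odd odd_bin signr_odd.
by rewrite mulrA -exprMn mulrNN mulr1 expr1n mul1r exprn_gt0 // invr_gt0 qC_gt0.
Qed.

Lemma ones_coef_neq0 m : ones_coef Fq m.*2 != 0.
Proof.
by apply: contraTneq (ones_coef_sign m) => ->; rewrite mulr0 ltxx.
Qed.

(** The powers of t are pairwise different. *)
Lemma poly_tq_eq (p r : {poly algC}) : (forall N, p.[t ^+ N] = r.[t ^+ N]) -> p = r.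
Proof.
move=> h; apply/eqP; rewrite -subr_eq0; apply/eqP.
apply: (@poly_inf_roots _ (fun N => t ^+ N)).
  exact: (exps_inj (tq0 Fq) (@tq1 Fq)).
by move=> N; rewrite hornerD hornerN h subrr.
Qed.

(** Since the degree is positive, [ch chi] is nonzero by [coef_chV], hence so is
    [s_mp la]; this is what the specialization of [s_mp la] requires. *)
Lemma chV_theta m (la : multipart (Theta Fq K)) (chi : 'CF(U io m.*2)) : (0 < m)%N ->
  is_chi la chi ->
  chV chi = \prod_(phi <- finsupp la) thetaW phi (la phi) \/
  chV chi = - \prod_(phi <- finsupp la) thetaW phi (la phi).
Proof.
move=> m0 [chi_gt0 chE].
have n0 : (0 < m.*2)%N by rewrite double_gt0.
have s0 : s_mp io la != 0.
  apply/eqP => e; have ch0 : ch chi = 0 by case: chE => ->; rewrite e ?oppr0.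
  have V0 : chV chi = 0.
    by apply: poly_tq_eq => N; rewrite -(spec_ch Kalg) ch0 horner0; exact: (rmorph0 (@specL Fq K io N)).
  have := coef_chV Kalg chi n0; rewrite V0 coef0 => /esym/eqP.
  by rewrite mulf_eq0 (negPf (ones_coef_neq0 m)) orbF gt_eqF.
have V N := @spec_ch Fq K io Kalg _ chi N.
case: chE => e; [left|right]; apply: poly_tq_eq => N; rewrite -V e.
  exact: specL_s_mp.
rewrite hornerN -(specL_s_mp Kalg) //; exact: (rmorphN (@specL Fq K io N)).
Qed.

(** The contribution of phi to the degree. *)
Definition theta_const (phi : Theta Fq K) (nu : intpart) : algC :=
  schur_const (t ^+ sizeTheta phi) nu.

(** For real s the sign of [s_nu(1, s, s^2, ...)] is that of [s^n(nu)], here of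
    [(-1)^(d n(nu))], which is [(-1)^(d |nu| / 2)] if the conjugate of nu is even. *)
Lemma prod_theta_const_sign (la : multipart (Theta Fq K)) m :
  mp_norm (@sizeTheta Fq K) la = m.*2 -> (forall phi, evenp (la phi)) ->
  0 < (-1) ^+ m * \prod_(phi <- finsupp la) theta_const phi (la phi).
Proof.
move=> lam la_even.
have mE : m = (\sum_(phi <- finsupp la) sizeTheta phi * (sumn (la phi))./2)%N.
  apply: double_inj; rewrite -lam /mp_norm -muln2 big_distrl /=; apply: eq_bigr => phi _.
  by rewrite -mulnA muln2 {1}(evenp_sumn (la_even phi)) (evenp_sumn (la_even phi)) doubleK.
rewrite {1}mE -prodrXr -big_split /=; apply: prodr_gt0 => phi _.
set d := sizeTheta phi; have d0 : (0 < d)%N := sizeTheta_gt0 phi.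
set nu := la phi; pose s := t ^+ d.
have sR : s \is Num.real by rewrite rpredX ?tR.
have s1 : `|s| < 1 := norm_tqX Fq d0.
have s0 : s != 0 by rewrite expf_neq0 // tq0.
have sgn : 0 < (-1) ^+ (d * (sumn nu)./2) * s ^+ npart nu.
  have sE : s = (-1) ^+ d * (q%:R^-1) ^+ d by rewrite /s tE [LHS]exprNn.
  rewrite exprM sE [X in _ * X]exprMn mulrA -exprD -exprM mulnC exprM.
  rewrite -[(-1) ^+ (_ + _)]signr_odd oddD (evenp_npart (la_even phi)) addbb expr0 expr1n mul1r.
  by rewrite !exprn_gt0 // invr_gt0 qC_gt0.
have C0 := schur_const_sign sR s1 s0 nu.
have -> : theta_const phi nu = s ^+ npart nu * (schur_const s nu / s ^+ npart nu).
  by rewrite mulrC divfK // expf_neq0.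
by rewrite mulrA mulr_gt0.
Qed.

(** Compare coefficients of [V^n] on the two sides of [ch chi = +- s_la]. The sign is
    plus, since [chi 1] is positive and the two constants have the same sign. *)
Lemma chi_degree m (la : multipart (Theta Fq K)) (chi : 'CF(U io m.*2)) : (0 < m)%N ->
  mp_norm (@sizeTheta Fq K) la = m.*2 -> (forall phi, evenp (la phi)) ->
  is_chi la chi ->
  chi 1%g = (ones_coef Fq m.*2)^-1 * \prod_(phi <- finsupp la) theta_const phi (la phi).
Proof.
move=> m0 lam la_even chiP; have [chi_gt0 _] := chiP.
have n0 : (0 < m.*2)%N by rewrite double_gt0.
set C := \prod_(phi <- _) _.
(* the degrees d|la(phi)| add up to 2m, so this is the product of top coefficients;
   the signs (-1)^(d|la(phi)|) cancel as 2m is even *)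
have WE : (\prod_(phi <- finsupp la) thetaW phi (la phi))`_m.*2 = C.
  have [_] := @coef_top_prod _ (finsupp la) (fun phi => thetaW phi (la phi))
    (fun phi => sizeTheta phi * sumn (la phi))%N
    (fun phi => proj1 (schurW_top _ _ (sizeTheta_gt0 phi) (la phi))).
  rewrite -[(\sum_(phi <- _) _)%N]/(mp_norm (@sizeTheta Fq K) la) lam => ->.
  under eq_bigr => phi _ do rewrite (proj2 (schurW_top _ _ (sizeTheta_gt0 phi) (la phi))) -exprM.
  rewrite big_split /= prodrXr.
  rewrite -[(\sum_(phi <- _) _)%N]/(mp_norm (@sizeTheta Fq K) la) lam.
  by rewrite -signr_odd odd_double expr0 mul1r.
have k0 := ones_coef_neq0 m; have h1 := ones_coef_sign m; have h2 := prod_theta_const_sign lam la_even.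
have E : chi 1%g * ones_coef Fq m.*2 = C \/ chi 1%g * ones_coef Fq m.*2 = - C.
  rewrite -(coef_chV Kalg chi n0).
  by case: (chV_theta m0 chiP) => ->; [left|right]; rewrite ?coefN WE.
case: E => E; first by rewrite -E mulrC mulfK.
have := mulr_gt0 chi_gt0 h1; rewrite mulrCA E mulrN oppr_gt0 -/C => h3.
by have := lt_trans h2 h3; rewrite ltxx.
Qed.

(** In terms of [Z = X^2], a partition with even conjugate has even size. *)
Lemma theta_series m (phi : Theta Fq K) :
  let d := sizeTheta phi in
  \sum_(nu <- parts_upto m.*2 | evenp nu) theta_const phi nu *: 'X^(d * sumn nu) =
  (even_schur_const (t ^+ d) m \Po 'X^d) \Po 'X^2.
Proof.
move=> d; rewrite /even_schur_const poly_def !rmorph_sum /=.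
under [RHS]eq_bigr => k _ do rewrite !comp_polyZ comp_Xn_poly rmorphXn /= comp_Xn_poly -!exprM big_mkcond scaler_suml.
rewrite exchange_big /= big_mkcond !big_seq; apply: eq_bigr => nu.
rewrite mem_parts_upto => nun; case: (boolP (evenp nu)) => la_even; last first.
  by rewrite big1 // => k _; rewrite scale0r.
have km : ((sumn nu)./2 < m.+1)%N by rewrite ltnS -[m]doubleK half_leq.
have nuE : sumn nu = (sumn nu)./2.*2 by rewrite {1 2}(evenp_sumn la_even) doubleK.
rewrite (bigD1 (Ordinal km)) //= -nuE eqxx big1 ?addr0 => [|k ki].
  by congr (_ *: _); rewrite {1}nuE -!muln2; congr ('X^_); lia.
case: eqP => [e|_]; last by rewrite scale0r.
by case/eqP: ki; apply: val_inj => /=; rewrite e doubleK.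
Qed.

(** The power sums of the factors add up to
    [t^k / ((1 - t^k) (1 - t^(2k)))] times the sum of the orbit sizes dividing k,
    which is [q^k - (-1)^k]; and [(q^k - (-1)^k) t^k = (-1)^k (1 - t^k)]. *)
Lemma theta_newton m (T : {fset Theta Fq K}) :
  (forall phi, (sizeTheta phi <= m)%N -> phi \in T) ->
  newton m (fun k => (-1) ^+ k / (1 - (t ^+ 2) ^+ k))
    (\prod_(phi <- T) (even_schur_const (t ^+ sizeTheta phi) m \Po 'X^(sizeTheta phi))).
Proof.
move=> mT.
have := @newton_prod algC m _ (T : seq _) predT _ _ (fun phi _ =>
  newton_dil (sizeTheta_gt0 phi) (even_schur_newton
     (expf_neq0 (sizeTheta phi) (tq0 Fq)) (fun k => tqX_neq1 Fq k (sizeTheta_gt0 phi)) m)).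
apply: eq_newton => k /andP[k0 km].
rewrite -big_mkcond /=.
transitivity (\sum_(phi <- T | (sizeTheta phi %| k)%N) (sizeTheta phi)%:R *
   (t ^+ k / ((1 - t ^+ k) * (1 - t ^+ k.*2)))).
  apply: eq_bigr => phi dk; congr (_ * _).
  have e := divnK dk; rewrite mulnC in e.
  by rewrite -!exprM -!muln2 mulnA e.
rewrite -mulr_suml -natr_sum (sum_sizeTheta io k0); last first.
  by move=> phi phik; apply: mT; apply: leq_trans phik km.
have -> : (cardM Fq k)%:R = q%:R ^+ k - (-1) ^+ k :> algC.
  have := congr1 (fun z : int => z%:~R : algC) (cardME Fq k).
  by rewrite /= rmorphB !rmorphXn /= rmorphN1.
have tk : (q%:R ^+ k) * t ^+ k = (-1) ^+ k :> algC.
  by rewrite -exprMn tE mulrN divff // q0C.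
have := one_subX_gt0 tR t_lt1 k0; have := one_subX_gt0 tR t_lt1 (_ : (0 < k.*2)%N).
rewrite double_gt0 k0 -muln2 mulnC exprM => /(_ isT) /gt_eqF/negbT h2 /gt_eqF/negbT h1.
move: tk h1 h2; rewrite ![(t ^+ 2) ^+ k]exprAC.
move: (t ^+ k) (q%:R ^+ k) ((-1) ^+ k) => x y z xy h1 h2.
have -> : z = x * y by rewrite -xy mulrC.
by field; rewrite ?h1 ?h2.
Qed.

(** The generating function has the power sums of
    [prod_(i >= 0) (1 + t^(2i) Z)^-1]. *)
Lemma sum_theta_const m : (0 < m)%N ->
  \sum_(la \in [set la : multipart (Theta Fq K) |
      mp_norm (@sizeTheta Fq K) la = m.*2 /\ forall phi, evenp (la phi)])
    \prod_(phi <- finsupp la) theta_const phi (la phi) =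
  (-1) ^+ m / \prod_(i < m) (1 - (t ^+ 2) ^+ i.+1).
Proof.
move=> m0; pose T := fset_set [set phi : Theta Fq K | (sizeTheta phi <= m.*2)%N].
have TP phi : (sizeTheta phi <= m.*2)%N -> phi \in T.
  by move=> h; rewrite in_fset_set ?inE //; apply: (finite_Theta io).
have := @sum_multipart (Theta Fq K) (@sizeTheta Fq K) T m.*2 (@sizeTheta_gt0 Fq K) TP
  algC evenp theta_const evenp0.
move=> ->; last first.
  by move=> phi; rewrite /theta_const /schur_const /hook_factor /npart /= !big_ord0 expr0 mulr1 invr1 mulr1.
under eq_bigr => phi _ do rewrite theta_series.
rewrite -(rmorph_prod (comp_poly 'X^2)) /= coef_comp_poly_Xn // -muln2 dvdn_mull // mulnK //.
have mm : (m <= m.*2)%N by rewrite -addnn leq_addl.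
have N1 := @theta_newton m T (fun phi h => TP phi (leq_trans h mm)).
have t2 k : (t ^+ 2) ^+ k.+1 != 1 by apply: tqX_neq1.
have N2 := newton_qexp m (-1) t2.
by rewrite (newton_uniq N1 N2 (fun i _ => erefl) (leqnn m)) coef_poly ltnSn.
Qed.

Lemma degree_product m :
  (ones_coef Fq m.*2)^-1 * ((-1) ^+ m / \prod_(i < m) (1 - (t ^+ 2) ^+ i.+1)) =
  (\prod_(1 <= i < m.+1) (q ^ (2 * i - 2) * (q ^ (2 * i - 1) + 1)))%N%:R.
Proof.
have q0 : q%:R != 0 :> algC by rewrite gt_eqF ?qC_gt0.
have t0 := tq0 Fq.
have t1 k : (0 < k)%N -> 1 - t ^+ k != 0.
  by move=> k0; rewrite gt_eqF // (one_subX_gt0 tR t_lt1).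
rewrite /ones_coef -[(-1) ^+ m.*2]signr_odd odd_double expr0 mul1r.
elim: m => [|m IH].
  by rewrite !big_geq // big_ord0 expr0 !divr1 invr1 mulr1.
have tm : t ^+ m.*2 = (q%:R ^+ m.*2)^-1.
  by rewrite tE [LHS]exprNn -signr_odd odd_double expr0 mul1r exprVn.
have -> : (\prod_(1 <= i < m.+2) (q ^ (2 * i - 2) * (q ^ (2 * i - 1) + 1)))%N%:R =
    (\prod_(1 <= i < m.+1) (q ^ (2 * i - 2) * (q ^ (2 * i - 1) + 1)))%N%:R *
    (q%:R ^+ m.*2 * (q%:R ^+ m.*2 * q%:R + 1)) :> algC.
  have e1 : (2 * m.+1 - 2 = m.*2)%N by lia.
  have e2 : (2 * m.+1 - 1 = m.*2.+1)%N by lia.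
  by rewrite big_nat_recr //= e1 e2 !natrM natrX natrD natrX exprSr.
rewrite -IH doubleS binS bin1 binS bin1 big_ord_recr /=.
rewrite (big_nat_recr m.*2.+2) //= (big_nat_recr m.*2.+1) //=.
have := t1 m.*2.+1 isT; have := t1 m.*2.+2 isT.
have P0 : \prod_(1 <= i < m.*2.+1) (1 - t ^+ i) != 0.
  by rewrite prodf_seq_neq0; apply/allP => i; rewrite mem_index_iota => /andP[i0 _]; apply: t1.
have B0 : \prod_(i < m) (1 - (t ^+ 2) ^+ i.+1) != 0.
  by apply/prodf_neq0 => i _; rewrite -exprM t1.
have E0 : t ^+ 'C(m.*2, 2) != 0 by rewrite expf_neq0.
have Y0 : q%:R ^+ m.*2 != 0 :> algC by rewrite expf_neq0.
have -> : (t ^+ 2) ^+ m.+1 = t ^+ m.*2.+2 by rewrite -exprM; congr (t ^+ _); lia.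
rewrite !exprD (exprSr _ m.*2.+1) (exprSr t m.*2) tm [(-1) ^+ m.+1]exprS.
have := tE; move: P0 B0 E0 Y0 q0.
move: (q%:R : algC) (\prod_(1 <= i < _) _) (\prod_(i < m) _) (t ^+ 'C(_, _)) (_ ^+ m.*2) ((-1) ^+ m).
move=> u P B E Y S P0 B0 E0 Y0 u0 -> h2 h1.
have g1 : Y * u + 1 != 0.
  by apply: contraNneq h1 => e; rewrite mulrN opprK -(mulrI_eq0 _ (mulfI (mulf_neq0 Y0 u0))); apply/eqP; rewrite -[RHS]e; field; rewrite u0 Y0.
have g2 : Y * u * u - 1 != 0.
  apply: contraNneq h2 => e; rewrite -(mulrI_eq0 _ (mulfI (mulf_neq0 Y0 (mulf_neq0 u0 u0)))).
  by apply/eqP; rewrite -[RHS]e; field; rewrite u0 Y0.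
by field; rewrite B0 P0 E0 u0 Y0 g1 g2.
Qed.

End Final.

Theorem theorem5p3
  (Fq : finFieldType) (K : closedFieldType) (io : {rmorphism Fq -> K})
  (Kalg : integralRange io) (m : nat) (m_ge1 : (1 <= m)%N)
  (chi : multipart (Theta Fq K) -> 'CF(U io (2 * m)))
  (chiP : forall la : multipart (Theta Fq K),
     mp_norm (@sizeTheta Fq K) la = (2 * m)%N -> is_chi la (chi la)) :
  \sum_(la \in [set la : multipart (Theta Fq K) |
      mp_norm (@sizeTheta Fq K) la = (2 * m)%N /\ mp_even (mp_conj la)])
    chi la 1%g
  = (\prod_(1 <= i < m.+1)
      (#|Fq| ^ (2 * i - 2) * (#|Fq| ^ (2 * i - 1) + 1)))%N%:R.
Proof.
rewrite -(degree_product Fq m) -(sum_theta_const io m_ge1).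
move: chi chiP; rewrite mul2n => chi chiP.
rewrite mulr_fsumr.
have -> : [set la : multipart (Theta Fq K) |
      mp_norm (@sizeTheta Fq K) la = m.*2 /\ mp_even (mp_conj la)] =
    [set la | mp_norm (@sizeTheta Fq K) la = m.*2 /\ forall phi, evenp (la phi)].
  by apply/seteqP; split=> la [lam /mp_even_conj la_even].
apply: eq_fsbigr => la; rewrite inE => -[lam la_even].
by apply: (chi_degree Kalg) => //; apply: chiP.
Qed.
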